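(* Let $L$ be a nondegenerate even lattice of finite rank, $\mathfrak h=\mathbb C\otimes_{\mathbb Z}L$, and let $f:\mathfrak h\to\mathfrak h\otimes x\mathbb C[[x]]$, $\alpha\mapsto f(\alpha,x)$, be any linear map. Then there exists a $B_L$-module structure $Y_M^f(\cdot,x)$ on $V_L$, which is uniquely determined by $$Y_M^f(e^\alpha,z)=\exp\big(\Phi(f(\alpha,x))(z)\big)\qquad\text{for }\alpha\in L,$$ and $V_L$ with this $B_L$-module structure becomes a $B_L$-module vertex algebra. Furthermore, $Y_M^f(\cdot,x)$ is compatible with $\rho$, and $Y_M^f$ is an invertible element of $\mathfrak L_{B_L}^\rho(V_L)$ (with respect to the operation $*$).
   Context: All vector spaces are over $\mathbb C$; $(x-z)^n$ is expanded in nonnegative powers of $z$. A nonlocal vertex algebra is a vector space $V$ with a linear map $Y(\cdot,x):V\to(\mathrm{End}\,V)[[x,x^{-1}]]$, $Y(v,x)=\sum v_nx^{-n-1}$, and $\mathbf 1\in V$ such that $Y(u,x)v\in V((x))$; $Y(\mathbf 1,x)v=v$, $Y(v,x)\mathbf 1\in V[[x]]$ with $\lim_{x\to0}Y(v,x)\mathbf 1=v$; and for $u,v\in V$ there is $k\ge 0$ with $(x_1-x_2)^kY(u,x_1)Y(v,x_2)\in \mathrm{Hom}(V,V((x_1,x_2)))$ and $\big((x_1-x_2)^kY(u,x_1)Y(v,x_2)\big)|_{x_1=x_2+x_0}=x_0^kY(Y(u,x_0)v,x_2)$. Modules $(W,Y_W)$ satisfy the analogous axioms. A vertex algebra is one satisfying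 locality. A (nonlocal) vertex bialgebra is a (nonlocal) vertex algebra $H$ with a coalgebra structure $(\Delta,\varepsilon)$ for which $\Delta,\varepsilon$ are homomorphisms of nonlocal vertex algebras. An $H$-module (nonlocal) vertex algebra is a (nonlocal) vertex algebra $V$ with an $H$-module structure $Y_V^H$ with $Y_V^H(h,x)v\in V\otimes\mathbb C((x))$, $Y_V^H(h,x)\mathbf 1=\varepsilon(h)\mathbf 1$, $Y_V^H(h,x_1)Y(u,x_2)v=\sum Y(Y_V^H(h_{(1)},x_1-x_2)u,x_2)Y_V^H(h_{(2)},x_1)v$. A right $H$-comodule vertex algebra structure on $V$ is a homomorphism of nonlocal vertex algebras $\rho:V\to V\otimes H$ with $(\rho\otimes1)\rho=(1\otimes\Delta)\rho$, $(1\otimes\varepsilon)\rho=\mathrm{Id}_V$; $Y_V^H$ is compatible with $\rho$ if $\rho(Y_V^H(h,x)v)=(Y_V^H(h,x)\otimes1)\rho(v)$. $\mathfrak L_H^\rho(V)$ is the set of $H$-module nonlocal vertex algebra structures on $V$ compatible with $\rho$. For $Y_M,Y_M'\in\mathrm{Hom}(H,\mathrm{Hom}(V,V\otimes\mathbb C((x))))$, $(Y_M*Y_M')(h,x)=\sum Y_M(h_{(1)},x)Y_M'(h_{(2)},x)$ (product in $\mathrm{Hom}(V,V\otimes \mathbb C((x)))\cong\mathrm{End}_{\mathbb C((x))}(V\otimes\mathbb C((x)))$); the identity is $Y_M^\varepsilon(h,x)v=\varepsilon(h)v$. Lattice vertex algebra. Let $L$ be a finite rank even lattice with nondegenerate form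 $\langle\cdot,\cdot\rangle$, extended to $\mathfrak h$. $\widehat{\mathfrak h}=\mathfrak h\otimes\mathbb C[t,t^{-1}]+\mathbb C\mathbf k$ with $\mathbf k$ central, $[\alpha(m),\beta(n)]=m\delta_{m+n,0}\langle\alpha,\beta\rangle\mathbf k$, $\alpha(m)=\alpha\otimes t^m$; $\widehat{\mathfrak h}^-=\mathfrak h\otimes t^{-1}\mathbb C[t^{-1}]$. Let $\epsilon:L\times L\to\mathbb C^\times$ be a 2-cocycle with $\epsilon(\alpha,\beta)\epsilon(\beta,\alpha)^{-1}=(-1)^{\langle\alpha,\beta\rangle}$, $\epsilon(\alpha,0)=1=\epsilon(0,\alpha)$, and $\mathbb C_\epsilon[L]$ the twisted group algebra with basis $e_\alpha$, $e_\alpha e_\beta=\epsilon(\alpha,\beta)e_{\alpha+\beta}$, on which $h(n)$, $n\ne0$, and $\mathbf k$ act as $0$ and $h(0)e_\beta=\langle h,\beta\rangle e_\beta$. $V_L=S(\widehat{\mathfrak h}^-)\otimes\mathbb C_\epsilon[L]$ (level 1), $\mathbf 1=1\otimes e_0$, $\mathfrak h,\mathbb C_\epsilon[L]\subset V_L$ via $a\mapsto a(-1)\otimes1$, $e_\alpha\mapsto1\otimes e_\alpha$; the vertex algebra structure is determined by $Y(h,z)=\sum_{n}h(n)z^{-n-1}$, $Y(e_\alpha,z)=E^-(-\alpha,z)E^+(-\alpha,z)e_\alpha z^\alpha$, with $E^\pm(\alpha,z)=\exp\big(\sum_{n\ge1}\frac{\alpha(\pm n)}{\pm n}z^{\mp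 n}\big)$, $z^\alpha e_\beta=z^{\langle\alpha,\beta\rangle}e_\beta$. Vertex bialgebra $B_L=S(\widehat{\mathfrak h}^-)\otimes\mathbb C[L]$, with $\mathbb C[L]$ the group algebra with basis $e^\alpha$: $\Delta(h(-n))=h(-n)\otimes1+1\otimes h(-n)$, $\Delta(e^\alpha)=e^\alpha\otimes e^\alpha$, $\varepsilon(h(-n))=0$, $\varepsilon(e^\alpha)=1$; derivation $\partial(h(-n))=nh(-n-1)$, $\partial(u\otimes e^\alpha)=\alpha(-1)u\otimes e^\alpha+\partial u\otimes e^\alpha$; $Y_{B_L}(a,x)b=(e^{x\partial}a)b$. $\rho:V_L\to V_L\otimes B_L$ is the right $B_L$-comodule vertex algebra structure uniquely determined by $\rho(h)=h\otimes1+1\otimes h(-1)$, $\rho(e_\alpha)=e_\alpha\otimes e^\alpha$. For $a\in\mathfrak h$, $g(x)\in\mathbb C((x))$, $\Phi(a\otimes g(x))(z)=\sum_{n\ge0}\frac{(-1)^n}{n!}g^{(n)}(z)a_n$ on $V_L$ (with $a_n=a(n)$), extended linearly to $\Phi(G(x))(z)$ for $G(x)\in\mathfrak h\otimes\mathbb C((x))$ (and to $\mathfrak h\otimes x\mathbb C[[x]]$ in particular). *)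

(* Defs.v *)
From HB Require Import structures.
From mathcomp Require Import all_boot all_order all_algebra finmap.
From mathcomp Require Import generic_quotient.
From mathcomp.multinomials Require Import monalg.
From mathcomp Require Import boolp classical_sets fsbigop reals.
From mathcomp.real_closed Require Import complex.

Set Implicit Arguments.
Unset Strict Implicit.
Unset Printing Implicit Defensive.

Import Order.TTheory GRing.Theory Num.Theory.

Local Open Scope ring_scope.

Definition bilin (F : numFieldType) (U V W : lmodType F) (b : U -> V -> W) :
    Prop :=
  (forall v, linear (fun u => b u v)) /\ (forall u, linear (b u)).

(* A list [:: (v1, w1); ...; (vk, wk)] stands for the formal sum of the       *)
(* vi (x) wi.  Two formal sums agree in the tensor product iff every bilinear *)
(* map takes the same value on them, so that quotienting by tens_eq produces  *)
(* the space with the universal property (see tliftE).                        *)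
Definition tens_eq (F : numFieldType) (V W : lmodType F) : rel (seq (V * W)) :=
  fun s t => `[< forall (U : lmodType F) (b : V -> W -> U), bilin b ->
     \sum_(p <- s) b p.1 p.2 = \sum_(p <- t) b p.1 p.2 >].

Lemma tens_eq_refl (F : numFieldType) (V W : lmodType F) :
  reflexive (@tens_eq F V W).
Proof. by move=> s; apply/asboolP. Qed.

Lemma tens_eq_sym (F : numFieldType) (V W : lmodType F) :
  symmetric (@tens_eq F V W).
Proof. by move=> s t; apply/asboolP/asboolP => h U b /h. Qed.

Lemma tens_eq_trans (F : numFieldType) (V W : lmodType F) :
  transitive (@tens_eq F V W).
Proof.
move=> t s r /asboolP h1 /asboolP h2; apply/asboolP => U b hb.
by rewrite h1 // h2.
Qed.

Canonical tens_eq_equiv (F : numFieldType) (V W : lmodType F) :=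
  EquivRel (@tens_eq F V W) (@tens_eq_refl F V W) (@tens_eq_sym F V W)
    (@tens_eq_trans F V W).

Definition tensor (F : numFieldType) (V W : lmodType F) :=
  {eq_quot (@tens_eq F V W)}%qT.

HB.instance Definition _ (F : numFieldType) (V W : lmodType F) :=
  Choice.on (tensor V W).
HB.instance Definition _ (F : numFieldType) (V W : lmodType F) :=
  EqQuotient.on (tensor V W).

Definition mktens (F : numFieldType) (V W : lmodType F) (s : seq (V * W)) :
    tensor V W := (\pi_(tensor V W) s)%qT.

(* The linear map out of a tensor product induced by a bilinear map; Sweedler *)
(* sums "\sum b h_(1) h_(2)" are tlift b (Delta h).                           *)
Definition tlift (F : numFieldType) (V W : lmodType F) (U : zmodType)
    (b : V -> W -> U) (t : tensor V W) : U :=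
  \sum_(p <- repr t) b p.1 p.2.

Lemma mktens_repr (F : numFieldType) (V W : lmodType F) (t : tensor V W) :
  mktens (repr t) = t.
Proof. exact: reprK. Qed.

Lemma eq_mktens (F : numFieldType) (V W : lmodType F) (s t : seq (V * W)) :
  (forall (U : lmodType F) (b : V -> W -> U), bilin b ->
     \sum_(p <- s) b p.1 p.2 = \sum_(p <- t) b p.1 p.2) ->
  mktens s = mktens t.
Proof. by move=> h; apply/eqmodP/asboolP. Qed.

Lemma tlift_mktens (F : numFieldType) (V W U : lmodType F) (b : V -> W -> U)
    (s : seq (V * W)) :
  bilin b -> tlift b (mktens s) = \sum_(p <- s) b p.1 p.2.
Proof.
move=> hb; have /eqmodP/asboolP h : mktens (repr (mktens s)) = mktens s.
  exact: mktens_repr.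
exact: h.
Qed.

Definition tens_zero (F : numFieldType) (V W : lmodType F) : tensor V W :=
  mktens [::].
Definition tens_scale (F : numFieldType) (V W : lmodType F) (a : F)
    (t : tensor V W) : tensor V W :=
  mktens [seq (a *: p.1, p.2) | p <- repr t].
Definition tens_opp (F : numFieldType) (V W : lmodType F) (t : tensor V W) :
  tensor V W := tens_scale (-1) t.
Definition tens_add (F : numFieldType) (V W : lmodType F) (s t : tensor V W) :
  tensor V W := mktens (repr s ++ repr t).

Lemma bilinZ (F : numFieldType) (U V W : lmodType F) (b : U -> V -> W) a u v :
  bilin b -> b (a *: u) v = a *: b u v.
Proof.
move=> [h _]; have b0 : b 0 v = 0.
  by have := h v (-1) 0 0; rewrite scaler0 addr0 scaleN1r addNr.
by have := h v a u 0; rewrite b0 !addr0.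
Qed.

Lemma tlift_add (F : numFieldType) (V W U : lmodType F) (b : V -> W -> U) s t :
  bilin b -> tlift b (tens_add s t) = tlift b s + tlift b t.
Proof. by move=> hb; rewrite tlift_mktens // big_cat. Qed.

Lemma tlift_scale (F : numFieldType) (V W U : lmodType F) (b : V -> W -> U) a t :
  bilin b -> tlift b (tens_scale a t) = a *: tlift b t.
Proof.
move=> hb; rewrite tlift_mktens // big_map scaler_sumr.
by apply: eq_bigr => p _; rewrite (bilinZ a).
Qed.

Lemma tlift_zero (F : numFieldType) (V W U : lmodType F) (b : V -> W -> U) :
  bilin b -> tlift b (tens_zero V W) = 0.
Proof. by move=> hb; rewrite tlift_mktens // big_nil. Qed.

Lemma tensP (F : numFieldType) (V W : lmodType F) (s t : tensor V W) :
  (forall (U : lmodType F) (b : V -> W -> U), bilin b -> tlift b s = tlift b t) ->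
  s = t.
Proof.
by move=> h; rewrite -[s]mktens_repr -[t]mktens_repr; apply: eq_mktens => U b /h.
Qed.

Lemma tens_addA (F : numFieldType) (V W : lmodType F) :
  associative (@tens_add F V W).
Proof. by move=> s t r; apply: tensP => U b hb; rewrite !tlift_add ?addrA. Qed.

Lemma tens_addC (F : numFieldType) (V W : lmodType F) :
  commutative (@tens_add F V W).
Proof. by move=> s t; apply: tensP => U b hb; rewrite !tlift_add // addrC. Qed.

Lemma tens_add0 (F : numFieldType) (V W : lmodType F) :
  left_id (tens_zero V W) (@tens_add F V W).
Proof.
by move=> s; apply: tensP => U b hb; rewrite tlift_add // tlift_zero // add0r.
Qed.

Lemma tens_addN (F : numFieldType) (V W : lmodType F) :
  left_inverse (tens_zero V W) (@tens_opp F V W) (@tens_add F V W).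
Proof.
move=> s; apply: tensP => U b hb.
by rewrite tlift_add // tlift_scale // tlift_zero // scaleN1r addNr.
Qed.

HB.instance Definition _ (F : numFieldType) (V W : lmodType F) :=
  GRing.isZmodule.Build (tensor V W) (@tens_addA F V W) (@tens_addC F V W)
    (@tens_add0 F V W) (@tens_addN F V W).

Lemma tens_scaleA (F : numFieldType) (V W : lmodType F) (a b : F)
    (t : tensor V W) :
  tens_scale a (tens_scale b t) = tens_scale (a * b) t.
Proof. by apply: tensP => U c hc; rewrite !tlift_scale // scalerA. Qed.

Lemma tens_scale1 (F : numFieldType) (V W : lmodType F) :
  left_id 1 (@tens_scale F V W).
Proof. by move=> t; apply: tensP => U c hc; rewrite tlift_scale // scale1r. Qed.

Lemma tens_scaleDr (F : numFieldType) (V W : lmodType F) :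
  right_distributive (@tens_scale F V W) +%R.
Proof.
move=> a s t; apply: tensP => U c hc.
by rewrite !(tlift_scale, tlift_add) // scalerDr.
Qed.

Lemma tens_scaleDl (F : numFieldType) (V W : lmodType F) (t : tensor V W) :
  {morph (@tens_scale F V W)^~ t : a b / a + b}.
Proof.
move=> a b; apply: tensP => U c hc.
by rewrite !(tlift_scale, tlift_add) // scalerDl.
Qed.

HB.instance Definition _ (F : numFieldType) (V W : lmodType F) :=
  GRing.Zmodule_isLmodule.Build F (tensor V W) (@tens_scaleA F V W)
    (@tens_scale1 F V W) (@tens_scaleDr F V W) (@tens_scaleDl F V W).

Definition tens (F : numFieldType) (V W : lmodType F) (v : V) (w : W) :
  tensor V W := mktens [:: (v, w)].

Lemma tliftE (F : numFieldType) (V W U : lmodType F) (b : V -> W -> U) v w :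
  bilin b -> tlift b (tens v w) = b v w.
Proof. by move=> hb; rewrite tlift_mktens // big_seq1. Qed.

Definition tmap (F : numFieldType) (V W V' W' : lmodType F)
    (f : V -> V') (g : W -> W') : tensor V W -> tensor V' W' :=
  tlift (fun v w => tens (f v) (g w)).

Definition tassoc (F : numFieldType) (U V W : lmodType F) :
    tensor (tensor U V) W -> tensor U (tensor V W) :=
  tlift (fun t w => tlift (fun u v => tens u (tens v w)) t).

(* A series \sum_m s_m x^m is the function s : int -> V of its coefficients.  *)
(* Infinite sums of coefficients are finitely supported big operators; they   *)
(* are only used where all but finitely many terms vanish.                    *)
Definition laurent (V : zmodType) (s : int -> V) : Prop :=
  exists N : int, forall m, m < N -> s m = 0.

Definition laurent2 (V : zmodType) (P : int -> int -> V) : Prop :=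
  exists N : int, forall a b, (a < N) || (b < N) -> P a b = 0.

Definition cst_series (V : zmodType) (v : V) : int -> V :=
  fun m => if m == 0 then v else 0.

(* V (x) F((x)), as a subspace of V((x)) *)
Definition tens_laurent (F : numFieldType) (V : lmodType F) (s : int -> V) :
    Prop :=
  exists (k : nat) (v : 'I_k -> V) (g : 'I_k -> int -> F),
    (forall i, laurent (g i)) /\ (forall m, s m = \sum_(i < k) g i m *: v i).

(* the coefficient of y^j in (x + y)^a is ibin F a j * x^(a - j) *)
Definition ibin (F : numFieldType) (a : int) (j : nat) : F :=
  (\prod_(i < j) (a%:~R - i%:R)) / (j`!)%:R.

(* (x1 - x2)^k P(x1, x2) *)
Definition mul_diff (F : numFieldType) (V : lmodType F) (k : nat)
    (P : int -> int -> V) (a b : int) : V :=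
  \sum_(i < k.+1) ((-1) ^+ i *+ 'C(k, i) : F) *:
    P (a - (k - i)%N%:Z) (b - i%:Z).

(* the coefficient of x0^p x2^c in P(x2 + x0, x2) *)
Definition subst_sum (F : numFieldType) (V : lmodType F)
    (P : int -> int -> V) (p c : int) : V :=
  if p is Posz j then
    \sum_(a \in [set: int]) ibin F a j *: P a (c + j%:Z - a)
  else 0.

(* composition of A(x) and B(x), A being extended F((x))-linearly *)
Definition scomp (U V W : zmodType) (A : V -> int -> W) (B : U -> int -> V) :
    U -> int -> W :=
  fun u m => \sum_(j \in [set: int]) A (B u j) (m - j).

Definition spow (V : zmodType) (A : V -> int -> V) (k : nat) : V -> int -> V :=
  iter k (scomp A) (@cst_series V).

Definition sexp (F : numFieldType) (V : lmodType F) (A : V -> int -> V) :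
    V -> int -> V :=
  fun v m => \sum_(k \in [set: nat]) (k`!%:R^-1 : F) *: spow A k v m.

Definition sderiv (F : numFieldType) (g : int -> F) : int -> F :=
  fun m => (m + 1)%:~R * g (m + 1).

(* vop u v m is the coefficient of x^m in Y(u, x)v, i.e. u_(-m-1) v *)
Record preva (F : numFieldType) (V : lmodType F) :=
  PreVA { vac : V; vop : V -> V -> int -> V }.

Definition weak_assoc (F : numFieldType) (V W : lmodType F)
    (YV : V -> V -> int -> V) (YW : V -> W -> int -> W) : Prop :=
  forall u v, exists k : nat, forall w,
    let P := mul_diff k (fun a b => YW u (YW v w b) a) in
    laurent2 P /\
    forall p c, subst_sum P p c = YW (YV u v (p - k%:Z)) w c.

Definition local (F : numFieldType) (V : lmodType F) (A : preva V) : Prop :=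
  forall u v, exists k : nat, forall w a b,
    mul_diff k (fun a b => vop A u (vop A v w b) a) a b =
    mul_diff k (fun a b => vop A v (vop A u w a) b) a b.

Record is_nlva (F : numFieldType) (V : lmodType F) (A : preva V) : Prop := {
  nlva_bilin : forall m, bilin (fun u v => vop A u v m);
  nlva_laurent : forall u v, laurent (vop A u v);
  nlva_vacl : forall v, vop A (vac A) v = cst_series v;
  nlva_vacr : forall v m, m < 0 -> vop A v (vac A) m = 0;
  nlva_vacr0 : forall v, vop A v (vac A) 0 = v;
  nlva_assoc : weak_assoc (vop A) (vop A) }.

Definition is_va (F : numFieldType) (V : lmodType F) (A : preva V) : Prop :=
  is_nlva A /\ local A.

Record is_module (F : numFieldType) (V W : lmodType F) (A : preva V)
    (YW : V -> W -> int -> W) : Prop := {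
  module_bilin : forall m, bilin (fun u w => YW u w m);
  module_laurent : forall u w, laurent (YW u w);
  module_vac : forall w, YW (vac A) w = cst_series w;
  module_assoc : weak_assoc (vop A) YW }.

Record is_va_hom (F : numFieldType) (V W : lmodType F) (A : preva V)
    (B : preva W) (f : V -> W) : Prop := {
  va_hom_linear : linear f;
  va_hom_vac : f (vac A) = vac B;
  va_hom_vop : forall u v m, f (vop A u v m) = vop B (f u) (f v) m }.

Definition unit_va (F : numFieldType) : preva F^o :=
  PreVA (1 : F^o) (fun a b => cst_series (a * b : F^o)).

(* Y(u (x) h, x)(v (x) k) = Y(u, x)v (x) Y(h, x)k *)
Definition tensor_va (F : numFieldType) (V H : lmodType F) (A : preva V)
    (B : preva H) : preva (tensor V H) :=
  PreVA (tens (vac A) (vac B))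
    (fun s t m => tlift (fun u h => tlift (fun v k =>
       \sum_(j \in [set: int]) tens (vop A u v j) (vop B h k (m - j))) t) s).

Record prevb (F : numFieldType) (H : lmodType F) := PreVB {
  vb_va :> preva H;
  comul : H -> tensor H H;
  counit : H -> F^o }.

Record is_coalgebra (F : numFieldType) (H : lmodType F)
    (D : H -> tensor H H) (e : H -> F^o) : Prop := {
  comul_linear : linear D;
  counit_linear : linear e;
  coassoc : forall h, tassoc (tmap D id (D h)) = tmap id D (D h);
  counitl : forall h, tlift (fun h1 h2 => e h1 *: h2) (D h) = h;
  counitr : forall h, tlift (fun h1 h2 => e h2 *: h1) (D h) = h }.

Record is_nlvb (F : numFieldType) (H : lmodType F) (B : prevb H) : Prop := {
  nlvb_nlva : is_nlva B;
  nlvb_coalgebra : is_coalgebra (comul B) (counit B);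
  nlvb_comul : is_va_hom B (tensor_va B B) (comul B);
  nlvb_counit : is_va_hom B (unit_va F) (counit B) }.

(* In the last field, the coefficient of x1^a x2^b of                         *)
(*   \sum Y(YM(h_(1), x1 - x2)u, x2) YM(h_(2), x1)v,                          *)
(* the summation index (m, k) selecting the term of                           *)
(*   (x1 - x2)^m = \sum_k ibin F m k * x1^(m - k) * (-x2)^k.                  *)
Record is_module_nlva (F : numFieldType) (H V : lmodType F) (B : prevb H)
    (A : preva V) (YM : H -> V -> int -> V) : Prop := {
  module_nlva_nlvb : is_nlvb B;
  module_nlva_nlva : is_nlva A;
  module_nlva_module : is_module B YM;
  module_nlva_tens : forall h v, tens_laurent (YM h v);
  module_nlva_vac : forall h,
    YM h (vac A) = cst_series (counit B h *: vac A);
  module_nlva_vop : forall h u v a b,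
    YM h (vop A u v b) a =
    tlift (fun h1 h2 => \sum_(mk \in [set: int * nat])
        (ibin F mk.1 mk.2 * (-1) ^+ mk.2) *:
          vop A (YM h1 u mk.1) (YM h2 v (a - mk.1 + mk.2%:Z)) (b - mk.2%:Z))
      (comul B h) }.

Definition is_module_va (F : numFieldType) (H V : lmodType F) (B : prevb H)
    (A : preva V) (YM : H -> V -> int -> V) : Prop :=
  [/\ is_module_nlva B A YM, local B & local A].

Record is_comodule_nlva (F : numFieldType) (H V : lmodType F) (B : prevb H)
    (A : preva V) (rho : V -> tensor V H) : Prop := {
  comodule_hom : is_va_hom A (tensor_va A B) rho;
  comodule_coassoc : forall v,
    tassoc (tmap rho id (rho v)) = tmap id (comul B) (rho v);
  comodule_counit : forall v,
    tlift (fun w h => counit B h *: w) (rho v) = v }.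

Definition compatible (F : numFieldType) (H V : lmodType F)
    (rho : V -> tensor V H) (YM : H -> V -> int -> V) : Prop :=
  forall h v m, rho (YM h v m) = tmap (fun w => YM h w m) id (rho v).

Definition frakL (F : numFieldType) (H V : lmodType F) (B : prevb H)
    (A : preva V) (rho : V -> tensor V H) (YM : H -> V -> int -> V) : Prop :=
  is_module_nlva B A YM /\ compatible rho YM.

Definition conv (F : numFieldType) (H V : lmodType F) (B : prevb H)
    (YM YM' : H -> V -> int -> V) : H -> V -> int -> V :=
  fun h v m => tlift (fun h1 h2 => scomp (YM h1) (YM' h2) v m) (comul B h).

Definition Yeps (F : numFieldType) (H V : lmodType F) (B : prevb H) :
    H -> V -> int -> V :=
  fun h v => cst_series (counit B h *: v).

Definition invertible_frakL (F : numFieldType) (H V : lmodType F)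
    (B : prevb H) (A : preva V) (rho : V -> tensor V H)
    (YM : H -> V -> int -> V) : Prop :=
  frakL B A rho YM /\
  exists YM', [/\ frakL B A rho YM', conv B YM YM' = Yeps B
                & conv B YM' YM = Yeps B].

(* L = Z^n (row vectors) with the form of Gram matrix G; h = F^n.             *)
Definition lform (n : nat) (G : 'M[int]_n) (a b : 'rV[int]_n) : int :=
  (a *m G *m b^T) 0 0.

Definition hform (F : numFieldType) (n : nat) (G : 'M[int]_n)
    (a b : 'rV[F]_n) : F :=
  (a *m map_mx intr G *m b^T) 0 0.

Definition hvec (F : numFieldType) (n : nat) (a : 'rV[int]_n) : 'rV[F]_n :=
  map_mx intr a.

Definition nondeg_even_lattice (n : nat) (G : 'M[int]_n) : Prop :=
  [/\ G^T = G, (forall a, (2 %| lform G a a)%Z) & \det G != 0].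

Record is_lattice_cocycle (F : numFieldType) (n : nat) (G : 'M[int]_n)
    (eps : 'rV[int]_n -> 'rV[int]_n -> F) : Prop := {
  cocycle_neq0 : forall a b, eps a b != 0;
  cocycleE : forall a b c, eps a b * eps (a + b) c = eps b c * eps a (b + c);
  cocycle0r : forall a, eps a 0 = 1;
  cocycle0l : forall a, eps 0 a = 1;
  cocycle_comm : forall a b, eps a b / eps b a = (-1) ^ lform G a b }.

(* fock is the space S(h^-) (x) F[L] underlying both V_L and B_L.  S(h^-) is  *)
(* the polynomial algebra in the variables (i, m) : 'I_n * nat, the variable  *)
(* (i, m) standing for b_i(-(m+1)), where (b_i) is the basis of L.            *)
Notation smonom n := {cmonom ('I_n * nat)%type}.

Definition fock (F : numFieldType) (n : nat) :=
  {malg F[(smonom n * 'rV[int]_n)%type]}.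

HB.instance Definition _ (F : numFieldType) (n : nat) :=
  GRing.Lmodule.on (fock F n).

(* M (x) e_a *)
Definition bas (F : numFieldType) (n : nat) (M : smonom n) (a : 'rV[int]_n) :
  fock F n := << (M, a) >>.

Definition linext (F : numFieldType) (n : nat) (U : lmodType F)
    (phi : smonom n -> 'rV[int]_n -> U) (v : fock F n) : U :=
  \sum_(p <- msupp v) v@_p *: phi p.1 p.2.

Definition fock1 (F : numFieldType) (n : nat) : fock F n :=
  bas F (onecm _) 0.

Definition fock_e (F : numFieldType) (n : nat) (a : 'rV[int]_n) : fock F n :=
  bas F (onecm _) a.

(* a(-m-1) (x) e_0 *)
Definition fock_h (F : numFieldType) (n : nat) (a : 'rV[F]_n) (m : nat) :
    fock F n :=
  \sum_i a 0 i *: bas F (ucm (i, m)) 0.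

(* The operator a(k): multiplication by a(k) for k < 0, the derivation of     *)
(* S(h^-) with b(-j) |-> k <a, b> delta_(k,j) for k > 0.                      *)
Definition mode (F : numFieldType) (n : nat) (G : 'M[int]_n) (a : 'rV[F]_n)
    (k : int) : fock F n -> fock F n :=
  match k with
  | Negz m => linext (fun M b =>
      \sum_i a 0 i *: bas F (mulcm (ucm (i, m)) M) b)
  | Posz 0 => linext (fun M b => hform G a (hvec F b) *: bas F M b)
  | Posz m.+1 => linext (fun M b =>
      \sum_i (m.+1%:R * hform G a (delta_mx 0 i) * (M (i, m))%:R) *:
        bas F (divcm M (ucm (i, m))) b)
  end.

Definition Eminus (F : numFieldType) (n : nat) (G : 'M[int]_n) (a : 'rV[F]_n) :
    fock F n -> int -> fock F n :=
  sexp (fun v m => if 0 < m then ((- m)%:~R^-1 : F) *: mode G a (- m) v else 0).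

Definition Eplus (F : numFieldType) (n : nat) (G : 'M[int]_n) (a : 'rV[F]_n) :
    fock F n -> int -> fock F n :=
  sexp (fun v m => if m < 0 then ((- m)%:~R^-1 : F) *: mode G a (- m) v else 0).

(* e_a z^a *)
Definition ez (F : numFieldType) (n : nat) (G : 'M[int]_n)
    (eps : 'rV[int]_n -> 'rV[int]_n -> F) (a : 'rV[int]_n) :
    fock F n -> int -> fock F n :=
  fun v m => linext (fun M b =>
    if m == lform G a b then eps a b *: bas F M (a + b) else 0) v.

Record is_lattice_va (F : numFieldType) (n : nat) (G : 'M[int]_n)
    (eps : 'rV[int]_n -> 'rV[int]_n -> F) (A : preva (fock F n)) : Prop := {
  lattice_va_va : is_va A;
  lattice_va_vac : vac A = fock1 F n;
  lattice_va_h : forall (a : 'rV[F]_n) v m,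
    vop A (fock_h a 0) v m = mode G a (- m - 1) v;
  lattice_va_e : forall a : 'rV[int]_n,
    vop A (fock_e F a) =
    scomp (Eminus G (- hvec F a)) (scomp (Eplus G (- hvec F a)) (ez G eps a)) }.

Definition bl_mul (F : numFieldType) (n : nat) (u v : fock F n) : fock F n :=
  linext (fun M a => linext (fun N b => bas F (mulcm M N) (a + b)) v) u.

Definition bl_der (F : numFieldType) (n : nat) : fock F n -> fock F n :=
  linext (fun M a =>
    \sum_(x <- finsupp M) ((M x * x.2.+1)%N%:R : F) *:
        bas F (mulcm (ucm (x.1, x.2.+1)) (divcm M (ucm x))) a
    + \sum_i ((a 0 i)%:~R : F) *: bas F (mulcm (ucm (i, 0%N)) M) a).

Definition bl_va (F : numFieldType) (n : nat) : preva (fock F n) :=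
  PreVA (fock1 F n)
    (fun a b m => if m is Posz j then
       (j`!%:R^-1 : F) *: bl_mul (iter j (@bl_der F n) a) b else 0).

(* the product of the algebra B_L (x) B_L *)
Definition bl_tmul (F : numFieldType) (n : nat)
    (s t : tensor (fock F n) (fock F n)) : tensor (fock F n) (fock F n) :=
  tlift (fun a b =>
    tlift (fun c d => tens (bl_mul a c) (bl_mul b d)) t) s.

(* The algebra morphism for which the variables are primitive and the e^a     *)
(* are grouplike.                                                             *)
Definition bl_comul (F : numFieldType) (n : nat) :
    fock F n -> tensor (fock F n) (fock F n) :=
  linext (fun M a =>
    bl_tmul
      (\big[@bl_tmul F n/tens (fock1 F n) (fock1 F n)]_(x <- finsupp M)
         iter (M x)
           (bl_tmul (tens (bas F (ucm x) 0) (fock1 F n)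
                     + tens (fock1 F n) (bas F (ucm x) 0)))
           (tens (fock1 F n) (fock1 F n)))
      (tens (fock_e F a) (fock_e F a))).

Definition bl_counit (F : numFieldType) (n : nat) : fock F n -> F^o :=
  linext (fun M _ => (M == onecm _)%:R : F^o).

Definition BL (F : numFieldType) (n : nat) : prevb (fock F n) :=
  PreVB (bl_va F n) (@bl_comul F n) (@bl_counit F n).

Record is_lattice_coaction (F : numFieldType) (n : nat) (A : preva (fock F n))
    (rho : fock F n -> tensor (fock F n) (fock F n)) : Prop := {
  lattice_coaction_comodule : is_comodule_nlva (BL F n) A rho;
  lattice_coaction_h : forall a : 'rV[F]_n,
    rho (fock_h a 0) = tens (fock_h a 0) (fock1 F n)
                       + tens (fock1 F n) (fock_h a 0);
  lattice_coaction_e : forall a : 'rV[int]_n,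
    rho (fock_e F a) = tens (fock_e F a) (fock_e F a) }.

(* Phi(a (x) g(x))(z) *)
Definition Phi1 (F : numFieldType) (n : nat) (G : 'M[int]_n) (a : 'rV[F]_n)
    (g : int -> F) : fock F n -> int -> fock F n :=
  fun v m => \sum_(k \in [set: nat])
    ((-1) ^+ k / k`!%:R * iter k (@sderiv F) g m : F) *: mode G a k%:Z v.

(* h being finite dimensional, elements of h (x) F((x)) are series with       *)
(* coefficients in h.                                                         *)
Definition Phi (F : numFieldType) (n : nat) (G : 'M[int]_n)
    (g : int -> 'rV[F]_n) : fock F n -> int -> fock F n :=
  fun v m => \sum_i Phi1 G (delta_mx 0 i) (fun j => g j 0 i) v m.

(* Main.v *)
(* A module for B_L, a commutative algebra with derivation, is an algebra     *)
(* homomorphism into series of commuting operators that turns the derivation  *)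
(* into d/dx: weak associativity with a regular vertex operator map forces    *)
(* the products Y(u, x1) Y(v, x2) to be regular at x1 = x2. As                *)
(* alpha(-1) = (d e^alpha) e^(-alpha), such a module is determined by the     *)
(* Y(e^alpha, x).                                                             *)
(* Conversely the modes b_i(k), k >= 0, commute, so e^alpha |-> exp Phi(f),   *)
(* alpha(-m-1) |-> d^(m+1)/dx^(m+1) Phi(f) / m! defines such a homomorphism.  *)
(* Borcherds' commutator formula gives                                        *)
(*   [Phi(g)(x1), Y(u, x2)] = Y(Phi(g)(x1 - x2) u, x2),                       *)
(* hence the compatibility with Y for primitive elements, by the binomial     *)
(* formula for their exponentials, and the property is multiplicative in h.   *)
(* Since rho commutes with the modes b_i(k), k >= 0, it commutes with all     *)
(* operators in their bicommutant. The inverse of Y_M^f is Y_M^(-f).          *)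

Require Import Defs.
From HB Require Import structures.
From mathcomp Require Import all_boot all_order all_algebra finmap.
From mathcomp.multinomials Require Import monalg.
From mathcomp Require Import boolp classical_sets fsbigop reals.
From mathcomp.real_closed Require Import complex.
From mathcomp Require Import ring zify.

Set Implicit Arguments.
Unset Strict Implicit.
Unset Printing Implicit Defensive.

Import Order.TTheory GRing.Theory Num.Theory.

Local Open Scope ring_scope.

(** * Formal series and residues *)

(** B_L is a commutative algebra with a derivation, and its vertex operators are Y(u, x) = e^(x d)u.
    An algebra morphism from B_L to series of operators in nonnegative powers of x that turns d into
    d/dx is therefore a module structure ([fock_weak_assoc]). Conversely, the products Y(u, x1)Y(v,
    x2) of any module are regular at x1 = x2 ([regular_module]), so a module respects products and
    d. Since b_i(-1) = (d e^(b_i)) e^(-b_i), it is then determined by the e^alpha ([BL_module_ext]).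

    Existence: the modes b_i(k) with k >= 0 commute, and the power series with coefficients in their
    bicommutant form a commutative ring [opser]. Each Phi(f(alpha)) lies in this ring. Since f has
    no constant term, every term of Phi(f(alpha)) either lowers the polynomial degree or carries a
    power of x ([phiop_fil]), so its exponential converges. The universal property [fock_eval] of
    B_L gives the morphism [ym], and [ym_der] shows that it respects d.

    Compatibility with Y: a residue computation gives Borcherds' commutator formula
    ([va_commutator]). It says that Phi(g) is primitive for the coproduct that describes the action
    on Y(u, x2)v ([coprod_phi]). Exponentials of primitive elements are grouplike ([coprod_exp]) and
    the property is multiplicative ([coprodM]), so [ym_coprod] follows by checking generators.

    Compatibility with the coaction: rho commutes with the modes b_i(k), k >= 0 ([rho_fmode]),
    hence, slice by slice, with everything in their bicommutant ([rho_op]). The convolution inverse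
    is the structure attached to -f, since exp(Phi(f)) exp(-Phi(f)) = 1 ([ym_inverse]). *)

Definition fsupp (I : choiceType) (V : zmodType) (F : I -> V) : Prop :=
  exists s : seq I, forall i, i \notin s -> F i = 0.

Lemma fsum_seq (I : choiceType) (V : zmodType) (s : seq I) (F : I -> V) :
  uniq s -> (forall i, i \notin s -> F i = 0) ->
  \sum_(i \in [set: I]) F i = \sum_(i <- s) F i.
Proof.
move=> us hF; rewrite (@fsbigTE _ _ _ _ [fset x in s]%fset).
  by apply: perm_big; rewrite uniq_perm ?fset_uniq // => i; rewrite !inE.
by move=> i; rewrite !inE; exact: hF.
Qed.

Lemma fsum_linear (I : choiceType) (U V : zmodType) (h : U -> V) (F : I -> U) :
  additive h -> fsupp F ->
  h (\sum_(i \in [set: I]) F i) = \sum_(i \in [set: I]) h (F i).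
Proof.
move=> ha [s hs].
pose ht := GRing.isAdditive.Build _ _ _ ha.
pose hm : {additive U -> V} := HB.pack h ht.
have h0 : h 0 = 0 by exact: (raddf0 hm).
rewrite !(@fsum_seq _ _ (undup s)) ?undup_uniq //; first exact: (raddf_sum hm).
  by move=> i; rewrite mem_undup => /hs ->.
by move=> i; rewrite mem_undup => /hs.
Qed.

Lemma fsupp_map (I : choiceType) (U V : zmodType) (h : I -> U -> V) (F : I -> U) :
  (forall i, h i 0 = 0) -> fsupp F -> fsupp (fun i => h i (F i)).
Proof. by move=> h0 [s hs]; exists s => i /hs ->. Qed.

Lemma fsumD (I : choiceType) (V : zmodType) (F G : I -> V) :
  fsupp F -> fsupp G ->
  \sum_(i \in [set: I]) (F i + G i) =
  \sum_(i \in [set: I]) F i + \sum_(i \in [set: I]) G i.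
Proof.
move=> [s hs] [t ht].
rewrite !(@fsum_seq _ _ (undup (s ++ t))) ?undup_uniq ?big_split //.
all: move=> i; rewrite mem_undup mem_cat negb_or => /andP[/hs his /ht hit] //.
by rewrite his hit addr0.
Qed.

Lemma fsumB (I : choiceType) (V : zmodType) (F G : I -> V) :
  fsupp F -> fsupp G ->
  \sum_(i \in [set: I]) (F i - G i) =
  \sum_(i \in [set: I]) F i - \sum_(i \in [set: I]) G i.
Proof.
move=> [s hs] [t ht].
rewrite !(@fsum_seq _ _ (undup (s ++ t))) ?undup_uniq ?sumrB //.
all: move=> i; rewrite mem_undup mem_cat negb_or => /andP[/hs his /ht hit] //.
by rewrite his hit subrr.
Qed.

Lemma fsum_nat (V : zmodType) (K : nat) (F : nat -> V) :
  (forall k, (K <= k)%N -> F k = 0) ->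
  \sum_(k \in [set: nat]) F k = \sum_(k < K) F k.
Proof.
move=> hF; rewrite (@fsum_seq _ _ (iota 0 K)) ?iota_uniq //.
  by rewrite -(big_mkord xpredT) /index_iota subn0.
by move=> i; rewrite mem_iota /= add0n -leqNgt => /hF.
Qed.

Lemma fsum_int (V : zmodType) (N : int) (K : nat) (F : int -> V) :
  (forall i, i < N -> F i = 0) -> (forall i, N + K%:Z <= i -> F i = 0) ->
  \sum_(i \in [set: int]) F i = \sum_(k < K) F (N + k%:Z).
Proof.
move=> h1 h2; rewrite (@fsum_seq _ _ [seq N + k%:Z | k <- iota 0 K]).
- by rewrite big_map -(big_mkord xpredT (fun k => F (N + k%:Z))) /index_iota subn0.
- by rewrite map_inj_uniq ?iota_uniq // => i j /addrI [].
move=> i hi; case: (ltP i N) => [/h1 //|hN]; apply: h2; rewrite leNgt.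
apply: contra hi => hK; apply/mapP; exists `|i - N|%N; last lia.
by rewrite mem_iota; lia.
Qed.

Lemma fsum_posz (V : zmodType) (K : nat) (F : int -> V) :
  (forall i, i < 0 -> F i = 0) -> (forall i, K%:Z <= i -> F i = 0) ->
  \sum_(i \in [set: int]) F i = \sum_(k < K) F k%:Z.
Proof.
by move=> h1 h2; rewrite (@fsum_int _ 0 K).
Qed.

Lemma fsupp_int (V : zmodType) (N M : int) (F : int -> V) :
  (forall i, i < N -> F i = 0) -> (forall i, M < i -> F i = 0) -> fsupp F.
Proof.
move=> h1 h2; exists [seq N + k%:Z | k <- iota 0 `|M - N|.+1] => i hi.
case: (ltP i N) => [/h1 //|hN]; apply: h2; rewrite ltNge.
apply: contra hi => hK; apply/mapP; exists `|i - N|%N; last lia.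
by rewrite mem_iota; lia.
Qed.

Lemma fsum_shift (V : zmodType) (F : int -> V) (d : int) :
  \sum_(i \in [set: int]) F (i + d) = \sum_(i \in [set: int]) F i.
Proof.
apply/esym/(@reindex_fsbigT _ _ _ _ _ (fun i : int => i + d) F).
by exists (fun i => i - d) => i; rewrite ?addrK ?subrK.
Qed.

Lemma fsum1 (I : choiceType) (V : zmodType) (j : I) (F : I -> V) :
  (forall i, i != j -> F i = 0) -> \sum_(i \in [set: I]) F i = F j.
Proof.
move=> h; rewrite (@fsum_seq _ _ [:: j]) ?big_seq1 // => i.
by rewrite inE => /h.
Qed.

Section GeneralizedBinomials.
Variable F : numFieldType.

Lemma ibin0 a : ibin F a 0 = 1.
Proof. by rewrite /ibin big_ord0 fact0 divr1. Qed.

Lemma ibinS a j : ibin F (a + 1) j.+1 = ibin F a j.+1 + ibin F a j.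
Proof.
rewrite /ibin big_ord_recl [in X in X / _ + _]big_ord_recr /=.
under eq_bigr => i _.
  have -> : (a + 1)%:~R - (bump 0 i)%:R = a%:~R - i%:R :> F.
    by rewrite intrD /bump /= natrD; ring.
  over.
rewrite factS natrM.
have h1 : (j`!)%:R != 0 :> F by rewrite pnatr_eq0 -lt0n fact_gt0.
have h2 : j.+1%:R != 0 :> F by rewrite pnatr_eq0.
rewrite intrD; move: (\prod_(i < j) _) => p.
rewrite -addn1 natrD in h2 *; field.
by apply/andP.
Qed.

Lemma ibin_nat (m j : nat) : ibin F m j = 'C(m, j)%:R.
Proof.
elim: m j => [|m IH] [|j]; rewrite ?ibin0 ?bin0 //.
  by rewrite /ibin big_ord_recl /= subrr !mul0r.
by rewrite -addn1 PoszD ibinS !IH addn1 binS natrD.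
Qed.

End GeneralizedBinomials.

(** * Multiplication by powers of x1 - x2, substitution x1 = x2 + x0, and residues *)

Definition dmul (V : zmodType) (P : int -> int -> V) (a b : int) : V :=
  P (a - 1) b - P a (b - 1).

Section MulDiff.
Variables (F : numFieldType) (V : lmodType F).
Implicit Types P Q H : int -> int -> V.

Lemma sum_shift_bin (m : nat) (g : nat -> V) :
  \sum_(i < m.+2) 'C(m.+1, i)%:R *: g i =
  \sum_(i < m.+1) 'C(m, i)%:R *: g i + \sum_(i < m.+1) 'C(m, i)%:R *: g i.+1
  :> V.
Proof.
rewrite big_ord_recl /= bin0.
under eq_bigr => i _ do rewrite /bump /= add1n binS natrD scalerDl.
rewrite big_split /= addrA; congr (_ + _).
by rewrite [RHS]big_ord_recl big_ord_recr /= bin0 bin_small // scale0r addr0.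
Qed.

Lemma mul_diff0 P : mul_diff (F := F) 0 P = P.
Proof.
apply/funext => a; apply/funext => b.
by rewrite /mul_diff big_ord1 /= expr0 bin0 mulr1n scale1r !subr0.
Qed.

Lemma mul_diffS k P : mul_diff (F := F) k.+1 P = mul_diff (F := F) k (dmul P).
Proof.
apply/funext => a; apply/funext => b; rewrite /mul_diff.
pose g (i : nat) := (-1) ^+ i *: P (a - (k.+1 - i)%N%:Z) (b - i%:Z) : V.
rewrite (eq_bigr (fun i : 'I_k.+2 => 'C(k.+1, i)%:R *: g i)); last first.
  by move=> i _; rewrite /g scalerA -[(-1) ^+ i *+ _]mulr_natl.
rewrite sum_shift_bin -big_split /=; apply: eq_bigr => i _.
rewrite /g /dmul -[(-1) ^+ i *+ _]mulr_natl -scalerA -!scalerDr; congr (_ *: _).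
rewrite exprS mulN1r scaleNr -scalerBr; congr (_ *: (P _ _ - P _ _)).
all: by have := ltn_ord i; lia.
Qed.

Lemma mul_diffE k P : mul_diff (F := F) k P = iter k (@dmul V) P.
Proof.
elim: k P => [|k IH] P; first exact: mul_diff0.
by rewrite mul_diffS IH iterSr.
Qed.

Lemma mul_diffSr k P : mul_diff (F := F) k.+1 P = dmul (mul_diff (F := F) k P).
Proof. by rewrite !mul_diffE. Qed.

Lemma mul_diffD j k P :
  mul_diff (F := F) (j + k) P = mul_diff (F := F) j (mul_diff (F := F) k P).
Proof. by rewrite !mul_diffE iterD. Qed.

Lemma mul_diff_sub k P Q a b :
  mul_diff (F := F) k (fun a b => P a b - Q a b) a b =
  mul_diff (F := F) k P a b - mul_diff (F := F) k Q a b.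
Proof.
by rewrite /mul_diff -sumrB; apply: eq_bigr => i _; rewrite scalerBr.
Qed.

(* Expands [x1 ^ m = ((x1 - x2) + x2) ^ m]. *)
Lemma mul_diff_inv m P a c :
  P (a - m%:Z) c = \sum_(j < m.+1) 'C(m, j)%:R *:
     mul_diff (F := F) j P a (c - (m - j)%N%:Z).
Proof.
elim: m P c => [|m IH] P c.
  by rewrite big_ord1 mul_diff0 bin0 scale1r !subr0.
rewrite (@sum_shift_bin _ (fun j => mul_diff (F := F) j P a (c - (m.+1 - j)%N%:Z))).
have -> : P (a - m.+1%:Z) c = P (a - m%:Z) (c - 1) + dmul P (a - m%:Z) c.
  by rewrite /dmul [RHS]addrC subrK; congr (P _ _); lia.
rewrite [P _ (c - 1)]IH [dmul P _ _]IH; congr (_ + _); apply: eq_bigr => j _.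
  by congr (_ *: mul_diff _ _ _ _); rewrite subSn ?leq_ord //; lia.
by rewrite -mul_diffS subSS.
Qed.

Lemma truncb_mul_diff k N P : (forall a b, b < N -> P a b = 0) ->
  forall a b, b < N -> mul_diff (F := F) k P a b = 0.
Proof.
move=> h a b hb; rewrite /mul_diff big1 // => i _.
by rewrite h ?scaler0 //; lia.
Qed.

Lemma trunca_mul_diff k N P : (forall a b, a < N -> P a b = 0) ->
  forall a b, a < N -> mul_diff (F := F) k P a b = 0.
Proof.
move=> h a b hb; rewrite /mul_diff big1 // => i _.
by rewrite h ?scaler0 //; lia.
Qed.

Lemma laurent2_mul_diff k P : laurent2 P -> laurent2 (mul_diff (F := F) k P).
Proof.
move=> [N h]; exists N => a b /orP[ha|hb].
  by apply: (@trunca_mul_diff k N) => // a' b' h'; rewrite h ?h'.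
by apply: (@truncb_mul_diff k N) => // a' b' h'; rewrite h ?h' ?orbT.
Qed.

(** Summation by parts. It turns multiplication of a series by x1 - x2 into a difference of the
    binomial weights, to which Pascal's rule [ibinS] applies. *)
Lemma abel (g : int -> F) (h : int -> V) :
  fsupp (fun a => g (a + 1) *: h a) -> fsupp (fun a => g a *: h a) ->
  \sum_(a \in [set: int]) g a *: (h (a - 1) - h a) =
  \sum_(a \in [set: int]) (g (a + 1) - g a) *: h a.
Proof.
move=> f1 f2.
under eq_fsbigr => a _ do rewrite scalerBr.
under [RHS]eq_fsbigr => a _ do rewrite scalerBl.
rewrite !fsumB //; first congr (_ - _).
  rewrite -(fsum_shift _ 1).
  by under eq_fsbigr => a _ do rewrite addrK.
have [s hs] := f1; exists [seq a + 1 | a <- s] => a ha.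
rewrite -{1}(subrK 1 a) hs //; apply: contra ha => ha.
by apply/mapP; exists (a - 1); rewrite ?subrK.
Qed.

Lemma fsupp_diag P (g : int -> F) c :
  laurent2 P -> fsupp (fun a => g a *: P a (c - a)).
Proof.
move=> [N h]; apply: (@fsupp_int _ N (c - N)) => a ha.
  by rewrite h ?ha ?scaler0.
by rewrite h ?scaler0 //; lia.
Qed.

(** Under x1 = x2 + x0 the factor x1 - x2 becomes x0. On coefficients this is summation by parts
    followed by Pascal's rule; for p = 0 the weights are constant and their differences vanish. *)
Lemma subst_sum_dmul P p c : laurent2 P ->
  subst_sum (F := F) (dmul P) p c = subst_sum (F := F) P (p - 1) c.
Proof.
move=> hP; case: p => [[|j]|j]; last by [].
  rewrite /=; under eq_fsbigr => a _.
    rewrite ibin0 /dmul.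
    have -> : c + 0%:Z - a - 1 = c - 1 - a by lia.
    have -> : c + 0%:Z - a = c - 1 - (a - 1) by lia.
    over.
  rewrite (abel (g := fun=> 1) (h := fun a => P a (c - 1 - a))).
  - by rewrite fsbig1 // => a _; rewrite subrr scale0r.
  - exact: fsupp_diag.
  - exact: fsupp_diag.
have -> : subst_sum (F := F) P (j.+1%:Z - 1) c = subst_sum (F := F) P j%:Z c.
  by congr subst_sum; lia.
rewrite /=; under eq_fsbigr => a _.
  rewrite /dmul.
  have -> : c + j.+1%:Z - a - 1 = c + j%:Z - a by lia.
  have -> : c + j.+1%:Z - a = c + j%:Z - (a - 1) by lia.
  over.
rewrite (abel (g := fun a => ibin F a j.+1) (h := fun a => P a (c + j%:Z - a))).
- by apply: eq_fsbigr => a _; rewrite ibinS addrAC subrr add0r.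
- exact: (fsupp_diag (fun a => ibin F (a + 1) j.+1)).
- exact: fsupp_diag.
Qed.

Lemma subst_sum_mul_diff k P p c : laurent2 P ->
  subst_sum (F := F) (mul_diff (F := F) k P) p c =
  subst_sum (F := F) P (p - k%:Z) c.
Proof.
move=> hP; elim: k p => [|k IH] p; first by rewrite mul_diff0 subr0.
rewrite mul_diffSr subst_sum_dmul; last exact: laurent2_mul_diff.
by rewrite IH; congr subst_sum; lia.
Qed.

(** The sum telescopes to the constant value that h takes towards minus infinity, since h vanishes
    towards plus infinity. *)
Lemma telescope0 (h : int -> V) (N B : int) :
  (forall a, B <= a -> h a = 0) -> (forall a, a < N -> h (a - 1) = h a) ->
  \sum_(a \in [set: int]) (h (a - 1) - h a) = 0 -> forall a, a < N -> h a = 0.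
Proof.
move=> hB hN hs a0 ha0.
pose K := `|B - a0|%N.
rewrite (@fsum_int _ (a0 + 1) K) in hs; first last.
- by move=> a ha; rewrite !hB ?subr0 //; lia.
- by move=> a ha; rewrite hN ?subrr //; lia.
rewrite -(big_mkord xpredT (fun k => h (a0 + 1 + k%:Z - 1) - h (a0 + 1 + k%:Z)))
  in hs.
rewrite (eq_bigr (fun k : nat => - (h (a0 + k.+1%:Z) - h (a0 + k%:Z)))) in hs.
  rewrite sumrN (telescope_sumr (fun k : nat => h (a0 + k%:Z))) // opprB in hs.
  by move: hs; rewrite addr0 [h (a0 + K%:Z)]hB ?subr0 //; lia.
by move=> k _; rewrite opprB; congr (h _ - h _); lia.
Qed.

(** On an antidiagonal a + b = const, regularity of (x1 - x2)H makes H constant for a small, while H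
    vanishes for a large. The coefficient of x0^0 is the total variation, so that constant is 0. *)
Lemma dmul_laurent2 H N : (forall a b, b < N -> H a b = 0) ->
  laurent2 (dmul H) -> (forall c, subst_sum (F := F) (dmul H) 0 c = 0) ->
  laurent2 H.
Proof.
move=> hH [M hM] h0; exists (Num.min M N) => a b.
case: (ltP b N) => [hb _|hb]; first exact: hH.
rewrite [b < _]ltNge => /orP[ha|]; last by lia.
pose h a' := H a' (a + b - a').
have <- : h a = H a b by rewrite /h; congr H; lia.
apply: (@telescope0 h M (a + b - N + 1)); last by lia.
- by move=> a' ha'; apply: hH; lia.
- move=> a' ha'; have := hM a' (a + b - a' + 1); rewrite ha' => /(_ isT).
  rewrite /dmul /h => /subr0_eq hh.
  have -> : a + b - (a' - 1) = a + b - a' + 1 by lia.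
  by rewrite hh; congr H; lia.
rewrite -[RHS](h0 (a + b + 1)) /=.
apply: eq_fsbigr => a' _; rewrite ibin0 scale1r /dmul /h.
by congr (H _ _ - H _ _); lia.
Qed.

(* If (x1 - x2)^k P is regular and its value at x1 = x2 + x0 is divisible by  *)
(* x0^k, then P itself is regular.                                            *)
Lemma mul_diff_regular k P N : (forall a b, b < N -> P a b = 0) ->
  laurent2 (mul_diff (F := F) k P) ->
  (forall (p : nat) c, (p < k)%N ->
     subst_sum (F := F) (mul_diff (F := F) k P) p%:Z c = 0) ->
  laurent2 P.
Proof.
move=> hP; elim: k => [|k IH]; first by rewrite mul_diff0.
rewrite mul_diffSr => hl h0.
have hk : laurent2 (mul_diff (F := F) k P).
  apply: (@dmul_laurent2 _ N) => //; first exact: truncb_mul_diff.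
  by move=> c; apply: h0.
apply: IH => // p c hp.
by have := h0 p.+1 c hp; rewrite subst_sum_dmul //; congr (subst_sum _ _ _ = _); lia.
Qed.

(** H, being truncated in x2, is the expansion of (x1 - x2)^(-p-1) Q in nonnegative powers of x2.
    Its residue in x1 therefore only involves nonnegative exponents a of x1 in Q, with weight C(a,
    p). *)
Lemma residue_b H N p c : (forall a b, b < N -> H a b = 0) ->
  let g a := if 0 <= a then ibin F a p else 0 in
  let Q a := mul_diff (F := F) p.+1 H a (c + p%:Z - a) in
  fsupp (fun a => g a *: Q a) /\
  \sum_(a \in [set: int]) g a *: Q a = H (-1) c.
Proof.
move=> hH /=; elim: p c => [|p IH] c.
  pose h a := H a (c - 1 - a).
  have hz a : c - N <= a -> h a = 0 by move=> ha; apply: hH; lia.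
  have e a : mul_diff (F := F) 1 H a (c + 0%:Z - a) = h (a - 1) - h a.
    by rewrite mul_diffS mul_diff0 /dmul /h; congr (H _ _ - H _ _); lia.
  split.
    apply: (@fsupp_int _ 0 (c - N)) => a ha; first by rewrite leNgt ha scale0r.
    by rewrite e !hz ?subrr ?scaler0 //; lia.
  under eq_fsbigr => a _ do rewrite e.
  rewrite (@abel (fun a => if 0 <= a then ibin F a 0 else 0)).
  - rewrite (@fsum1 _ _ (-1)).
      by rewrite ler0N1 /= ibin0 subr0 scale1r /h; congr H; lia.
    move=> a ha; rewrite !ibin0.
    case: (ltP a 0) => h0; last by rewrite ifT ?subrr ?scale0r //; lia.
    by rewrite ifF ?subrr ?scale0r //; lia.
  - apply: (@fsupp_int _ (-1) (c - N)) => a ha.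
      by rewrite ifF ?scale0r //; lia.
    by rewrite hz ?scaler0 //; lia.
  - apply: (@fsupp_int _ 0 (c - N)) => a ha; first by rewrite leNgt ha scale0r.
    by rewrite hz ?scaler0 //; lia.
pose h a := mul_diff (F := F) p.+1 H a (c + p%:Z - a).
have hz a : c + p%:Z - N < a -> h a = 0.
  by move=> ha; apply: (@truncb_mul_diff p.+1 N) => //; lia.
have e a : mul_diff (F := F) p.+2 H a (c + p.+1%:Z - a) = h (a - 1) - h a.
  by rewrite mul_diffSr /dmul /h; congr (mul_diff _ _ _ _ - mul_diff _ _ _ _); lia.
split.
  apply: (@fsupp_int _ 0 (c + p%:Z - N + 1)) => a ha.
    by rewrite leNgt ha scale0r.
  by rewrite e !hz ?subrr ?scaler0 //; lia.
under eq_fsbigr => a _ do rewrite e.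
rewrite (@abel (fun a => if 0 <= a then ibin F a p.+1 else 0)).
- rewrite -(IH c).2; apply: eq_fsbigr => a _.
  congr (_ *: _); case: (ltP a 0) => h0; last first.
    by rewrite ifT; [rewrite ibinS addrAC subrr add0r|lia].
  rewrite subr0; case: ifP => // h1.
  have -> : a = -1 by lia.
  by rewrite addNr (@ibin_nat F 0) bin0n.
- apply: (@fsupp_int _ (-1) (c + p%:Z - N)) => a ha.
    by rewrite ifF ?scale0r //; lia.
  by rewrite hz ?scaler0.
- apply: (@fsupp_int _ 0 (c + p%:Z - N)) => a ha; first by rewrite leNgt ha scale0r.
  by rewrite hz ?scaler0.
Qed.

(** The counterpart of [residue_b] for the expansion in nonnegative powers of x1: now the negative
    exponents of x1 contribute, with the opposite sign. The two weights add up to [ibin F a p] for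
    all a, the weight in [subst_sum]. *)
Lemma residue_a H N p c : (forall a b, a < N -> H a b = 0) ->
  let g a := if a < 0 then ibin F a p else 0 in
  let Q a := mul_diff (F := F) p.+1 H a (c + p%:Z - a) in
  fsupp (fun a => g a *: Q a) /\
  \sum_(a \in [set: int]) g a *: Q a = - H (-1) c.
Proof.
move=> hH /=; elim: p c => [|p IH] c.
  pose h a := H a (c - 1 - a).
  have hz a : a < N -> h a = 0 by move=> ha; apply: hH; lia.
  have e a : mul_diff (F := F) 1 H a (c + 0%:Z - a) = h (a - 1) - h a.
    by rewrite mul_diffS mul_diff0 /dmul /h; congr (H _ _ - H _ _); lia.
  split.
    apply: (@fsupp_int _ N 0) => a ha; last by rewrite ltNge ltW // scale0r.
    by rewrite e !hz ?subrr ?scaler0 //; lia.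
  under eq_fsbigr => a _ do rewrite e.
  rewrite (@abel (fun a => if a < 0 then ibin F a 0 else 0)).
  - rewrite (@fsum1 _ _ (-1)).
      by rewrite /= ibin0 sub0r scaleN1r /h; congr (- H _ _); lia.
    move=> a ha; rewrite !ibin0.
    case: (ltP a 0) => h0; first by rewrite ifT ?subrr ?scale0r //; lia.
    by rewrite ifF ?subrr ?scale0r //; lia.
  - apply: (@fsupp_int _ N 0) => a ha; first by rewrite hz ?scaler0.
    by rewrite ifF ?scale0r //; lia.
  - apply: (@fsupp_int _ N 0) => a ha; first by rewrite hz ?scaler0.
    by rewrite ifF ?scale0r //; lia.
pose h a := mul_diff (F := F) p.+1 H a (c + p%:Z - a).
have hz a : a < N -> h a = 0.
  by move=> ha; apply: (@trunca_mul_diff p.+1 N) => //; lia.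
have e a : mul_diff (F := F) p.+2 H a (c + p.+1%:Z - a) = h (a - 1) - h a.
  by rewrite mul_diffSr /dmul /h; congr (mul_diff _ _ _ _ - mul_diff _ _ _ _); lia.
split.
  apply: (@fsupp_int _ N 0) => a ha; last by rewrite ltNge ltW // scale0r.
  by rewrite e !hz ?subrr ?scaler0 //; lia.
under eq_fsbigr => a _ do rewrite e.
rewrite (@abel (fun a => if a < 0 then ibin F a p.+1 else 0)).
- rewrite -(IH c).2; apply: eq_fsbigr => a _.
  congr (_ *: _); case: (ltP a 0) => h0; last first.
    by rewrite ifF ?subrr //; lia.
  case: ifP => h1; first by rewrite ibinS addrAC subrr add0r.
  have {h0 h1} -> : a = -1 by lia.
  have := ibinS F (-1) p; rewrite addNr (@ibin_nat F 0) bin0n /= => h0.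
  by rewrite sub0r; apply/esym/eqP; rewrite -addr_eq0 addrC -h0.
- apply: (@fsupp_int _ N 0) => a ha; first by rewrite hz ?scaler0.
  by rewrite ifF ?scale0r //; lia.
- apply: (@fsupp_int _ N 0) => a ha; first by rewrite hz ?scaler0.
  by rewrite ifF ?scale0r //; lia.
Qed.

(* P and Q being expansions of one rational function with a pole along        *)
(* x1 = x2, the difference of residues in x1 is the residue at x1 = x2.       *)
Lemma residue_sub P Q N k j c :
  (forall a b, b < N -> P a b = 0) -> (forall a b, a < N -> Q a b = 0) ->
  mul_diff (F := F) k P = mul_diff (F := F) k Q ->
  mul_diff (F := F) j P (-1) c - mul_diff (F := F) j Q (-1) c =
  subst_sum (F := F) (mul_diff (F := F) k P) (k%:Z - 1 - j%:Z) c.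
Proof.
(* For j >= k both sides vanish: the two series already agree after multiplication by (x1 - x2)^j,
   and the exponent k - 1 - j of x0 is negative. *)
move=> hP hQ hk; case: (ltnP j k) => hj; last first.
  rewrite -(subnK hj) !mul_diffD hk subrr.
  by have -> : k%:Z - 1 - (j - k + k)%N%:Z = Negz (j - k) by lia.
have -> : k%:Z - 1 - j%:Z = (k - j.+1)%N%:Z by lia.
(* The pole left after multiplying by (x1 - x2)^j has order p + 1 = k - j, so its residue is the
   coefficient of x0^p in the numerator. *)
set p := (k - j.+1)%N; have ek : k = (p.+1 + j)%N by rewrite /p; lia.
have h1 := @residue_b _ N p c (@truncb_mul_diff j N P hP).
have h2 := @residue_a _ N p c (@trunca_mul_diff j N Q hQ).
rewrite -mul_diffD -ek -hk in h2; rewrite -mul_diffD -ek in h1.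
rewrite -h1.2 -h2.2 -fsumD; [|exact: h1.1|exact: h2.1].
apply: eq_fsbigr => a _; rewrite -scalerDl; congr (_ *: _).
by case: ltP; rewrite ?add0r ?addr0.
Qed.

End MulDiff.

(** * Borcherds' commutator formula and regularity of modules *)

Lemma weak_assoc_ge (F : numFieldType) (V W : lmodType F)
    (YV : V -> V -> int -> V) (YW : V -> W -> int -> W) u v k :
  (forall w, let P := mul_diff (F := F) k (fun a b => YW u (YW v w b) a) in
    laurent2 P /\
    forall p c, subst_sum (F := F) P p c = YW (YV u v (p - k%:Z)) w c) ->
  forall l, (k <= l)%N -> forall w,
    let P := mul_diff (F := F) l (fun a b => YW u (YW v w b) a) in
    laurent2 P /\
    forall p c, subst_sum (F := F) P p c = YW (YV u v (p - l%:Z)) w c.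
Proof.
move=> h l hl w; have [h1 h2] := h w; rewrite -(subnK hl) mul_diffD /=.
split; first exact: laurent2_mul_diff.
move=> p c; rewrite subst_sum_mul_diff // h2; congr (YW (YV _ _ _) _ _); lia.
Qed.

(** As [vop A u w (-1 - m)] is u_m w, this is Borcherds' formula [u_m, Y(v, x)] = sum_j C(m, j)
    x^(m-j) Y(u_j v, x). By locality the two orders of the product expand the same function; x1^m is
    developed in powers of x1 - x2, and [residue_sub] with weak associativity evaluates each
    term. *)
Lemma va_commutator (F : numFieldType) (V : lmodType F) (A : preva V) :
  is_va A -> forall u v w (m : nat) c,
  vop A u (vop A v w c) (-1 - m%:Z) - vop A v (vop A u w (-1 - m%:Z)) c =
  \sum_(j < m.+1) 'C(m, j)%:R *:
     vop A (vop A u v (-1 - j%:Z)) w (c - (m - j)%N%:Z).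
Proof.
move=> [hA hloc] u v w m c.
have [k1 h1] := nlva_assoc hA u v.
have [k2 h2] := hloc u v.
(* An exponent that serves for weak associativity and for locality at once. *)
pose k := maxn k1 k2.
have /(_ w)[_ hs] := weak_assoc_ge h1 (leq_maxl k1 k2); rewrite -/k in hs.
pose P a b := vop A u (vop A v w b) a.
pose Q a b := vop A v (vop A u w a) b.
have hk : mul_diff (F := F) k P = mul_diff (F := F) k Q.
  rewrite -[k](subnK (leq_maxr k1 k2)) !mul_diffD; congr mul_diff.
  by apply/funext => a; apply/funext => b; apply: h2.
have lin0 x m' : vop A x 0 m' = 0.
  have [_ hb] := nlva_bilin hA m'.
  by have := hb x (-1) 0 0; rewrite scaler0 addr0 scaleN1r addNr.
have [N1 hN1] := nlva_laurent hA v w.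
have [N2 hN2] := nlva_laurent hA u w.
pose N := Num.min N1 N2.
have hP a b : b < N -> P a b = 0.
  by move=> hb; rewrite /P hN1 ?lin0 //; move: hb; rewrite /N; lia.
have hQ a b : a < N -> Q a b = 0.
  by move=> hb; rewrite /Q hN2 ?lin0 //; move: hb; rewrite /N; lia.
rewrite (@mul_diff_inv _ _ m (fun a b => P a b - Q a b)).
apply: eq_bigr => j _; congr (_ *: _).
rewrite mul_diff_sub (residue_sub _ _ hP hQ hk) hs.
by congr (vop _ (vop _ _ _ _) _ _); lia.
Qed.

(** When YV(u, x)v has no negative powers, the right-hand side of weak associativity is divisible by
    x0^k. Hence the factor (x1 - x2)^k can be cancelled and the identity holds with exponent 0. *)
Lemma regular_module (F : numFieldType) (V W : lmodType F)
    (YV : V -> V -> int -> V) (YW : V -> W -> int -> W) :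
  (forall m, bilin (fun u w => YW u w m)) -> (forall u w, laurent (YW u w)) ->
  (forall u v m, m < 0 -> YV u v m = 0) ->
  weak_assoc YV YW ->
  forall u v w, laurent2 (fun a b => YW u (YW v w b) a) /\
    forall (p : nat) c,
      subst_sum (F := F) (fun a b => YW u (YW v w b) a) p%:Z c =
      YW (YV u v p%:Z) w c.
Proof.
move=> hb hl hneg hw u v w.
have [k hk] := hw u v; have [h1 h2] := hk w.
have [N hN] := hl v w.
have lin0r x m : YW x 0 m = 0.
  by have := (hb m).2 x (-1) 0 0; rewrite scaler0 addr0 scaleN1r addNr.
have lin0l x m : YW 0 x m = 0.
  by have := (hb m).1 x (-1) 0 0; rewrite scaler0 addr0 scaleN1r addNr.
have hP : laurent2 (fun a b => YW u (YW v w b) a).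
  apply: (@mul_diff_regular _ _ k _ N) => //; first by move=> a b hb'; rewrite hN.
  by move=> p c hp; rewrite h2 hneg ?lin0l //; lia.
split=> // p c.
have := h2 (p%:Z + k%:Z) c; rewrite subst_sum_mul_diff //.
by rewrite addrK.
Qed.

(** * Tensor products *)

Section LinearMaps.
Variables (F : numFieldType).
Implicit Types U V W : lmodType F.

Lemma linear0 U V (f : U -> V) : linear f -> f 0 = 0.
Proof. by move=> /(_ (-1) 0 0); rewrite scaler0 addr0 scaleN1r addNr. Qed.

Lemma linearDf U V (f : U -> V) : linear f -> {morph f : u v / u + v}.
Proof. by move=> h u v; have := h 1 u v; rewrite !scale1r. Qed.

Lemma linearZf U V (f : U -> V) : linear f -> forall a u, f (a *: u) = a *: f u.
Proof. by move=> h a u; have := h a u 0; rewrite !addr0 linear0 // addr0. Qed.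

Lemma linearNf U V (f : U -> V) : linear f -> {morph f : u / - u}.
Proof. by move=> h u; rewrite -scaleN1r linearZf // scaleN1r. Qed.

Lemma linear_sumf U V (f : U -> V) (I : Type) (r : seq I) (P : pred I)
    (g : I -> U) : linear f ->
  f (\sum_(i <- r | P i) g i) = \sum_(i <- r | P i) f (g i).
Proof. by move=> h; rewrite (big_morph f (linearDf h) (linear0 h)). Qed.

Lemma linear_sum_fun U V (I : Type) (r : seq I) (P : pred I)
    (f : I -> U -> V) : (forall i, linear (f i)) ->
  linear (fun u => \sum_(i <- r | P i) f i u).
Proof.
move=> h a u v; rewrite scaler_sumr -big_split /=.
by apply: eq_bigr => i _; rewrite h.
Qed.

Lemma linear_comp U V W (f : U -> V) (g : V -> W) :
  linear f -> linear g -> linear (fun u => g (f u)).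
Proof. by move=> hf hg a u v; rewrite hf hg. Qed.

Lemma linear_scale U V (f : U -> V) a : linear f -> linear (fun u => a *: f u).
Proof. by move=> hf b u v; rewrite hf scalerDr !scalerA mulrC. Qed.

Lemma linear_add U V (f g : U -> V) :
  linear f -> linear g -> linear (fun u => f u + g u).
Proof. by move=> hf hg b u v; rewrite hf hg scalerDr addrACA. Qed.

Lemma linear_id U : linear (fun u : U => u).
Proof. by []. Qed.

Lemma linear_zero U V : linear (fun _ : U => 0 : V).
Proof. by move=> a u v; rewrite scaler0 addr0. Qed.

Lemma bilin_comp U V W U' V' (b : U -> V -> W) (f : U' -> U) (g : V' -> V) :
  bilin b -> linear f -> linear g -> bilin (fun u v => b (f u) (g v)).
Proof.
move=> [b1 b2] hf hg; split=> [v|u].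
  exact: (linear_comp hf (b1 _)).
exact: (linear_comp hg (b2 _)).
Qed.

Lemma bilin_sum U V W (I : Type) (r : seq I) (P : pred I)
    (b : I -> U -> V -> W) : (forall i, bilin (b i)) ->
  bilin (fun u v => \sum_(i <- r | P i) b i u v).
Proof.
by move=> h; split=> ?; apply: linear_sum_fun => i; [apply: (h i).1|
  apply: (h i).2].
Qed.

End LinearMaps.

Section TensorProduct.
Variables (F : numFieldType).
Implicit Types U V W : lmodType F.

Lemma tlift_linear V W U (b : V -> W -> U) : bilin b -> linear (tlift b).
Proof. by move=> hb a s t; rewrite tlift_add // tlift_scale. Qed.

Lemma tens_bilin V W : bilin (@tens F V W).
Proof.
split=> [w a u v|u a v w]; apply: tensP => U b hb.
all: have [b1 b2] := hb; rewrite tlift_add // tlift_scale // !tliftE //.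
  exact: b1.
exact: b2.
Qed.

Lemma tens_sum V W (t : tensor V W) : t = \sum_(p <- repr t) tens p.1 p.2.
Proof.
apply: tensP => U b hb; rewrite (linear_sumf _ _ _ (tlift_linear hb)).
by apply: eq_bigr => p _; rewrite tliftE.
Qed.

Lemma tens_ind V W (P : tensor V W -> Prop) :
  P 0 -> (forall s t, P s -> P t -> P (s + t)) ->
  (forall v w, P (tens v w)) -> forall t, P t.
Proof. by move=> h0 hD hT t; rewrite (tens_sum t); apply: big_ind. Qed.

Lemma tens_linear_ext V W U (f g : tensor V W -> U) : linear f -> linear g ->
  (forall v w, f (tens v w) = g (tens v w)) -> f =1 g.
Proof.
move=> hf hg h; apply: tens_ind => [|s t hs ht|] //; first by rewrite !linear0.
by rewrite !linearDf // hs ht.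
Qed.

Lemma tlift_comp V W U U' (b : V -> W -> U) (h : U -> U') t :
  bilin b -> linear h -> h (tlift b t) = tlift (fun v w => h (b v w)) t.
Proof. by move=> hb hh; rewrite /tlift linear_sumf. Qed.

Lemma tmap_bilin V W V' W' (f : V -> V') (g : W -> W') :
  linear f -> linear g -> bilin (fun v w => tens (f v) (g w)).
Proof. by move=> hf hg; apply: bilin_comp => //; apply: tens_bilin. Qed.

Lemma tmap_linear V W V' W' (f : V -> V') (g : W -> W') :
  linear f -> linear g -> linear (tmap f g).
Proof. by move=> hf hg; apply/tlift_linear/tmap_bilin. Qed.

Lemma tmapE V W V' W' (f : V -> V') (g : W -> W') v w :
  linear f -> linear g -> tmap f g (tens v w) = tens (f v) (g w).
Proof. by move=> hf hg; apply/tliftE/tmap_bilin. Qed.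

Lemma tassoc_bilin U V W : bilin (fun (t : tensor U V) (w : W) =>
  tlift (fun u v => tens u (tens v w)) t).
Proof.
have h1 (w : W) : bilin (fun (u : U) (v : V) => tens u (tens v w)).
  split=> [v|u]; first exact: (tens_bilin _ _).1.
  exact: (linear_comp ((tens_bilin _ _).1 w) ((tens_bilin _ _).2 u)).
split=> [w|t]; first exact: tlift_linear.
apply: linear_sum_fun => p; apply: linear_comp; first exact: (tens_bilin _ _).2.
exact: (tens_bilin _ _).2.
Qed.

Lemma tassoc_linear U V W : linear (@tassoc F U V W).
Proof. exact/tlift_linear/tassoc_bilin. Qed.

Lemma tassocE U V W (u : U) (v : V) (w : W) :
  tassoc (tens (tens u v) w) = tens u (tens v w).
Proof.
rewrite /tassoc tliftE; last exact: tassoc_bilin.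
rewrite tliftE //; split=> [v'|u']; first exact: (tens_bilin _ _).1.
exact: (linear_comp ((tens_bilin _ _).1 w) ((tens_bilin _ _).2 u')).
Qed.

Definition tmul V W (m1 : V -> V -> V) (m2 : W -> W -> W) (s t : tensor V W) :
    tensor V W :=
  tlift (fun a b => tlift (fun c d => tens (m1 a c) (m2 b d)) t) s.

Section TMul.
Variables (V W : lmodType F) (m1 : V -> V -> V) (m2 : W -> W -> W).
Hypotheses (h1 : bilin m1) (h2 : bilin m2).

Lemma tmul_inner a b : bilin (fun c d => tens (m1 a c) (m2 b d)).
Proof. by apply: tmap_bilin; [apply: h1.2|apply: h2.2]. Qed.

Lemma tmul_outer t :
  bilin (fun a b => tlift (fun c d => tens (m1 a c) (m2 b d)) t).
Proof.
split=> [b|a]; apply: linear_sum_fun => p.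
  exact: (linear_comp (h1.1 p.1) ((tens_bilin _ _).1 (m2 b p.2))).
exact: (linear_comp (h2.1 p.2) ((tens_bilin _ _).2 (m1 a p.1))).
Qed.

Lemma tmul_bilin : bilin (tmul m1 m2).
Proof.
split=> [t|s]; first exact/tlift_linear/tmul_outer.
by apply: linear_sum_fun => p; apply/tlift_linear/tmul_inner.
Qed.

Lemma tmulE a b c d :
  tmul m1 m2 (tens a b) (tens c d) = tens (m1 a c) (m2 b d).
Proof.
rewrite /tmul tliftE; last exact: tmul_outer.
by rewrite tliftE //; apply: tmul_inner.
Qed.

Lemma tmulC : commutative m1 -> commutative m2 -> commutative (tmul m1 m2).
Proof.
move=> c1 c2 s t; move: s; apply: tens_linear_ext; try exact: tmul_bilin.1.
  exact: tmul_bilin.2.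
move=> a b; move: t; apply: tens_linear_ext; first exact: tmul_bilin.2.
  exact: tmul_bilin.1.
by move=> c d; rewrite !tmulE c1 c2.
Qed.

Lemma tmulA : associative m1 -> associative m2 -> associative (tmul m1 m2).
Proof.
move=> a1 a2 s t r; move: s; apply: tens_linear_ext; first exact: tmul_bilin.1.
  by apply: linear_comp; apply: tmul_bilin.1.
move=> a b; move: t; apply: tens_linear_ext.
- by apply: linear_comp; [apply: tmul_bilin.1|apply: tmul_bilin.2].
- by apply: linear_comp; [apply: tmul_bilin.2|apply: tmul_bilin.1].
move=> c d; move: r; apply: tens_linear_ext.
- by apply: linear_comp; apply: tmul_bilin.2.
- exact: tmul_bilin.2.
by move=> e g; rewrite !tmulE a1 a2.
Qed.

Lemma tmul1 e1 e2 : left_id e1 m1 -> left_id e2 m2 ->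
  left_id (tens e1 e2) (tmul m1 m2).
Proof.
move=> l1 l2; apply: tens_linear_ext; [exact: tmul_bilin.2|exact: linear_id|].
by move=> a b; rewrite tmulE l1 l2.
Qed.

Lemma tlift_tmul U (b : V -> W -> U) s t : bilin b ->
  tlift b (tmul m1 m2 s t) =
  tlift (fun x y => tlift (fun x' y' => b (m1 x x') (m2 y y')) t) s.
Proof.
move=> hb; rewrite /tmul (tlift_comp _ (tmul_outer t) (tlift_linear hb)).
apply: eq_bigr => p _.
rewrite (tlift_comp _ (tmul_inner p.1 p.2) (tlift_linear hb)).
by apply: eq_bigr => q _; rewrite tliftE.
Qed.

End TMul.

(** Together with [tassocM], this reduces coassociativity to generators: both of its sides become
    algebra morphisms. *)
Lemma tmapM V W V' W' (m1 : V -> V -> V) (m2 : W -> W -> W)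
    (m1' : V' -> V' -> V') (m2' : W' -> W' -> W') f g :
  bilin m1 -> bilin m2 -> bilin m1' -> bilin m2' -> linear f -> linear g ->
  {morph f : u v / m1 u v >-> m1' u v} -> {morph g : u v / m2 u v >-> m2' u v} ->
  {morph tmap f g : s t / tmul m1 m2 s t >-> tmul m1' m2' s t}.
Proof.
move=> h1 h2 h1' h2' hf hg fM gM s t.
have hT := tmap_linear hf hg.
have hm := tmul_bilin h1 h2; have hm' := tmul_bilin h1' h2'.
move: s; apply: tens_linear_ext.
- exact: (linear_comp (hm.1 t)).
- exact: (linear_comp hT (hm'.1 _)).
move=> a b; move: t; apply: tens_linear_ext.
- exact: (linear_comp (hm.2 _)).
- exact: (linear_comp hT (hm'.2 _)).
by move=> c d; rewrite !(tmulE, tmapE) // fM gM.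
Qed.

Lemma tassocM U V W (m1 : U -> U -> U) (m2 : V -> V -> V) (m3 : W -> W -> W) :
  bilin m1 -> bilin m2 -> bilin m3 ->
  {morph @tassoc F U V W : s t / tmul (tmul m1 m2) m3 s t >->
     tmul m1 (tmul m2 m3) s t}.
Proof.
move=> h1 h2 h3 s t.
have h12 := tmul_bilin h1 h2; have h23 := tmul_bilin h2 h3.
have hl := tmul_bilin h12 h3; have hr := tmul_bilin h1 h23.
have ha := @tassoc_linear U V W.
move: s; apply: tens_linear_ext.
- exact: (linear_comp (hl.1 t)).
- exact: (linear_comp ha (hr.1 _)).
move=> s1 c; move: t; apply: tens_linear_ext.
- exact: (linear_comp (hl.2 _)).
- exact: (linear_comp ha (hr.2 _)).
move=> t1 c'; rewrite tmulE //.
move: s1; apply: tens_linear_ext.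
- exact: (linear_comp (linear_comp (h12.1 t1) ((tens_bilin _ _).1 _)) ha).
- exact: (linear_comp (linear_comp ((tens_bilin _ _).1 _) ha) (hr.1 _)).
move=> a b; move: t1; apply: tens_linear_ext.
- exact: (linear_comp (linear_comp (h12.2 _) ((tens_bilin _ _).1 _)) ha).
- exact: (linear_comp (linear_comp ((tens_bilin _ _).1 _) ha) (hr.2 _)).
by move=> a' b'; rewrite !(tmulE, tassocE).
Qed.

End TensorProduct.

(** * The algebra B_L *)

Section CommutativeMonomials.
Variable I : choiceType.

Lemma cmonom_eq (M N : {cmonom I}) : (forall i, M i = N i) -> M = N.
Proof. by move=> h; apply/eqP/cmP. Qed.

Lemma divcmK (M : {cmonom I}) x : (0 < M x)%N -> mulcm (ucm x) (divcm M (ucm x)) = M.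
Proof.
move=> h; apply: cmonom_eq => i; rewrite mulcmE divcmE ucmE.
by case: eqVneq => [<-|_]; lia.
Qed.

Lemma mulcm_div (M : {cmonom I}) x : divcm (mulcm (ucm x) M) (ucm x) = M.
Proof. by apply: cmonom_eq => i; rewrite divcmE mulcmE addKn. Qed.

Lemma divcm_mulr (M N : {cmonom I}) x : (0 < N x)%N ->
  divcm (mulcm M N) (ucm x) = mulcm M (divcm N (ucm x)).
Proof.
move=> h; apply: cmonom_eq => i; rewrite !(divcmE, mulcmE) ucmE.
by case: eqVneq => [<-|_]; lia.
Qed.

Lemma divcm_mull (M N : {cmonom I}) x : (0 < M x)%N ->
  divcm (mulcm M N) (ucm x) = mulcm (divcm M (ucm x)) N.
Proof. by move=> h; rewrite mulcmC divcm_mulr // mulcmC. Qed.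

Lemma mulcm_divl (L M N : {cmonom I}) x : (0 < M x)%N ->
  mulcm L (divcm (mulcm M N) (ucm x)) = mulcm (mulcm L (divcm M (ucm x))) N.
Proof. by move=> h; rewrite divcm_mull // mulcmA. Qed.

Lemma mulcm_divr (L M N : {cmonom I}) x : (0 < N x)%N ->
  mulcm L (divcm (mulcm M N) (ucm x)) = mulcm M (mulcm L (divcm N (ucm x))).
Proof. by move=> h; rewrite divcm_mulr // mulcmA [mulcm L M]mulcmC -mulcmA. Qed.

Lemma mulcmCA (L M N : {cmonom I}) : mulcm L (mulcm M N) = mulcm M (mulcm L N).
Proof. by rewrite !mulcmA [mulcm L M]mulcmC. Qed.

Lemma divcmC (M N P : {cmonom I}) : divcm (divcm M N) P = divcm (divcm M P) N.
Proof. by apply: cmonom_eq => i; rewrite !divcmE subnAC. Qed.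

Lemma cmonom_ind (P : {cmonom I} -> Prop) : P (onecm _) ->
  (forall x M, P M -> P (mulcm (ucm x) M)) -> forall M, P M.
Proof.
move=> h1 hM M; have [k] := ubnP (mdeg M); elim: k M => // k IH M hk.
case: (eqVneq M (onecm _)) => [->//|hne].
have [x hx] : exists x, (0 < M x)%N.
  apply: contrapT => hx; case/eqP: hne; apply: cmonom_eq => i.
  rewrite onecmE; apply/eqP; rewrite -leqn0 leqNgt; apply/negP => hi.
  by apply: hx; exists i.
rewrite -(divcmK hx); apply: hM; apply: IH.
by move: hk; rewrite -{1}(divcmK hx) mdegM mdegU.
Qed.

Lemma mdeg_divcm (M : {cmonom I}) x : (0 < M x)%N ->
  mdeg M = (mdeg (divcm M (ucm x))).+1.
Proof. by move=> h; rewrite -{1}(divcmK h) mdegM mdegU. Qed.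

Section Eval.
Variables (T : Type) (idx : T) (op : Monoid.com_law idx) (p : I -> T).

(** The morphism from the free commutative monoid that extends p. It is spelled with [iter] over the
    support so that the body of [bl_comul] is an instance of it. *)
Definition evalcm (M : {cmonom I}) : T :=
  \big[op/idx]_(x <- finsupp M) iter (M x) (op (p x)) idx.

Lemma evalcmEw (D : {fset I}) (M : {cmonom I}) : (finsupp M `<=` D)%fset ->
  evalcm M = \big[op/idx]_(x <- D) iter (M x) (op (p x)) idx.
Proof.
move=> hD; apply: big_fset_incl => // x _ hx.
by rewrite (_ : M x = 0%N) //; apply/eqP; rewrite cmE_eq0.
Qed.

Lemma evalcmM M N : evalcm (mulcm M N) = op (evalcm M) (evalcm N).
Proof.
pose D := (finsupp M `|` finsupp N)%fset.
rewrite (evalcmEw (D := D)); last by rewrite (mdomD M N).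
rewrite (evalcmEw (D := D) (fsubsetUl _ _)) (evalcmEw (D := D) (fsubsetUr _ _)).
rewrite -big_split; apply: eq_bigr => x _; rewrite mulcmE.
elim: (M x) => [|m IH]; first by rewrite add0n /= Monoid.mul1m.
by rewrite addSn !iterS IH Monoid.mulmA.
Qed.

Lemma evalcm1 : evalcm (onecm _) = idx.
Proof. by rewrite /evalcm mdom1 big_nil. Qed.

Lemma evalcmU x : evalcm (ucm x) = p x.
Proof. by rewrite /evalcm mdomU big_seq_fset1 ucmE eqxx /= Monoid.mulm1. Qed.

End Eval.
End CommutativeMonomials.

Lemma malgU_scale (F : numFieldType) (K : choiceType) (c : F) (k : K) :
  << c *g k >> = c *: << k >> :> {malg F[K]}.
Proof.
by apply/malgP => k'; rewrite mcoeffZ !mcoeffU mulrnAr mulr1.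
Qed.

(* Sealed copies: unifying bas F M a with bas F N b, or two different         *)
(* products, unfolds finitely supported functions, without end in practice.   *)
HB.lock Definition fbas (F : numFieldType) (n : nat) (M : smonom n)
  (a : 'rV[int]_n) : fock F n := bas F M a.
HB.lock Definition fmul (F : numFieldType) (n : nat) :
  fock F n -> fock F n -> fock F n := @bl_mul F n.
HB.lock Definition fder (F : numFieldType) (n : nat) : fock F n -> fock F n :=
  @bl_der F n.

Definition fe (F : numFieldType) (n : nat) (a : 'rV[int]_n) : fock F n :=
  fbas F (onecm _) a.
Definition fx (F : numFieldType) (n : nat) (x : 'I_n * nat) : fock F n :=
  fbas F (ucm x) 0.

Section Fock.
Variables (F : numFieldType) (n : nat).
Local Notation fk := (fock F n).
Implicit Types (M N : smonom n) (a b : 'rV[int]_n) (u v w : fk).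

Lemma linext_linear (U : lmodType F) (phi : smonom n -> 'rV[int]_n -> U) :
  linear (@linext F n U phi).
Proof.
(* The defining sum runs over the support of the vector; to compare several vectors it is first
   extended to a common finite set. *)
have E (D : {fset (smonom n * 'rV[int]_n)%type}) v : (msupp v `<=` D)%fset ->
    linext phi v = \sum_(p <- D) v@_p *: phi p.1 p.2.
  move=> hD; apply: big_fset_incl => // x _ hx.
  by rewrite mcoeff_outdom // scale0r.
move=> a u v.
pose D := (msupp u `|` msupp v `|` msupp (a *: u + v : fk))%fset.
have hu : (msupp u `<=` D)%fset by rewrite /D -fsetUA fsubsetUl.
have hv : (msupp v `<=` D)%fset by rewrite /D fsetUAC fsubsetUr.
rewrite (E D u hu) (E D v hv) (E D) ?fsubsetUr //.
rewrite scaler_sumr -big_split; apply: eq_bigr => p _ /=.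
by rewrite mcoeffD mcoeffZ scalerDl scalerA.
Qed.

Lemma fbasE M a : fbas F M a = bas F M a.
Proof. by rewrite fbas.unlock. Qed.

Lemma linextE (U : lmodType F) (phi : smonom n -> 'rV[int]_n -> U) M a :
  linext phi (fbas F M a) = phi M a.
Proof.
by rewrite fbas.unlock /linext /bas msuppU oner_eq0 big_seq_fset1 mcoeffUU scale1r.
Qed.

Lemma fock_sum (v : fk) : v = \sum_(p <- msupp v) v@_p *: fbas F p.1 p.2.
Proof.
rewrite {1}(monalgE v); apply: eq_bigr => -[M a] _; rewrite fbas.unlock; exact: malgU_scale.
Qed.

Lemma fock_linear_ext (U : lmodType F) (f g : fk -> U) :
  linear f -> linear g -> (forall M a, f (fbas F M a) = g (fbas F M a)) -> f =1 g.
Proof.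
move=> hf hg h v; rewrite (fock_sum v) !linear_sumf //.
by apply: eq_bigr => p _; rewrite !linearZf // h.
Qed.

Lemma fmul_bilin : bilin (@fmul F n).
Proof.
rewrite fmul.unlock; split=> [v|u]; first exact: linext_linear.
apply: linear_sum_fun => p; apply/linear_scale/linext_linear.
Qed.

Lemma fmulE M a N b :
  fmul (fbas F M a) (fbas F N b) = fbas F (mulcm M N) (a + b).
Proof. by rewrite fmul.unlock /bl_mul !linextE fbasE. Qed.

Lemma fmulC : commutative (@fmul F n).
Proof.
have [h1 h2] := fmul_bilin.
move=> u v; move: u.
apply: fock_linear_ext; [exact: h1|exact: h2|move=> M a].
move: v; apply: fock_linear_ext; [exact: h2|exact: h1|move=> N b].
by rewrite !fmulE mulcmC addrC.
Qed.

Lemma fmulA : associative (@fmul F n).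
Proof.
have [h1 h2] := fmul_bilin.
move=> u v w; move: u; apply: fock_linear_ext => [||M a]; first exact: h1.
  exact: (linear_comp (h1 v) (h1 w)).
move: v; apply: fock_linear_ext => [||N b].
- exact: (linear_comp (h1 w) (h2 _)).
- exact: (linear_comp (h2 _) (h1 w)).
move: w; apply: fock_linear_ext => [||P c].
- exact: (linear_comp (h2 _) (h2 _)).
- exact: h2.
by rewrite !fmulE mulcmA addrA.
Qed.

Lemma fmulCA u v w : fmul u (fmul v w) = fmul v (fmul u w).
Proof. by rewrite !fmulA (fmulC u). Qed.

Lemma fmul1 : left_id (fe F 0) (@fmul F n).
Proof.
have [h1 h2] := fmul_bilin.
apply: fock_linear_ext => [||M a]; [exact: h2|exact: linear_id|].
by rewrite fmulE mul0cm add0r.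
Qed.

Lemma fmulr1 : right_id (fe F 0) (@fmul F n).
Proof. by move=> u; rewrite fmulC fmul1. Qed.

(** The e^a and the variables generate the algebra. Identities that are linear and multiplicative in
    the element of B_L are all proved by this induction. *)
Lemma fock_gen_ind (P : fk -> Prop) :
  (forall c u v, P u -> P v -> P (c *: u + v)) ->
  (forall a, P (fe F a)) -> (forall x, P (fx F x)) ->
  (forall u v, P u -> P v -> P (fmul u v)) -> forall u, P u.
Proof.
move=> hl he hx hm u.
have h0 : P 0 by have := hl (-1) _ _ (he 0) (he 0); rewrite scaleN1r addNr.
rewrite (fock_sum u); apply: big_rec => // -[M a] v _ hv.
apply: hl => //=.
have -> : fbas F M a = fmul (fbas F M 0) (fe F a).
  by rewrite fmulE mulcm0 add0r.
apply: (hm) => //; move: M; apply: cmonom_ind => [|x M hM]; first exact: he.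
have -> : fbas F (mulcm (ucm x) M) 0 = fmul (fx F x) (fbas F M 0).
  by rewrite fmulE addr0.
exact: hm.
Qed.

Section Universal.
Variables (U : lmodType F) (one : U) (op : Monoid.com_law one).
Hypothesis op_bilin : bilin op.
Variables (p : 'I_n * nat -> U) (q : 'rV[int]_n -> U).
Hypotheses (qD : forall a b, q (a + b) = op (q a) (q b)) (q0 : q 0 = one).

(** Universal property of B_L: an algebra morphism to a commutative algebra amounts to arbitrary
    images of the variables and a multiplicative family indexed by L. It produces both the coproduct
    and the module structure [ym]. *)
Definition fock_eval : fk -> U := linext (fun M a => op (evalcm op p M) (q a)).

Lemma fock_eval_linear : linear fock_eval.
Proof. exact: linext_linear. Qed.

Lemma fock_evalM u v : fock_eval (fmul u v) = op (fock_eval u) (fock_eval v).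
Proof.
have [h1 h2] := fmul_bilin; have [o1 o2] := op_bilin.
have he := fock_eval_linear.
move: u; apply: fock_linear_ext => [||M a].
- exact: (linear_comp (h1 v) he).
- exact: (linear_comp he (o1 _)).
move: v; apply: fock_linear_ext => [||N b].
- exact: (linear_comp (h2 _) he).
- exact: (linear_comp he (o2 _)).
by rewrite fmulE /fock_eval !linextE evalcmM qD Monoid.mulmACA.
Qed.

Lemma fock_eval_e a : fock_eval (fe F a) = q a.
Proof. by rewrite /fock_eval linextE evalcm1 Monoid.mul1m. Qed.

Lemma fock_eval_x x : fock_eval (fx F x) = p x.
Proof. by rewrite /fock_eval linextE evalcmU q0 Monoid.mulm1. Qed.

End Universal.

Lemma fder_linear : linear (@fder F n).
Proof. by rewrite fder.unlock; exact: linext_linear. Qed.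

Lemma fder_basE M a : fder (fbas F M a) =
    \sum_(x <- finsupp M) ((M x * x.2.+1)%N%:R : F) *:
        fbas F (mulcm (ucm (x.1, x.2.+1)) (divcm M (ucm x))) a
    + \sum_i ((a 0 i)%:~R : F) *: fbas F (mulcm (ucm (i, 0%N)) M) a.
Proof. by rewrite fder.unlock /bl_der linextE fbas.unlock. Qed.

Lemma fder_basEw (D : {fset ('I_n * nat)%type}) M a : (finsupp M `<=` D)%fset ->
  fder (fbas F M a) =
    \sum_(x <- D) ((M x * x.2.+1)%N%:R : F) *:
        fbas F (mulcm (ucm (x.1, x.2.+1)) (divcm M (ucm x))) a
    + \sum_i ((a 0 i)%:~R : F) *: fbas F (mulcm (ucm (i, 0%N)) M) a.
Proof.
move=> hD; rewrite fder_basE; congr (_ + _).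
apply: (big_fset_incl _ hD) => x _ hx.
by rewrite (_ : M x = 0%N) ?mul0n ?scale0r //; apply/eqP; rewrite cmE_eq0.
Qed.

(** Both sums in [fder_basE] satisfy the Leibniz rule separately: the multiplicities M x in the
    first and the exponents a in the second are additive under multiplication. *)
Lemma fderM u v : fder (fmul u v) = fmul (fder u) v + fmul u (fder v).
Proof.
have [h1 h2] := fmul_bilin; have hd := fder_linear.
move: u; apply: fock_linear_ext => [||M a].
- exact: (linear_comp (h1 v) hd).
- exact: (linear_add (linear_comp hd (h1 v)) (h1 _)).
move: v; apply: fock_linear_ext => [||N b].
- exact: (linear_comp (h2 _) hd).
- exact: (linear_add (h2 _) (linear_comp hd (h2 _))).
pose D := (finsupp M `|` finsupp N)%fset.
rewrite fmulE (fder_basEw (D := D)); last by rewrite (mdomD M N).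
rewrite (fder_basEw (D := D) _ (fsubsetUl _ _)).
rewrite (fder_basEw (D := D) _ (fsubsetUr _ _)).
rewrite (linearDf (h1 _)) (linearDf (h2 _)) addrACA.
rewrite !(linear_sumf _ _ _ (h1 _)) !(linear_sumf _ _ _ (h2 _)) -!big_split.
congr (_ + _); apply: eq_bigr => x _ /=.
  rewrite !(linearZf (h1 _)) !(linearZf (h2 _)) !fmulE.
  rewrite (mulcmE M N x) mulnDl natrD scalerDl; apply: (congr2 +%R).
    case: (posnP (M x)) => [->|hx]; first by rewrite !mul0n !scale0r.
    by congr (_ *: fbas F _ _); apply: mulcm_divl.
  case: (posnP (N x)) => [->|hx]; first by rewrite !mul0n !scale0r.
  by congr (_ *: fbas F _ _); apply: mulcm_divr.
rewrite !(linearZf (h1 _)) !(linearZf (h2 _)) !fmulE.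
rewrite mxE intrD scalerDl; apply: (congr2 +%R); congr (_ *: fbas F _ _).
  exact: mulcmA.
exact: mulcmCA.
Qed.

Lemma fder_x (i : 'I_n) m : fder (fx F (i, m)) = m.+1%:R *: fx F (i, m.+1).
Proof.
rewrite fder_basE mdomU big_seq_fset1 ucmE eqxx mul1n /=.
rewrite [X in _ + X]big1 => [|j _]; last by rewrite mxE scale0r.
rewrite addr0; congr (_ *: fbas F _ _).
by apply: cmonom_eq => j; rewrite mulcmE divcmE subnn addn0.
Qed.

Lemma fder_e a : fder (fe F a) =
  fmul (\sum_i ((a 0 i)%:~R : F) *: fx F (i, 0%N)) (fe F a).
Proof.
have [h1 h2] := fmul_bilin.
rewrite fder_basE mdom1 big_seq_fset0 add0r (linear_sumf _ _ _ (h1 _)).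
apply: eq_bigr => i _; rewrite (linearZf (h1 _)) fmulE.
by rewrite mulcm0 add0r.
Qed.

Lemma fder1 : fder (fe F (0 : 'rV[int]_n)) = 0.
Proof.
rewrite (fder_e 0) big1 ?(linear0 (fmul_bilin.1 _)) // => i _.
by rewrite mxE scale0r.
Qed.

End Fock.

Lemma fsum_flip (V : zmodType) (F : int -> V) (d : int) :
  \sum_(i \in [set: int]) F (d - i) = \sum_(i \in [set: int]) F i.
Proof.
apply/esym/(@reindex_fsbigT _ _ _ _ _ (fun i : int => d - i) F).
by exists (fun i => d - i) => i; rewrite opprB addrC subrK.
Qed.

(** * The vertex bialgebra B_L *)

Section DividedPowers.
Variable F : numFieldType.
Implicit Types U V W : lmodType F.

Lemma factV_neq0 j : (j`!)%:R != 0 :> F.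
Proof. by rewrite pnatr_eq0 -lt0n fact_gt0. Qed.

(** The coefficient of x^j in e^(xD). With divided powers the Leibniz rule has no binomial
    coefficients. *)
Definition dpow U (D : U -> U) (j : nat) (u : U) : U := (j`!)%:R^-1 *: iter j D u.

Lemma dpow0 U (D : U -> U) u : dpow D 0 u = u.
Proof. by rewrite /dpow fact0 invr1 scale1r. Qed.

Lemma iter_linear U (D : U -> U) j : linear D -> linear (iter j D).
Proof. by move=> hD; elim: j => [|j IH] //=; apply: linear_comp. Qed.

Lemma dpow_linear U (D : U -> U) j : linear D -> linear (dpow D j).
Proof. by move=> hD; apply/linear_scale/iter_linear. Qed.

Lemma dpow_comp U (D : U -> U) i j u : linear D ->
  dpow D i (dpow D j u) = 'C(i + j, j)%:R *: dpow D (i + j) u.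
Proof.
move=> hD; rewrite /dpow (linearZf (iter_linear _ hD)) -iterD !scalerA.
congr (_ *: _).
have /(congr1 (fun k => k%:R : F)) := bin_fact (leq_addl i j).
rewrite addnK !natrM => <-.
move: (factV_neq0 i) (factV_neq0 j).
have : ('C(i + j, j))%:R != 0 :> F by rewrite pnatr_eq0 -lt0n bin_gt0 leq_addl.
move=> h1 h2 h3; field; exact/and3P.
Qed.

Lemma dpow_morph U V (f : U -> V) (D : U -> U) (D' : V -> V) j u :
  linear f -> (forall u, f (D u) = D' (f u)) -> f (dpow D j u) = dpow D' j (f u).
Proof.
move=> hf h; rewrite /dpow linearZf //; congr (_ *: _).
by elim: j => //= j IH; rewrite h IH.
Qed.

Lemma dpow_leibniz U V W (b : U -> V -> W) D1 D2 D3 :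
  bilin b -> linear D3 ->
  (forall u v, D3 (b u v) = b (D1 u) v + b u (D2 v)) ->
  forall j u v, dpow D3 j (b u v) =
    \sum_(i < j.+1) b (dpow D1 i u) (dpow D2 (j - i) v).
Proof.
move=> hb h3 hD j u v.
have E : iter j D3 (b u v) =
    \sum_(i < j.+1) 'C(j, i)%:R *: b (iter i D1 u) (iter (j - i) D2 v).
  elim: j => [|j IH]; first by rewrite big_ord1 bin0 scale1r.
  rewrite (@sum_shift_bin _ _ _ (fun i => b (iter i D1 u) (iter (j.+1 - i) D2 v))).
  rewrite iterS IH linear_sumf // -big_split; apply: eq_bigr => i _ /=.
  by rewrite linearZf // hD scalerDr addrC subSS subSn ?leq_ord.
rewrite /dpow E scaler_sumr; apply: eq_bigr => i _.
rewrite (linearZf (hb.1 _)) (linearZf (hb.2 _)) !scalerA; congr (_ *: _).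
have /(congr1 (fun k => k%:R : F)) := bin_fact (leq_ord i).
rewrite !natrM => <-.
have : ('C(j, i))%:R != 0 :> F by rewrite pnatr_eq0 -lt0n bin_gt0 leq_ord.
move: (factV_neq0 i) (factV_neq0 (j - i)) => h1 h2 h3'.
field; exact/and3P.
Qed.

End DividedPowers.

Section VertexBialgebra.
Variables (F : numFieldType) (n : nat).
Local Notation fk := (fock F n).
Implicit Types (u v : fk).

Definition ftmul : tensor fk fk -> tensor fk fk -> tensor fk fk :=
  tmul (@fmul F n) (@fmul F n).
Definition ft1 : tensor fk fk := tens (fe F 0) (fe F 0).

Lemma ftmul_bilin : bilin ftmul.
Proof. exact: (tmul_bilin (fmul_bilin F n) (fmul_bilin F n)). Qed.

Lemma ftmulE a b c d : ftmul (tens a b) (tens c d) = tens (fmul a c) (fmul b d).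
Proof. exact: (tmulE (fmul_bilin F n) (fmul_bilin F n)). Qed.

Lemma ftmulA : associative ftmul.
Proof.
by apply: (tmulA (fmul_bilin F n) (fmul_bilin F n)); apply: fmulA.
Qed.

Lemma ftmulC : commutative ftmul.
Proof.
by apply: (tmulC (fmul_bilin F n) (fmul_bilin F n)); apply: fmulC.
Qed.

Lemma ftmul1 : left_id ft1 ftmul.
Proof.
by apply: (tmul1 (fmul_bilin F n) (fmul_bilin F n)); apply: fmul1.
Qed.

HB.instance Definition _ :=
  Monoid.isComLaw.Build (tensor fk fk) ft1 ftmul ftmulA ftmulC ftmul1.

Definition fcomul_def : fk -> tensor fk fk :=
  fock_eval ftmul (fun x => tens (fx F x) (fe F 0) + tens (fe F 0) (fx F x))
    (fun a => tens (fe F a) (fe F a)).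

Lemma bas_fbas : @bas F n = @fbas F n.
Proof. by rewrite fbas.unlock. Qed.

Lemma bl_mul_fmul : @bl_mul F n = @fmul F n.
Proof. by rewrite fmul.unlock. Qed.

Lemma bl_der_fder : @bl_der F n = @fder F n.
Proof. by rewrite fder.unlock. Qed.

Lemma fock_e_fe : @fock_e F n = @fe F n.
Proof. by rewrite /fock_e bas_fbas. Qed.

Lemma fock1_fe : fock1 F n = fe F 0.
Proof. by rewrite /fock1 bas_fbas. Qed.

Lemma bl_tmul_ftmul : @bl_tmul F n = ftmul.
Proof. by rewrite /bl_tmul bl_mul_fmul. Qed.

Lemma bl_comul_fcomul : @bl_comul F n = fcomul_def.
Proof. by rewrite /bl_comul bl_tmul_ftmul fock1_fe fock_e_fe bas_fbas. Qed.

End VertexBialgebra.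

HB.lock Definition fcomul (F : numFieldType) (n : nat) :
  fock F n -> tensor (fock F n) (fock F n) := @fcomul_def F n.
HB.lock Definition fcounit (F : numFieldType) (n : nat) : fock F n -> F^o :=
  @bl_counit F n.

Section Bialgebra.
Variables (F : numFieldType) (n : nat).
Local Notation fk := (fock F n).
Local Notation D := (@fcomul F n).
Local Notation e := (@fcounit F n).
Implicit Types (u v : fk).

Lemma fcomul_linear : linear D.
Proof. by rewrite fcomul.unlock; exact: fock_eval_linear. Qed.

Let qD a b : tens (fe F (a + b)) (fe F (a + b)) =
  ftmul (tens (fe F a) (fe F a)) (tens (fe F b) (fe F b)) :> tensor fk fk.
Proof. by rewrite ftmulE /fe fmulE mulcm0. Qed.

Lemma fcomulM u v : D (fmul u v) = ftmul (D u) (D v).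
Proof.
by rewrite fcomul.unlock; apply: (fock_evalM (ftmul_bilin F n) _ qD).
Qed.

Lemma fcomul_e a : D (fe F a) = tens (fe F a) (fe F a).
Proof. by rewrite fcomul.unlock; apply: fock_eval_e. Qed.

Lemma fcomul_x x : D (fx F x) = tens (fx F x) (fe F 0) + tens (fe F 0) (fx F x).
Proof. by rewrite fcomul.unlock; apply: fock_eval_x. Qed.

Lemma fcounit_linear : linear e.
Proof. by rewrite fcounit.unlock; exact: linext_linear. Qed.

Lemma fcounit_bas M a : e (fbas F M a) = (M == onecm _)%:R.
Proof. by rewrite fcounit.unlock /bl_counit linextE. Qed.

Lemma fcounit_e (a : 'rV[int]_n) : e (fe F a) = 1.
Proof. by rewrite fcounit_bas eqxx. Qed.

Lemma fcounit_x (x : 'I_n * nat) : e (fx F x) = 0.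
Proof. by rewrite fcounit_bas (cm1_eq1 x). Qed.

Lemma mulFo_bilin : bilin (fun a b : F^o => (a * b : F^o)).
Proof.
by split=> [b|a] c x y /=; rewrite ?mulrDl ?mulrDr -?scalerAl -?scalerAr.
Qed.

Lemma fcounitM u v : e (fmul u v) = e u * e v.
Proof.
have [h1 h2] := fmul_bilin F n; have [m1 m2] := mulFo_bilin.
have he := fcounit_linear.
move: u; apply: fock_linear_ext => [||M a].
- exact: (linear_comp (h1 v) he).
- exact: (linear_comp he (m1 _)).
move: v; apply: fock_linear_ext => [||N b].
- exact: (linear_comp (h2 _) he).
- exact: (linear_comp he (m2 _)).
rewrite fmulE !fcounit_bas -natrM mulnb; congr (nat_of_bool _)%:R.
exact: cmM_eq1.
Qed.

(** This is what makes the counit a morphism to the trivial vertex algebra, whose vertex operators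
    are constant in x. *)
Lemma fcounit_der u : e (fder u) = 0.
Proof.
move: u; apply: fock_gen_ind => [c u v hu hv|a|[i m]|u v hu hv].
- by rewrite fder_linear fcounit_linear hu hv scaler0 addr0.
- rewrite fder_e fcounitM (linear_sumf _ _ _ fcounit_linear) big1 ?mul0r // => i _.
  by rewrite (linearZf fcounit_linear) fcounit_x scaler0.
- by rewrite fder_x (linearZf fcounit_linear) fcounit_x scaler0.
by rewrite fderM (linearDf fcounit_linear) !fcounitM hu hv mul0r mulr0 addr0.
Qed.

(** In each axiom both sides are algebra morphisms of h, so it is enough that the e^a are grouplike
    and the variables primitive. *)
Lemma fock_coalgebra : is_coalgebra D e.
Proof.
have hD := fcomul_linear; have he := fcounit_linear.
have hm := fmul_bilin F n; have hid := @linear_id F fk.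
have b1 : bilin (fun h1 h2 : fk => e h1 *: h2).
  split=> [h2|h1] a x y; first by rewrite he scalerDl scalerA.
  by rewrite scalerDr !scalerA mulrC.
have b2 : bilin (fun h1 h2 : fk => e h2 *: h1).
  by split=> ?; [apply: b1.2|apply: b1.1].
split=> // h.
- move: h; apply: fock_gen_ind => [c u v hu hv|a|x|u v hu hv].
  + rewrite hD (tmap_linear hD hid) (tmap_linear hid hD) tassoc_linear.
    by rewrite hu hv.
  + by rewrite fcomul_e !tmapE // !fcomul_e tassocE.
  + rewrite fcomul_x (linearDf (tmap_linear hD hid)).
    rewrite (linearDf (tmap_linear hid hD)) !tmapE // !fcomul_x !fcomul_e.
    rewrite (linearDf ((tens_bilin _ _).1 _)) (linearDf ((tens_bilin _ _).2 _)).
    by rewrite !(linearDf (@tassoc_linear _ _ _ _)) !tassocE addrA.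
  have hT := ftmul_bilin F n.
  rewrite fcomulM /ftmul (tmapM hm hm hT hm) //; last exact: fcomulM.
  rewrite (tassocM hm hm hm) hu hv.
  by rewrite (tmapM hm hm hm hT) //; exact: fcomulM.
- move: h; apply: fock_gen_ind => [c u v hu hv|a|x|u v hu hv].
  + by rewrite hD (tlift_linear b1) hu hv.
  + by rewrite fcomul_e (tliftE _ _ b1) fcounit_e scale1r.
  + by rewrite fcomul_x (linearDf (tlift_linear b1)) !(tliftE _ _ b1) fcounit_x
      fcounit_e scale0r add0r scale1r.
  rewrite -{2}hu -{2}hv fcomulM (tlift_tmul hm hm _ _ b1) /tlift.
  rewrite (linear_sumf _ _ _ (hm.1 _)); apply: eq_bigr => p _.
  rewrite (linear_sumf _ _ _ (hm.2 _)); apply: eq_bigr => q _.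
  by rewrite (linearZf (hm.1 _)) (linearZf (hm.2 _)) scalerA fcounitM.
- move: h; apply: fock_gen_ind => [c u v hu hv|a|x|u v hu hv].
  + by rewrite hD (tlift_linear b2) hu hv.
  + by rewrite fcomul_e (tliftE _ _ b2) fcounit_e scale1r.
  + by rewrite fcomul_x (linearDf (tlift_linear b2)) !(tliftE _ _ b2) fcounit_x
      fcounit_e scale0r addr0 scale1r.
  rewrite -{2}hu -{2}hv fcomulM (tlift_tmul hm hm _ _ b2) /tlift.
  rewrite (linear_sumf _ _ _ (hm.1 _)); apply: eq_bigr => p _.
  rewrite (linear_sumf _ _ _ (hm.2 _)); apply: eq_bigr => q _.
  by rewrite (linearZf (hm.1 _)) (linearZf (hm.2 _)) scalerA fcounitM.
Qed.

(** The derivation d (x) 1 + 1 (x) d, whose exponential gives the vertex operators of B_L (x) B_L.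
    The coproduct intertwines it with d, hence is a morphism of vertex algebras. *)
Definition tder (t : tensor fk fk) : tensor fk fk :=
  tmap (@fder F n) id t + tmap id (@fder F n) t.

Lemma tder_linear : linear tder.
Proof.
by apply: linear_add; apply: tmap_linear => //; exact: fder_linear.
Qed.

Lemma tderE a b : tder (tens a b) = tens (fder a) b + tens a (fder b).
Proof. by rewrite /tder !tmapE //; exact: fder_linear. Qed.

Lemma tderM s t : tder (ftmul s t) = ftmul (tder s) t + ftmul s (tder t).
Proof.
have [t1 t2] := ftmul_bilin F n; have hd := tder_linear.
move: s; apply: tens_linear_ext => [||a b].
- exact: (linear_comp (t1 t) hd).
- exact: (linear_add (linear_comp hd (t1 t)) (t1 (tder t))).
move: t; apply: tens_linear_ext => [||c d].
- exact: (linear_comp (t2 _) hd).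
- exact: (linear_add (t2 _) (linear_comp hd (t2 _))).
rewrite ftmulE !tderE (linearDf (t1 _)) (linearDf (t2 _)) !ftmulE !fderM.
rewrite (linearDf ((tens_bilin _ _).1 _)) (linearDf ((tens_bilin _ _).2 _)).
by rewrite addrACA.
Qed.

Lemma fcomul_der u : D (fder u) = tder (D u).
Proof.
have hD := fcomul_linear; have hT := tder_linear.
move: u; apply: fock_gen_ind => [c u v hu hv|a|[i m]|u v hu hv].
- by rewrite fder_linear !hD hT hu hv.
- rewrite fder_e fcomulM fcomul_e tderE fder_e; set s := \sum_i _.
  have -> : D s = tens s (fe F 0) + tens (fe F 0) s.
    rewrite /s (linear_sumf _ _ _ hD) (linear_sumf _ _ _ ((tens_bilin _ _).1 _)).
    rewrite (linear_sumf _ _ _ ((tens_bilin _ _).2 _)) -big_split.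
    apply: eq_bigr => i _ /=; rewrite (linearZf hD) fcomul_x scalerDr.
    by rewrite (linearZf ((tens_bilin _ _).1 _)) (linearZf ((tens_bilin _ _).2 _)).
  by rewrite (linearDf ((ftmul_bilin F n).1 _)) !ftmulE fmul1.
- rewrite fder_x (linearZf hD) !fcomul_x (linearDf hT) !tderE !fder_x !fder1.
  rewrite (linear0 ((tens_bilin _ _).1 _)) (linear0 ((tens_bilin _ _).2 _)).
  rewrite (linearZf ((tens_bilin _ _).1 _)) (linearZf ((tens_bilin _ _).2 _)).
  by rewrite addr0 add0r scalerDr.
by rewrite fderM (linearDf hD) !fcomulM hu hv tderM.
Qed.

Lemma BL_vop u v (j : nat) : vop (BL F n) u v j%:Z = fmul (dpow (@fder F n) j u) v.
Proof.
rewrite /= bl_mul_fmul bl_der_fder.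
by rewrite (linearZf ((fmul_bilin F n).1 _)).
Qed.

Lemma BL_vopN u v (m : int) : m < 0 -> vop (BL F n) u v m = 0.
Proof. by case: m. Qed.

Lemma fdpowM j u v : dpow (@fder F n) j (fmul u v) =
  \sum_(i < j.+1) fmul (dpow (@fder F n) i u) (dpow (@fder F n) (j - i) v).
Proof.
apply: (dpow_leibniz (fmul_bilin F n) (@fder_linear F n)).
exact: fderM.
Qed.

Lemma fdpow1 j : dpow (@fder F n) j.+1 (fe F 0) = 0.
Proof.
rewrite /dpow iterSr fder1 (linear0 (iter_linear _ (@fder_linear F n))).
exact: scaler0.
Qed.

(** Taylor's formula: Y(u, x2 + x0) = sum_p x0^p Y(d^p u / p!, x2), and products of vertex operators
    are vertex operators of products. The exponent k of weak associativity can thus be 0. The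
    criterion serves for B_L itself and for [YM]. *)
Lemma fock_weak_assoc (W : lmodType F) (YW : fk -> W -> int -> W) :
  (forall u m, linear (fun w => YW u w m)) -> (forall w m, YW 0 w m = 0) ->
  (forall u w m, m < 0 -> YW u w m = 0) ->
  (forall u v w m, YW (fmul u v) w m = scomp (YW u) (YW v) w m) ->
  (forall p u w m, YW (dpow (@fder F n) p u) w m =
     ibin F (m + p%:Z) p *: YW u w (m + p%:Z)) ->
  weak_assoc (vop (BL F n)) YW.
Proof.
move=> hl h0 hN hM hd u v; exists 0%N => w; rewrite mul_diff0; split.
  exists 0 => a b /orP[ha|hb]; first exact: hN.
  by rewrite [YW v w b]hN // (linear0 (hl _ _)).
move=> p c; rewrite subr0; case: p => [j|j]; last by rewrite BL_vopN // h0.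
rewrite BL_vop hM /scomp /= -(fsum_flip _ (c + j%:Z)).
apply: eq_fsbigr => a _; rewrite hd.
have -> : c - a + j%:Z = c + j%:Z - a by lia.
by have -> : c + j%:Z - (c + j%:Z - a) = a by lia.
Qed.

Lemma BL_bilin m : bilin (fun u v => vop (BL F n) u v m).
Proof.
case: m => j; last by split=> ?; exact: linear_zero.
have hf := dpow_linear j (@fder_linear F n).
have [b1 b2] := bilin_comp (fmul_bilin F n) hf (@linear_id _ _).
by split=> x a y z; rewrite !BL_vop; [apply: b1|apply: b2].
Qed.

(** The exponential e^(xd) of a derivation is multiplicative. *)
Lemma BL_scomp u v w m : vop (BL F n) (fmul u v) w m =
  scomp (vop (BL F n) u) (vop (BL F n) v) w m.
Proof.
have h0 x c : vop (BL F n) x 0 c = 0 by apply: (linear0 ((BL_bilin c).2 x)).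
case: m => j; last first.
  rewrite BL_vopN // /scomp fsbig1 // => i _; case: (ltP i 0) => hi.
    by rewrite [vop _ v w i]BL_vopN.
  by rewrite BL_vopN //; lia.
rewrite BL_vop fdpowM (linear_sumf _ _ _ ((fmul_bilin F n).1 w)) /scomp.
rewrite (@fsum_posz _ j.+1) => [|i hi|i hi]; first last.
- by rewrite BL_vopN //; lia.
- by rewrite [vop _ v w i]BL_vopN.
rewrite [LHS](reindex_inj rev_ord_inj); apply: eq_bigr => i _.
have hi := ltn_ord i.
have -> : j%:Z - i%:Z = (j - i)%N%:Z by lia.
rewrite !BL_vop fmulA /= subSS; congr (fmul (fmul _ (dpow _ _ v)) w).
by lia.
Qed.

Lemma BL_nlva : is_nlva (BL F n).
Proof.
have hfd := @fder_linear F n.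
have vac_e : vac (BL F n) = fe F 0 by rewrite /= fock1_fe.
split.
- exact: BL_bilin.
- by move=> u v; exists 0 => m; exact: BL_vopN.
- move=> v; apply/funext => m; rewrite vac_e /cst_series.
  case: m => [[|j]|j] //; first by rewrite BL_vop dpow0 fmul1.
  by rewrite BL_vop fdpow1 (linear0 ((fmul_bilin F n).1 _)).
- by move=> v m; exact: BL_vopN.
- by move=> v; rewrite vac_e BL_vop dpow0 fmulr1.
apply: fock_weak_assoc.
- by move=> u m; exact: (BL_bilin m).2.
- by move=> w m; exact: (linear0 ((BL_bilin m).1 w)).
- by move=> u w m; exact: BL_vopN.
- exact: BL_scomp.
move=> p u w m; case: m => [j|j].
  rewrite -PoszD !BL_vop (dpow_comp _ _ _ hfd) ibin_nat.
  exact: (linearZf ((fmul_bilin F n).1 w)).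
rewrite BL_vopN //; case: (ltP (Negz j + p%:Z) 0) => h.
  by rewrite [vop _ _ _ (_ + _)]BL_vopN ?scaler0.
have [q hq] : exists q : nat, Negz j + p%:Z = q%:Z.
  by exists (absz (Negz j + p%:Z)); lia.
by rewrite hq ibin_nat bin_small ?scale0r //; lia.
Qed.

Lemma BL_local : local (BL F n).
Proof.
move=> u v; exists 0%N => w a b; rewrite !mul_diff0.
have h0 x c : vop (BL F n) x 0 c = 0 by apply: (linear0 ((BL_bilin c).2 x)).
case: a => a; last by rewrite BL_vopN // [vop _ u w _]BL_vopN.
case: b => b; last by rewrite [RHS]BL_vopN // [vop _ v w _]BL_vopN.
by rewrite !BL_vop; exact: fmulCA.
Qed.

Lemma tensor_vaE (V H : lmodType F) (A : preva V) (B : preva H) s t m :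
  vop (tensor_va A B) s t m =
  \sum_(p <- repr s) \sum_(q <- repr t) \sum_(j \in [set: int])
     tens (vop A p.1 q.1 j) (vop B p.2 q.2 (m - j)).
Proof. by []. Qed.

(** The exponential of d (x) 1 + 1 (x) d is e^(xd) (x) e^(xd). *)
Lemma tensor_BL_vop s t (j : nat) :
  vop (tensor_va (BL F n) (BL F n)) s t j%:Z = ftmul (dpow tder j s) t.
Proof.
have [t1 t2] := ftmul_bilin F n; have hT := tder_linear.
rewrite {2}(tens_sum s) (linear_sumf _ _ _ (dpow_linear j hT)).
rewrite (linear_sumf _ _ _ (t1 t)) tensor_vaE; apply: eq_bigr => p _.
rewrite {2}(tens_sum t) (linear_sumf _ _ _ (t2 _)); apply: eq_bigr => q _.
rewrite (@dpow_leibniz _ _ _ _ (@tens F fk fk) (@fder F n) (@fder F n) tder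
  (tens_bilin _ _) hT tderE j p.1 p.2).
rewrite (linear_sumf _ _ _ (t1 _)) (@fsum_posz _ j.+1) => [|i hi|i hi]; first last.
- rewrite [vop _ p.2 _ _]BL_vopN ?(linear0 ((tens_bilin _ _).2 _)) //; lia.
- by rewrite [vop _ p.1 _ _]BL_vopN ?(linear0 ((tens_bilin _ _).1 _)).
apply: eq_bigr => i _; rewrite ftmulE.
have -> : j%:Z - i%:Z = (j - i)%N%:Z by have := ltn_ord i; lia.
by rewrite !BL_vop.
Qed.

Lemma tensor_BL_vopN s t (m : int) : m < 0 ->
  vop (tensor_va (BL F n) (BL F n)) s t m = 0.
Proof.
move=> hm; rewrite tensor_vaE big1 // => p _; rewrite big1 // => q _.
rewrite fsbig1 // => i _; case: (ltP i 0) => hi.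
  by rewrite [vop _ p.1 _ _]BL_vopN // (linear0 ((tens_bilin _ _).1 _)).
rewrite [vop _ p.2 _ _]BL_vopN ?(linear0 ((tens_bilin _ _).2 _)) //; lia.
Qed.

Lemma BL_comulE : comul (BL F n) = D.
Proof. by rewrite fcomul.unlock /= bl_comul_fcomul. Qed.

Lemma BL_counitE : counit (BL F n) = e.
Proof. by rewrite fcounit.unlock. Qed.

Lemma BL_vacE : vac (BL F n) = fe F 0.
Proof. by rewrite /= fock1_fe. Qed.

Lemma BL_nlvb : is_nlvb (BL F n).
Proof.
have hm := fmul_bilin F n.
split; rewrite ?BL_comulE ?BL_counitE.
- exact: BL_nlva.
- exact: fock_coalgebra.
- split; first exact: fcomul_linear.
    by rewrite BL_vacE fcomul_e /= fock1_fe.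
  move=> u v [j|j]; last first.
    by rewrite BL_vopN // tensor_BL_vopN // (linear0 fcomul_linear).
  rewrite BL_vop tensor_BL_vop fcomulM; congr (ftmul _ _).
  exact: (dpow_morph _ _ fcomul_linear fcomul_der).
split; first exact: fcounit_linear.
  by rewrite BL_vacE fcounit_e.
move=> u v [[|j]|j].
- by rewrite BL_vop dpow0 fcounitM.
- rewrite BL_vop fcounitM /dpow iterS (linearZf fcounit_linear).
  by rewrite fcounit_der scaler0 mul0r.
by rewrite BL_vopN // (linear0 fcounit_linear).
Qed.

End Bialgebra.

(** * Commutative rings of operator series *)

(** Both sides equal (a + q + j)! / (a! q! j!). The identity governs the composition of divided
    derivatives and the coefficients in [coprod_phi]. *)
Lemma bin_trinomial a q j :
  ('C(a + q, q) * 'C(a + q + j, j) = 'C(a + q + j, q + j) * 'C(q + j, j))%N.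
Proof.
have h1 := bin_fact (leq_addl a q); have h2 := bin_fact (leq_addl (a + q) j).
have h3 : ('C(a + q + j, q + j) * ((q + j)`! * a`!) = (a + q + j)`!)%N.
  by rewrite -(bin_fact (_ : q + j <= a + q + j)%N); [rewrite -addnA addnK|lia].
have h4 := bin_fact (leq_addl q j).
rewrite !addnK in h1 h2 h4.
apply/eqP; rewrite -(eqn_pmul2r (_ : 0 < a`! * q`! * j`!)%N); last first.
  by rewrite !muln_gt0 !fact_gt0.
apply/eqP; transitivity ((a + q + j)`!)%N.
  by rewrite -h2 -h1; ring.
by rewrite -h3 -h4; ring.
Qed.

(** * Rearrangements of finite sums *)

Section TriangularSums.
Variable V : zmodType.

Lemma sum_tri (m : nat) (g : nat -> nat -> V) :
  \sum_(j < m.+1) \sum_(i < j.+1) g i (j - i)%N =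
  \sum_(i < m.+1) \sum_(l < (m - i).+1) g i l.
Proof.
elim: m => [|m IH]; first by rewrite !big_ord1.
rewrite big_ord_recr IH /= [RHS]big_ord_recr /= subnn big_ord1.
rewrite [X in _ + X]big_ord_recr /= subnn addrA; congr (_ + _).
rewrite -big_split; apply: eq_bigr => i _ /=.
by rewrite subSn ?leq_ord // [RHS]big_ord_recr.
Qed.

Lemma sum_tri_sym (m : nat) (g : nat -> nat -> V) :
  \sum_(i < m.+1) \sum_(l < (m - i).+1) g i l =
  \sum_(l < m.+1) \sum_(i < (m - l).+1) g i l.
Proof.
rewrite -!(sum_tri m) -(sum_tri m (fun l i => g i l)).
apply: eq_bigr => j _; rewrite (reindex_inj rev_ord_inj).
by apply: eq_bigr => i _; rewrite /= subSS subKn ?leq_ord.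
Qed.

Lemma sum_tri_square (K : nat) (g : nat -> nat -> V) :
  (forall k l, (K <= k + l)%N -> g k l = 0) ->
  \sum_(k < K) \sum_(l < K) g k l = \sum_(q < K) \sum_(k < q.+1) g k (q - k)%N.
Proof.
case: K => [|m] hg; first by rewrite !big_ord0.
rewrite sum_tri; apply: eq_bigr => k _.
have hk := ltn_ord k.
rewrite -(big_mkord xpredT (g k)) -(big_mkord xpredT (g k)).
rewrite (@big_cat_nat _ _ _ (m - k).+1) //=; last by rewrite ltnS leq_subr.
rewrite [X in _ + X = _](_ : _ = 0) ?addr0 //.
by rewrite big_nat big1 // => l /andP[h _]; apply: hg; lia.
Qed.

(** Both sides run over the quadruples with sum a. On the left the first and third entries are
    grouped, on the right the first and second, as needed to regroup a product of operators in
    [coprod_act]. *)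
Lemma sum_conv4 (a : nat) (g : nat -> nat -> nat -> nat -> V) :
  \sum_(j < a.+1) \sum_(i < j.+1) \sum_(p < (a - j).+1)
    g i p (j - i)%N (a - j - p)%N =
  \sum_(r < a.+1) \sum_(i < r.+1) \sum_(c < (a - r).+1)
    g i (r - i)%N c (a - r - c)%N.
Proof.
pose h1 i c := \sum_(p < (a - i - c).+1) g i p c (a - i - c - p)%N.
pose h2 i p := \sum_(c < (a - i - p).+1) g i p c (a - i - p - c)%N.
transitivity (\sum_(j < a.+1) \sum_(i < j.+1) h1 i (j - i)%N).
  apply: eq_bigr => j _; apply: eq_bigr => i _; rewrite /h1.
  by have -> : (a - i - (j - i) = a - j)%N by have := ltn_ord i; lia.
transitivity (\sum_(j < a.+1) \sum_(i < j.+1) h2 i (j - i)%N); last first.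
  apply: eq_bigr => j _; apply: eq_bigr => i _; rewrite /h2.
  by have -> : (a - i - (j - i) = a - j)%N by have := ltn_ord i; lia.
rewrite !sum_tri; apply: eq_bigr => i _; rewrite /h1 /h2.
rewrite (sum_tri_sym (a - i) (fun c p => g i p c (a - i - c - p)%N)).
apply: eq_bigr => p _; apply: eq_bigr => c _.
by congr (g _ _ _ _); lia.
Qed.

Lemma sum_window (m q k : nat) (h : nat -> V) : (k <= q)%N ->
  (forall s, (s < k)%N || (k + m < s <= m + q)%N -> h s = 0) ->
  \sum_(i < m.+1) h (i + k)%N = \sum_(s < (m + q).+1) h s.
Proof.
move=> hk h0; apply/esym; rewrite -(big_mkord xpredT h).
rewrite (@big_cat_nat _ _ _ k) //=; last by lia.
rewrite [X in X + _ = _](_ : _ = 0) ?add0r; last first.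
  by rewrite big_nat big1 // => s /andP[_ hs]; rewrite h0 ?hs.
rewrite (@big_cat_nat _ _ _ (k + m).+1) //=; [|by lia|by lia].
rewrite [X in _ + X = _](_ : _ = 0) ?addr0; last first.
  by rewrite big_nat big1 // => s hs; rewrite h0 // -ltnS hs orbT.
rewrite (_ : index_iota k _ = index_iota (0 + k) (k + m).+1) // big_addn.
by rewrite (_ : ((k + m).+1 - k)%N = m.+1) ?big_mkord //; lia.
Qed.

End TriangularSums.

(** * The commutative ring of power series over the bicommutant of a commuting family *)

Record comfam (F : numFieldType) (V : lmodType F) := Comfam {
  cf_idx : Type;
  cf_op :> cf_idx -> V -> V;
  cf_linear : forall i, linear (cf_op i);
  cf_comm : forall i j v, cf_op i (cf_op j v) = cf_op j (cf_op i v) }.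

Definition subspace (F : numFieldType) (V : lmodType F) (P : V -> Prop) : Prop :=
  P 0 /\ forall c u v, P u -> P v -> P (c *: u + v).

Lemma subspaceD (F : numFieldType) (V : lmodType F) (P : V -> Prop) u v :
  subspace P -> P u -> P v -> P (u + v).
Proof. by move=> [_ h] hu hv; rewrite -[u]scale1r; apply: h. Qed.

Lemma subspaceZ (F : numFieldType) (V : lmodType F) (P : V -> Prop) c u :
  subspace P -> P u -> P (c *: u).
Proof. by move=> [h0 h] hu; rewrite -[_ *: _]addr0; apply: h. Qed.

Lemma subspace_sum (F : numFieldType) (V : lmodType F) (P : V -> Prop)
    (I : Type) (r : seq I) (Q : pred I) (g : I -> V) :
  subspace P -> (forall i, Q i -> P (g i)) -> P (\sum_(i <- r | Q i) g i).
Proof.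
move=> hP h; apply: big_ind => //; first exact: hP.1.
by move=> u v; apply: subspaceD.
Qed.

(* Power series in x with coefficients in the bicommutant of the family T     *)
(* that moreover preserve all T-stable subspaces; they form a commutative     *)
(* ring.                                                                      *)
Record op_good (F : numFieldType) (V : lmodType F) (T : comfam V)
    (A : V -> nat -> V) : Prop := OpGood {
  op_linear : forall m, linear (fun v => A v m);
  op_bicomm : forall h : V -> V, linear h ->
    (forall i v, h (T i v) = T i (h v)) -> forall v m, A (h v) m = h (A v m);
  op_stable : forall P : V -> Prop, subspace P ->
    (forall i v, P v -> P (T i v)) -> forall v m, P v -> P (A v m) }.

Definition opser (F : numFieldType) (V : lmodType F) (T : comfam V) :=
  {A : V -> nat -> V | `[< op_good T A >]}.

HB.instance Definition _ (F : numFieldType) (V : lmodType F) (T : comfam V) :=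
  Choice.on (opser T).

Definition op_val (F : numFieldType) (V : lmodType F) (T : comfam V)
  (A : opser T) : V -> nat -> V := sval A.
Coercion op_val : opser >-> Funclass.

Section OperatorSeries.
Variables (F : numFieldType) (V : lmodType F) (T : comfam V).
Implicit Types A B C : opser T.

Lemma opP A B : (forall v m, A v m = B v m) -> A = B.
Proof.
by move=> h; apply: val_inj; apply/funext => v; apply/funext => m; apply: h.
Qed.

Lemma op_valP A : op_good T A.
Proof. by case: A => A hA; apply/asboolP. Qed.

Definition mkop (A : V -> nat -> V) (h : op_good T A) : opser T :=
  exist _ A (asboolT h).

Lemma opval_linear A m : linear (fun v => A v m).
Proof. exact: (op_linear (op_valP A)). Qed.

Lemma op_commT A i v m : A (T i v) m = T i (A v m).
Proof.
apply: (op_bicomm (op_valP A)) => [|j w]; first exact: cf_linear.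
exact: cf_comm.
Qed.

(** The coefficients of B commute with the family, hence with the coefficients of A, which lie in
    the bicommutant. *)
Lemma op_comm A B v i j : A (B v i) j = B (A v j) i.
Proof.
apply: (op_bicomm (op_valP A) (h := fun v => B v i)).
  exact: opval_linear.
by move=> k w; rewrite op_commT.
Qed.

Fact good0 : op_good T (fun _ _ => 0).
Proof.
split=> [m|h hl _ v m|P hP _ v m _]; first exact: linear_zero.
  by rewrite linear0.
exact: hP.1.
Qed.

Fact goodD A B : op_good T (fun v m => A v m + B v m).
Proof.
have [a1 a2 a3] := op_valP A; have [b1 b2 b3] := op_valP B.
split=> [m|h hl hc v m|P hP hT v m hv]; first exact: linear_add.
  by rewrite a2 // b2 // linearDf.
by apply: subspaceD; [|exact: a3|exact: b3].
Qed.

Fact goodZ c A : op_good T (fun v m => c *: A v m).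
Proof.
have [a1 a2 a3] := op_valP A.
split=> [m|h hl hc v m|P hP hT v m hv]; first exact: linear_scale.
  by rewrite a2 // linearZf.
by apply: subspaceZ; [|exact: a3].
Qed.

Fact good1 : op_good T (fun v m => if m is 0 then v else 0).
Proof.
split=> [[|m]|h hl hc v [|m]|P hP hT v [|m] hv] //.
- exact: linear_zero.
- by rewrite linear0.
- exact: hP.1.
Qed.

Fact goodM A B : op_good T (fun v m => \sum_(j < m.+1) A (B v j) (m - j)%N).
Proof.
have [a1 a2 a3] := op_valP A; have [b1 b2 b3] := op_valP B.
split=> [m|h hl hc v m|P hP hT v m hv].
- by apply: linear_sum_fun => j; exact: (linear_comp (b1 j) (a1 _)).
- by rewrite linear_sumf //; apply: eq_bigr => j _; rewrite b2 // a2.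
by apply: subspace_sum => // j _; apply: a3 => //; apply: b3.
Qed.

Fact good_der q A :
  op_good T (fun v m => 'C(m + q, q)%:R *: A v (m + q)%N).
Proof.
have [a1 a2 a3] := op_valP A.
split=> [m|h hl hc v m|P hP hT v m hv]; first exact: linear_scale.
  by rewrite a2 // linearZf.
by apply: subspaceZ; [|exact: a3].
Qed.

Definition op0 := mkop good0.
Definition op1 := mkop good1.
Definition opadd A B := mkop (goodD A B).
Definition opscale c A := mkop (goodZ c A).
Definition opmul A B := mkop (goodM A B).
(** The divided derivative (1/q!) d^q/dx^q. *)
Definition op_der q A := mkop (good_der q A).

Fact opaddA : associative opadd.
Proof. by move=> A B C; apply: opP => v m; apply: addrA. Qed.
Fact opaddC : commutative opadd.
Proof. by move=> A B; apply: opP => v m; apply: addrC. Qed.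
Fact opadd0 : left_id op0 opadd.
Proof. by move=> A; apply: opP => v m; apply: add0r. Qed.
Fact opaddN : left_inverse op0 (opscale (-1)) opadd.
Proof.
by move=> A; apply: opP => v m; rewrite /= scaleN1r; apply: addNr.
Qed.

HB.instance Definition _ :=
  GRing.isZmodule.Build (opser T) opaddA opaddC opadd0 opaddN.

Fact opmulA : associative opmul.
Proof.
move=> A B C; apply: opP => v m.
transitivity (\sum_(j < m.+1) \sum_(i < j.+1)
   A (B (C v i) (j - i)%N) (m - i - (j - i))%N).
  apply: eq_bigr => j _ /=; rewrite (linear_sumf _ _ _ (opval_linear A _)).
  by apply: eq_bigr => i _; congr (op_val A _ _); have := ltn_ord i; lia.
exact: (sum_tri m (fun i l => A (B (C v i) l) (m - i - l)%N)).
Qed.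

Fact opmulC : commutative opmul.
Proof.
move=> A B; apply: opP => v m.
rewrite [LHS](reindex_inj rev_ord_inj); apply: eq_bigr => j _ /=.
by rewrite op_comm subSS subKn ?leq_ord.
Qed.

Fact opmul1 : left_id op1 opmul.
Proof.
move=> A; apply: opP => v m.
rewrite [LHS]big_ord_recr /= subnn big1 ?add0r // => j _.
by rewrite -(subnSK (ltn_ord j)).
Qed.

Fact opmulDl : left_distributive opmul opadd.
Proof. by move=> A B C; apply: opP => v m; apply: big_split. Qed.

HB.instance Definition _ :=
  GRing.Zmodule_isComPzRing.Build (opser T) opmulA opmulC opmul1 opmulDl.

Fact opscaleA a b A : opscale a (opscale b A) = opscale (a * b) A.
Proof. by apply: opP => v m; apply: scalerA. Qed.
Fact opscale1 : left_id 1 opscale.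
Proof. by move=> A; apply: opP => v m; apply: scale1r. Qed.
Fact opscaleDr : right_distributive opscale +%R.
Proof. by move=> a A B; apply: opP => v m; apply: scalerDr. Qed.
Fact opscaleDl A : {morph opscale^~ A : a b / a + b}.
Proof. by move=> a b; apply: opP => v m; apply: scalerDl. Qed.

HB.instance Definition _ :=
  GRing.Zmodule_isLmodule.Build F (opser T) opscaleA opscale1 opscaleDr opscaleDl.

Lemma opDE A B v m : op_val (A + B) v m = A v m + B v m. Proof. by []. Qed.
Lemma opZE c A v m : op_val (c *: A) v m = c *: A v m. Proof. by []. Qed.
Lemma op0E v m : op_val (0 : opser T) v m = 0. Proof. by []. Qed.
Lemma op1E v m : op_val (1 : opser T) v m = if m is 0 then v else 0. Proof. by []. Qed.
Lemma opME A B v m : op_val (A * B) v m = \sum_(j < m.+1) A (B v j) (m - j)%N.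
Proof. by []. Qed.
Lemma op_derE q A v m :
  op_der q A v m = 'C(m + q, q)%:R *: A v (m + q)%N.
Proof. by []. Qed.

Lemma opval_linear_op v m : linear (fun A : opser T => A v m : V).
Proof. by []. Qed.

Lemma op_sumE (I : Type) (r : seq I) (P : pred I) (A : I -> opser T) v m :
  op_val (\sum_(i <- r | P i) A i) v m = \sum_(i <- r | P i) A i v m.
Proof. exact: (linear_sumf _ _ _ (opval_linear_op v m)). Qed.

Lemma opmul_bilin : bilin (fun A B : opser T => A * B).
Proof.
have h (B : opser T) : linear (fun A => A * B).
  move=> a A A'; rewrite mulrDl; congr (_ + _); apply: opP => v m.
  by rewrite opME opZE opME scaler_sumr.
split=> // A a B B'; rewrite ![A * _]mulrC; exact: h.
Qed.

Lemma op_der_linear q : linear (op_der q).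
Proof.
move=> a A B; apply: opP => v m.
by rewrite !(op_derE, opDE, opZE) scalerDr !scalerA mulrC.
Qed.

(** The Leibniz rule for divided derivatives; on coefficients it is Vandermonde's identity. *)
Lemma op_derM q A B :
  op_der q (A * B) = \sum_(k < q.+1) op_der (q - k) A * op_der k B.
Proof.
apply: opP => v m; rewrite op_derE opME op_sumE.
pose X s := A (B v s) (m + q - s)%N.
transitivity (\sum_(k < q.+1) \sum_(s < (m + q).+1)
    ('C(s, k) * 'C(m + q - s, q - k))%:R *: X s).
  rewrite exchange_big /= scaler_sumr; apply: eq_bigr => s _.
  rewrite -scaler_suml -natr_sum binomial.Vandermonde; congr (_%:R *: _); congr binomial.
  by have := ltn_ord s; lia.
apply: eq_bigr => k _; rewrite opME.
pose h s := ('C(s, k) * 'C(m + q - s, q - k))%:R *: X s.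
(* Only the s between k and k + m contribute: outside this window one of the two binomial
   coefficients is 0. *)
rewrite -(@sum_window _ m q k h) ?leq_ord //; last first.
  move=> s /orP[hs|/andP[hs1 hs2]]; rewrite /h; first by rewrite bin_small ?scale0r.
  by rewrite [X in (_ * X)%N]bin_small ?muln0 ?scale0r //; have := ltn_ord k; lia.
apply: eq_bigr => i _; rewrite /h /X !op_derE.
rewrite (linearZf (opval_linear A _)) scalerA natrM mulrC.
have hi := ltn_ord i; have hk := ltn_ord k.
by congr (('C(_, _)%:R * _) *: op_val A _ _); lia.
Qed.

Lemma op_der0 A : op_der 0 A = A.
Proof. by apply: opP => v m; rewrite op_derE addn0 bin0 scale1r. Qed.

Lemma op_der1M A B : op_der 1 (A * B) = op_der 1 A * B + A * op_der 1 B.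
Proof. by rewrite op_derM big_ord_recl big_ord1 /= !op_der0. Qed.

Lemma op_der_comp i j A : op_der i (op_der j A) = 'C(i + j, j)%:R *: op_der (i + j) A.
Proof.
apply: opP => v m; rewrite opZE !op_derE !scalerA addnA; congr (_ *: _).
by rewrite -!natrM bin_trinomial mulnC.
Qed.

End OperatorSeries.

Arguments op_der : simpl never.
Arguments op_val : simpl never.

Section SeriesOfOperators.
Variables (F : numFieldType) (V : lmodType F) (T : comfam V).
Implicit Types A B C : opser T.

Definition ser A : V -> int -> V := fun v m => if m is Posz j then A v j else 0.

Lemma ser_neg A v m : m < 0 -> ser A v m = 0.
Proof. by case: m. Qed.

Lemma ser_linear A m : linear (fun v => ser A v m).
Proof. by case: m => j; [apply: opval_linear|apply: linear_zero]. Qed.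

Lemma ser_linear_op v m : linear (fun A => ser A v m).
Proof. by case: m => j //; apply: linear_zero. Qed.

Lemma ser_scomp A B : scomp (ser A) (ser B) = ser (A * B).
Proof.
apply/funext => v; apply/funext => m; rewrite /scomp; case: m => m.
  rewrite (@fsum_posz _ m.+1) => [|i hi|i hi]; first last.
  - by rewrite ser_neg //; lia.
  - by rewrite [ser B v i]ser_neg // (linear0 (ser_linear _ _)).
  rewrite /ser opME; apply: eq_bigr => j _.
  by have -> : m%:Z - j%:Z = (m - j)%N%:Z by have := ltn_ord j; lia.
rewrite fsbig1 // => i _; case: (ltP i 0) => hi.
  by rewrite [ser B v i]ser_neg // (linear0 (ser_linear _ _)).
by rewrite ser_neg //; lia.
Qed.

Lemma ser1 : ser 1 = @cst_series V.
Proof. by apply/funext => v; apply/funext => -[[|m]|m]. Qed.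

Lemma ser_spow A k : spow (ser A) k = ser (A ^+ k).
Proof.
elim: k => [|k IH]; first by rewrite /spow /= -ser1.
by rewrite exprS -ser_scomp -IH.
Qed.

End SeriesOfOperators.

(** * Exponentials of operator series *)

Record filtration (F : numFieldType) (V : lmodType F) (T : comfam V)
    (fil : int -> V -> Prop) : Prop := Filtration {
  fil_sub : forall d, subspace (fil d);
  fil_stable : forall d i v, fil d v -> fil d (T i v);
  fil_mono : forall d d' v, d <= d' -> fil d v -> fil d' v;
  fil_neg : forall d v, d < 0 -> fil d v -> v = 0;
  fil_exh : forall v, exists d, fil d v }.

Section Exponential.
Variables (F : numFieldType) (V : lmodType F) (T : comfam V).
Variables (fil : int -> V -> Prop) (hf : filtration T fil).
Implicit Types A B C : opser T.

(* The k-th power of an operator of degree 1 can lower the filtration by less *)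
(* than k only at the cost of powers of x, whence exponentials converge.      *)
Definition fil_deg (k : nat) A : Prop :=
  forall d v m, fil d v -> fil (d - k%:Z + m%:Z) (A v m).

Lemma fil_op A d v m : fil d v -> fil d (A v m).
Proof.
apply: (op_stable (op_valP A)); first exact: fil_sub hf d.
by move=> i w; apply: fil_stable hf _ _ _.
Qed.

Lemma fil_degM j k A B : fil_deg j A -> fil_deg k B -> fil_deg (j + k) (A * B).
Proof.
move=> hA hB d v m hv; rewrite opME; apply: subspace_sum; first exact: fil_sub hf _.
move=> i _; have := hA _ _ (m - i)%N (hB _ _ i hv).
by congr (fil _ _); have := ltn_ord i; lia.
Qed.

Lemma fil_degX A k : fil_deg 1 A -> fil_deg k (A ^+ k).
Proof.
move=> hA; elim: k => [|k IH]; last by rewrite exprS -add1n; apply: fil_degM.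
move=> d v m hv; rewrite expr0; apply: (fil_mono hf (d := d)); first lia.
exact: fil_op.
Qed.

Lemma fil_degX0 A k d v m : fil_deg 1 A -> fil d v -> d + m%:Z < k%:Z ->
  op_val (A ^+ k) v m = 0.
Proof.
move=> hA hv hk; apply: (fil_neg hf _ (fil_degX k hA m hv)); lia.
Qed.

Definition exp_trunc A (K : nat) : opser T :=
  \sum_(k < K) (k`!%:R^-1 : F) *: A ^+ k.

Lemma exp_truncE A K v m :
  op_val (exp_trunc A K) v m = \sum_(k < K) (k`!%:R^-1 : F) *: op_val (A ^+ k) v m.
Proof. by rewrite /exp_trunc op_sumE. Qed.

Definition exp_fun A (v : V) (m : nat) : V :=
  \sum_(k \in [set: nat]) (k`!%:R^-1 : F) *: op_val (A ^+ k) v m.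

(** On a vector of filtration degree d, the powers A^k with k > d + m have no coefficient at x^m.
    All identities for exponentials are reduced to polynomials in this way. *)
Lemma exp_funE A d v m K : fil_deg 1 A -> fil d v -> d + m%:Z < K%:Z ->
  exp_fun A v m = op_val (exp_trunc A K) v m.
Proof.
move=> hA hv hK; rewrite exp_truncE /exp_fun (@fsum_nat _ K) // => k hk.
by rewrite (fil_degX0 hA hv) ?scaler0 //; lia.
Qed.

Lemma fil_common (u v : V) : exists d, fil d u /\ fil d v.
Proof.
have [d1 h1] := fil_exh hf u; have [d2 h2] := fil_exh hf v.
exists (Num.max d1 d2); split.
  by apply: (fil_mono hf (d := d1)) => //; lia.
by apply: (fil_mono hf (d := d2)) => //; lia.
Qed.

(** On any given vectors a coefficient of the exponential agrees with that of a polynomial in A,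
    which belongs to the ring. For linearity and commutation a bound common to two vectors is
    taken. *)
Lemma exp_good A : fil_deg 1 A -> op_good T (exp_fun A).
Proof.
move=> hA; have K d m : d + m%:Z < (absz d + m).+1%:Z by lia.
split=> [m c u v|h hl hc v m|P hP hT v m hv].
- have [d [hu hv]] := fil_common u v.
  have huv : fil d (c *: u + v) by apply: (fil_sub hf d).2.
  by rewrite !(exp_funE hA _ (K d m)) // opval_linear.
- have [d [hu hv]] := fil_common v (h v).
  rewrite !(exp_funE hA _ (K d m)) //.
  exact: (op_bicomm (op_valP _)).
have [d hd] := fil_exh hf v.
by rewrite (exp_funE hA hd (K d m)); apply: (op_stable (op_valP _)).
Qed.

(** The value 0 is a default for series whose exponential is not in the ring; it does not occur when
    [fil_deg 1 A] holds. *)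
Definition op_exp A : opser T :=
  match pselect (op_good T (exp_fun A)) with
  | left h => mkop h
  | right _ => 0
  end.

Lemma op_exp_fun A : fil_deg 1 A -> op_val (op_exp A) = exp_fun A.
Proof. by move=> /exp_good hA; rewrite /op_exp; case: pselect. Qed.

Lemma op_expE A d v m K : fil_deg 1 A -> fil d v -> d + m%:Z < K%:Z ->
  op_exp A v m = op_val (exp_trunc A K) v m.
Proof. by move=> hA hv hK; rewrite op_exp_fun // (exp_funE hA hv hK). Qed.

Lemma ser_exp A : fil_deg 1 A -> sexp (ser A) = ser (op_exp A).
Proof.
move=> hA; apply/funext => v; apply/funext => m; rewrite /sexp.
case: m => m; first by rewrite /ser op_exp_fun //; under eq_fsbigr do rewrite ser_spow.
by rewrite fsbig1 // => k _; rewrite ser_spow scaler0.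
Qed.

Lemma op_exp0 : op_exp 0 = 1.
Proof.
have h0 : fil_deg 1 0 by move=> d v m _; apply: (fil_sub hf _).1.
apply: opP => v m; rewrite op_exp_fun // /exp_fun (@fsum1 _ _ 0%N).
  by rewrite fact0 invr1 scale1r expr0.
by move=> k hk; rewrite expr0n (negbTE hk) scaler0.
Qed.

Lemma fil_degD k A B : fil_deg k A -> fil_deg k B -> fil_deg k (A + B).
Proof.
move=> hA hB d v m hv; rewrite opDE.
by apply: subspaceD; [exact: fil_sub hf _|apply: hA|apply: hB].
Qed.

(** The usual double series, after truncation: the terms A^k B^l with k + l >= K do not contribute
    at x^m, so the square of indices may be replaced by a triangle, on which the binomial formula
    applies. *)
Lemma op_expD A B : fil_deg 1 A -> fil_deg 1 B ->
  op_exp (A + B) = op_exp A * op_exp B.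
Proof.
move=> hA hB; apply: opP => v m.
have [d hd] := fil_exh hf v.
pose K := (absz d + m).+1.
have hK : d + m%:Z < K%:Z by rewrite /K; lia.
rewrite (op_expE (fil_degD hA hB) hd hK) opME.
transitivity (op_val (exp_trunc A K * exp_trunc B K) v m); last first.
  rewrite opME; apply: eq_bigr => j _; have hj := ltn_ord j.
  rewrite (op_expE (K := K) hB hd); last by rewrite /K; lia.
  rewrite (op_expE (K := K) hA (fil_op (exp_trunc B K) j hd)) //.
  by rewrite /K; lia.
rewrite exp_truncE /exp_trunc mulr_suml op_sumE.
under [RHS]eq_bigr => k _ do rewrite mulr_sumr op_sumE.
pose g k l : V := (k`!%:R^-1 * l`!%:R^-1 : F) *: op_val (A ^+ k * B ^+ l) v m.
have [b1 b2] := @opmul_bilin F V T.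
transitivity (\sum_(k < K) \sum_(l < K) g k l); last first.
  apply: eq_bigr => k _; apply: eq_bigr => l _.
  by rewrite (linearZf (b1 _)) (linearZf (b2 _)) scalerA opZE.
rewrite sum_tri_square => [|k l hkl]; last first.
  have hAB := fil_degM (fil_degX k hA) (fil_degX l hB).
  rewrite /g (fil_neg hf _ (hAB _ _ m hd)) ?scaler0 //; lia.
apply: eq_bigr => q _; rewrite [A + B]addrC exprDn op_sumE scaler_sumr.
apply: eq_bigr => k _; rewrite -[(_ * _) *+ _]scaler_nat opZE scalerA /g [B ^+ _ * _]mulrC.
congr (_ *: _).
have /(congr1 (fun k => k%:R : F)) := bin_fact (leq_ord k).
rewrite !natrM => <-.
have : ('C(q, k))%:R != 0 :> F by rewrite pnatr_eq0 -lt0n bin_gt0 leq_ord.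
move: (factV_neq0 F k) (factV_neq0 F (q - k)) => h1 h2 h3.
field; exact/and3P.
Qed.

Lemma op_der1X A k : op_der 1 (A ^+ k.+1) = k.+1%:R *: (A ^+ k * op_der 1 A).
Proof.
elim: k => [|k IH]; first by rewrite expr1 expr0 mul1r scale1r.
rewrite exprS op_der1M IH.
have [b1 b2] := @opmul_bilin F V T.
rewrite (linearZf (b2 _)) mulrA -exprS [op_der 1 A * _]mulrC.
by rewrite -[X in X + _]scale1r -scalerDl -mulrS.
Qed.

Lemma op_der1_exp A : fil_deg 1 A -> op_der 1 (op_exp A) = op_exp A * op_der 1 A.
Proof.
move=> hA; apply: opP => v m.
have [d hd] := fil_exh hf v.
(* One more than in [op_expD], because the derivative at x^m reads the coefficient of x^(m+1). *)
pose K := (absz d + m).+2.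
transitivity (op_val (op_der 1 (exp_trunc A K.+1)) v m).
  by rewrite !op_derE (op_expE hA hd (K := K.+1)) // /K; lia.
transitivity (op_val (exp_trunc A K * op_der 1 A) v m); last first.
  rewrite !opME; apply: eq_bigr => j _; have hj := ltn_ord j.
  by rewrite (op_expE hA (fil_op _ _ hd) (K := K)) // /K; lia.
congr (op_val _ _ _); rewrite /exp_trunc (linear_sumf _ _ _ (op_der_linear 1)).
rewrite big_ord_recl /= expr0 mulr_suml.
rewrite [X in X + _](_ : _ = 0) ?add0r; last first.
  rewrite (linearZf (op_der_linear 1)).
  rewrite (_ : op_der 1 _ = 0) ?scaler0 //.
  by apply: opP => w j; rewrite op_derE op1E addn1 scaler0.
apply: eq_bigr => k _; rewrite (linearZf (op_der_linear 1)) op_der1X scalerA.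
rewrite (linearZf ((@opmul_bilin F V T).1 _)); congr (_ *: _).
rewrite /bump /= add1n factS natrM invfM -mulrA mulrCA mulVf ?mulr1 //.
by rewrite pnatr_eq0.
Qed.

End Exponential.

(* theta is Y(A(x1 - x2) u, x2) B(x1) v; an operator A "has coproduct" s when *)
(* A(x1) Y(u, x2) v is the sum of these over the pairs of s.                  *)
Section Coproducts.
Variables (F : numFieldType) (V : lmodType F) (T : comfam V).
Variables (Y : V -> V -> int -> V) (hY : forall m, bilin (fun u v => Y u v m)).
(** A lower truncation of Y that is uniform on stable subspaces containing u and v. Operator series
    preserve these subspaces, so the bound survives when they are applied. *)
Hypothesis hT : forall u v, exists (N : int) (P Q : V -> Prop),
  [/\ subspace P /\ (forall i w, P w -> P (T i w)),
      subspace Q /\ (forall i w, Q w -> Q (T i w)), P u, Q v &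
      forall u' v' c, P u' -> Q v' -> c < N -> Y u' v' c = 0].
Implicit Types A B C : opser T.

(** A(x1 - x2) is written by Taylor's formula as the sum of (-x2)^k times the k-th divided
    derivative of A at x1. *)
Definition theta A B (u v : V) (a : nat) (b : int) : V :=
  \sum_(k \in [set: nat]) ((-1) ^+ k : F) *:
    \sum_(i < a.+1) Y (op_der k A u i) (B v (a - i)%N) (b - k%:Z).

(** The truncation bound K depends only on the stable subspaces and on b, so it is the same for all
    A and B. *)
Lemma thetaE N (P Q : V -> Prop) u v :
  subspace P /\ (forall i w, P w -> P (T i w)) ->
  subspace Q /\ (forall i w, Q w -> Q (T i w)) -> P u -> Q v ->
  (forall u' v' c, P u' -> Q v' -> c < N -> Y u' v' c = 0) ->
  forall A B a b K, b - K%:Z < N ->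
  theta A B u v a b = \sum_(k < K) ((-1) ^+ k : F) *:
    \sum_(i < a.+1) Y (op_der k A u i) (B v (a - i)%N) (b - k%:Z).
Proof.
move=> [p1 p2] [q1 q2] hu hv h A B a b K hK; rewrite /theta (@fsum_nat _ K) //.
move=> k hk; rewrite big1 ?scaler0 // => i _; apply: h; last lia.
  exact: (op_stable (op_valP _)).
exact: (op_stable (op_valP _)).
Qed.

Lemma theta_bilin u v a b : bilin (fun A B => theta A B u v a b).
Proof.
have [N [P [Q [hP hQ hu hv h]]]] := hT u v.
pose K := (absz (b - N)).+1.
have hK : b - K%:Z < N by rewrite /K; lia.
split=> [B|A] c C C'; rewrite !(thetaE hP hQ hu hv h _ _ _ hK) scaler_sumr.
  rewrite -big_split; apply: eq_bigr => k _ /=.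
  rewrite !scaler_sumr -!big_split; apply: eq_bigr => i _ /=.
  rewrite op_der_linear opDE opZE (hY _).1 scalerDr !scalerA.
  by rewrite [_ * c]mulrC.
rewrite -big_split; apply: eq_bigr => k _ /=.
rewrite !scaler_sumr -!big_split; apply: eq_bigr => i _ /=.
rewrite opDE opZE (hY _).2 scalerDr !scalerA.
by rewrite [_ * c]mulrC.
Qed.

Definition coprod A (s : seq (opser T * opser T)) : Prop :=
  forall u v a b, A (Y u v b) a = \sum_(p <- s) theta p.1 p.2 u v a b.

(** The coproduct of A is applied to the vectors B^(k)u and Cv occurring in [theta B C]. Collecting
    the powers of -x2 by the Leibniz rule [op_derM] turns the pairs of Taylor expansions into the
    expansion of the product. *)
Lemma coprod_act A s B C u v a b : coprod A s ->
  \sum_(j < a.+1) A (theta B C u v j b) (a - j)%N =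
  \sum_(p <- s) theta (p.1 * B) (p.2 * C) u v a b.
Proof.
move=> hA; have [N [P [Q [hP hQ hu hv h]]]] := hT u v.
pose K := (absz (b - N)).+1.
have hK : b - K%:Z < N by rewrite /K; lia.
pose w (p : opser T * opser T) k l r : V :=
  Y (op_val (op_der l p.1 * op_der k B) u r) (op_val (p.2 * C) v (a - r)%N)
    (b - (k + l)%N%:Z).
pose G p k l : V := ((-1) ^+ (k + l) : F) *: \sum_(r < a.+1) w p k l r.
transitivity (\sum_(p <- s) \sum_(k < K) \sum_(l < K) G p k l); last first.
  apply: eq_bigr => p _; rewrite sum_tri_square; last first.
    move=> k l hkl; rewrite /G big1 ?scaler0 // => r _; apply: h; last lia.
      by apply: (op_stable (op_valP _)) => //; [exact: hP.1|exact: hP.2].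
    by apply: (op_stable (op_valP _)) => //; [exact: hQ.1|exact: hQ.2].
  rewrite (thetaE hP hQ hu hv h _ _ _ hK); apply: eq_bigr => q _.
  transitivity (((-1) ^+ q : F) *: \sum_(k < q.+1) \sum_(r < a.+1) w p k (q - k)%N r).
    rewrite scaler_sumr; apply: eq_bigr => k _.
    by rewrite /G subnKC ?leq_ord.
  congr (_ *: _); rewrite exchange_big; apply: eq_bigr => r _ /=.
  rewrite op_derM op_sumE (linear_sumf _ _ _ ((hY _).1 _)).
  by apply: eq_bigr => k _; rewrite /w subnKC ?leq_ord.
pose g (p : opser T * opser T) k l i p' c d : V := Y (op_val (op_der l p.1) (op_der k B u i) p')
    (op_val p.2 (C v c) d) (b - (k + l)%N%:Z).
transitivity (\sum_(p <- s) \sum_(k < K) \sum_(l < K) ((-1) ^+ (k + l) : F) *: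
  \sum_(j < a.+1) \sum_(i < j.+1) \sum_(p' < (a - j).+1)
     g p k l i p' (j - i)%N (a - j - p')%N); last first.
  apply: eq_bigr => p _; apply: eq_bigr => k _; apply: eq_bigr => l _.
  rewrite /G sum_conv4; congr (_ *: _); apply: eq_bigr => r _.
  rewrite /w opME (linear_sumf _ _ _ ((hY _).1 _)); apply: eq_bigr => i _.
  by rewrite opME (linear_sumf _ _ _ ((hY _).2 _)).
transitivity (\sum_(j < a.+1) \sum_(p <- s) \sum_(k < K) \sum_(l < K)
  ((-1) ^+ (k + l) : F) *: \sum_(i < j.+1) \sum_(p' < (a - j).+1)
     g p k l i p' (j - i)%N (a - j - p')%N); last first.
  rewrite exchange_big; apply: eq_bigr => p _ /=.
  rewrite exchange_big; apply: eq_bigr => k _ /=.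
  rewrite exchange_big; apply: eq_bigr => l _ /=.
  by rewrite scaler_sumr.
apply: eq_bigr => j _.
rewrite (thetaE hP hQ hu hv h _ _ _ hK) (linear_sumf _ _ _ (opval_linear A _)).
rewrite [RHS]exchange_big; apply: eq_bigr => k _ /=.
rewrite (linearZf (opval_linear A _)) (linear_sumf _ _ _ (opval_linear A _)).
transitivity (((-1) ^+ k : F) *: \sum_(i < j.+1) \sum_(p <- s) \sum_(l < K)
  ((-1) ^+ l : F) *: \sum_(p' < (a - j).+1) g p k l i p' (j - i)%N (a - j - p')%N).
  congr (_ *: _); apply: eq_bigr => i _; rewrite hA; apply: eq_bigr => p _.
  have hu' : P (op_der k B u i).
    by apply: (op_stable (op_valP _)) => //; [exact: hP.1|exact: hP.2].
  have hv' : Q (C v (j - i)%N).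
    by apply: (op_stable (op_valP _)) => //; [exact: hQ.1|exact: hQ.2].
  have hK' : b - k%:Z - K%:Z < N by lia.
  rewrite (thetaE hP hQ hu' hv' h _ _ _ hK').
  apply: eq_bigr => l _; congr (_ *: _); apply: eq_bigr => p' _.
  by rewrite /g; congr (Y _ _ _); lia.
rewrite exchange_big scaler_sumr; apply: eq_bigr => p _ /=.
rewrite exchange_big scaler_sumr; apply: eq_bigr => l _ /=.
by rewrite -scaler_sumr scalerA exprD.
Qed.

Lemma coprodM A B s t : coprod A s -> coprod B t ->
  coprod (A * B) [seq (p.1 * q.1, p.2 * q.2) | p <- s, q <- t].
Proof.
move=> hA hB u v a b; rewrite opME.
rewrite big_allpairs_dep /= exchange_big /=.
under eq_bigr => j _ do rewrite hB (linear_sumf _ _ _ (opval_linear A _)).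
by rewrite exchange_big; apply: eq_bigr => q _; rewrite (coprod_act _ _ _ _ _ _ hA).
Qed.

Lemma theta11 u v a b : theta 1 1 u v a b = if a is 0 then Y u v b else 0.
Proof.
rewrite /theta (@fsum1 _ _ 0%N) => [|[|k] // _]; last first.
  rewrite big1 ?scaler0 // => i _.
  by rewrite op_derE op1E addnS scaler0 (linear0 ((hY _).1 _)).
rewrite expr0 scale1r subr0 op_der0; case: a => [|a]; first by rewrite big_ord1.
rewrite big1 // => i _; case: i => [[|i] hi] /=.
  by rewrite (linear0 ((hY _).2 _)).
by rewrite (linear0 ((hY _).1 _)).
Qed.

Section CoprodExp.
Variables (fil : int -> V -> Prop) (hf : filtration T fil).

(** For primitive A the coproduct of A^k is (A (x) 1 + 1 (x) A)^k, expanded by the binomial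
    formula. *)
Lemma coprod_primX A k u v a b : coprod A [:: (A, 1); (1, A)] ->
  op_val (A ^+ k) (Y u v b) a =
  \sum_(i < k.+1) 'C(k, i)%:R *: theta (A ^+ i) (A ^+ (k - i)) u v a b.
Proof.
move=> hA; elim: k a b => [|k IH] a b.
  by rewrite big_ord1 bin0 scale1r !expr0 theta11 op1E.
rewrite (@sum_shift_bin _ _ _ (fun i => theta (A ^+ i) (A ^+ (k.+1 - i)) u v a b)).
rewrite exprS opME.
under eq_bigr => j _ do rewrite IH (linear_sumf _ _ _ (opval_linear A _)).
rewrite exchange_big -big_split; apply: eq_bigr => i _ /=.
under eq_bigr => j _ do rewrite (linearZf (opval_linear A _)).
rewrite -scaler_sumr (coprod_act _ _ _ _ _ _ hA) big_cons big_seq1 /= !mul1r.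
by rewrite scalerDr addrC -!exprS subSS subSn ?leq_ord.
Qed.

(** The exponential of a primitive element is grouplike: the binomial expansions of the powers of A
    recombine into a product of two exponential series. *)
Lemma coprod_exp A : fil_deg fil 1 A -> coprod A [:: (A, 1); (1, A)] ->
  coprod (op_exp A) [:: (op_exp A, op_exp A)].
Proof.
move=> hn hA u v a b; rewrite big_seq1 /=.
have [N [P [Q [hP hQ hu hv h]]]] := hT u v.
pose K := (absz (b - N)).+1.
have hK : b - K%:Z < N by rewrite /K; lia.
have [d [hdu hdv]] := fil_common hf u v.
have [d' hd'] := fil_exh hf (Y u v b).
(* From [M0] on, powers of A vanish on u and v at every exponent below a + K, which covers the
   derivatives occurring in [theta]. Since [M] exceeds twice [M0], k + l >= M forces k or l to reach
   [M0]; [M] also exceeds the bound needed for Y(u, x2)v. *)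
pose M0 := (absz d + a + K).+1.
pose M := (M0 + M0 + absz d' + a).+1.
have hM : d' + a%:Z < M%:Z by rewrite /M; lia.
rewrite (op_expE hf hn hd' hM) exp_truncE.
transitivity (theta (exp_trunc A M) (exp_trunc A M) u v a b); last first.
  rewrite !(thetaE hP hQ hu hv h _ _ _ hK); apply: eq_bigr => k _.
  congr (_ *: _); apply: eq_bigr => i _.
  have hi := ltn_ord i; have hk := ltn_ord k.
  rewrite !op_derE !(op_expE hf hn _ (K := M) (d := d)) //.
    by rewrite /M /M0; lia.
  by rewrite /M /M0; lia.
have hb := theta_bilin u v a b.
rewrite /exp_trunc (linear_sumf _ _ _ (hb.1 _)).
under [RHS]eq_bigr => k _ do rewrite (linear_sumf _ _ _ (hb.2 _)).
pose g k l : V := (k`!%:R^-1 * l`!%:R^-1 : F) *: theta (A ^+ k) (A ^+ l) u v a b.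
transitivity (\sum_(k < M) \sum_(l < M) g k l); last first.
  apply: eq_bigr => k _; apply: eq_bigr => l _.
  by rewrite (linearZf (hb.1 _)) (linearZf (hb.2 _)) scalerA.
rewrite sum_tri_square => [|k l hkl]; last first.
  rewrite /g (thetaE hP hQ hu hv h _ _ _ hK) big1 ?scaler0 // => q _.
  rewrite big1 ?scaler0 // => i _; have hi := ltn_ord i; have hq := ltn_ord q.
  case: (leqP M0 k) => hk.
    rewrite op_derE (fil_degX0 hf hn hdu) ?scaler0 ?(linear0 ((hY _).1 _)) //.
    by move: hk; rewrite /M0; lia.
  rewrite (fil_degX0 hf (A := A) (k := l) hn hdv) ?(linear0 ((hY _).2 _)) //.
  by move: hk hkl; rewrite /M /M0; lia.
apply: eq_bigr => k _; rewrite (coprod_primX _ _ _ _ _ hA) scaler_sumr.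
apply: eq_bigr => i _; rewrite scalerA; congr (_ *: _).
have /(congr1 (fun k => k%:R : F)) := bin_fact (leq_ord i).
rewrite !natrM => <-.
have : ('C(k, i))%:R != 0 :> F by rewrite pnatr_eq0 -lt0n bin_gt0 leq_ord.
move: (factV_neq0 F i) (factV_neq0 F (k - i)) => h1 h2 h3.
field; exact/and3P.
Qed.

End CoprodExp.
End Coproducts.

(** * Annihilation operators on the Fock space *)

(* fann (j, k) is the partial derivative with respect to b_j(-k-1), and       *)
(* fmode G (i, k) is the mode b_i(k) with k >= 0.                             *)
HB.lock Definition fann (F : numFieldType) (n : nat) (x : 'I_n * nat) :
    fock F n -> fock F n :=
  linext (fun M b => (M x)%:R *: fbas F (divcm M (ucm x)) b).
HB.lock Definition fcharge (F : numFieldType) (n : nat) (G : 'M[int]_n)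
    (i : 'I_n) : fock F n -> fock F n :=
  linext (fun M b => hform G (delta_mx 0 i) (hvec F b) *: fbas F M b).
HB.lock Definition fmode (F : numFieldType) (n : nat) (G : 'M[int]_n)
    (x : 'I_n * nat) : fock F n -> fock F n :=
  mode G (delta_mx 0 x.1) x.2%:Z.

Section Modes.
Variables (F : numFieldType) (n : nat) (G : 'M[int]_n).
Local Notation fk := (fock F n).
Local Notation idx := ('I_n * nat)%type.
Implicit Types (M N : smonom n) (b : 'rV[int]_n) (x y : idx) (i j : 'I_n).

Lemma fann_linear x : linear (@fann F n x).
Proof. by rewrite fann.unlock; exact: linext_linear. Qed.

Lemma fannE x M b : fann x (fbas F M b) = (M x)%:R *: fbas F (divcm M (ucm x)) b.
Proof. by rewrite fann.unlock linextE. Qed.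

Lemma fcharge_linear i : linear (@fcharge F n G i).
Proof. by rewrite fcharge.unlock; exact: linext_linear. Qed.

Lemma fchargeE i M b :
  fcharge G i (fbas F M b) = hform G (delta_mx 0 i) (hvec F b) *: fbas F M b.
Proof. by rewrite fcharge.unlock linextE. Qed.

Lemma fannC x y (v : fk) : fann x (fann y v) = fann y (fann x v).
Proof.
have hl := fann_linear.
move: v; apply: fock_linear_ext => [||M b].
- exact: (linear_comp (hl y) (hl x)).
- exact: (linear_comp (hl x) (hl y)).
have e z t : fann z (fann t (fbas F M b)) =
    (M t * divcm M (ucm t) z)%:R *: fbas F (divcm (divcm M (ucm t)) (ucm z)) b.
  by rewrite fannE (linearZf (hl z)) fannE scalerA natrM.
rewrite (e x y) (e y x) (divcmC M (ucm y) (ucm x)).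
suff -> : (M y * divcm M (ucm y) x = M x * divcm M (ucm x) y)%N by [].
rewrite !divcmE !ucmE [y == x]eq_sym.
by case: (eqVneq x y) => [->|_] //; rewrite !subn0 mulnC.
Qed.

Lemma fcharge_annC i x (v : fk) : fcharge G i (fann x v) = fann x (fcharge G i v).
Proof.
have hl := fann_linear; have hc := fcharge_linear.
move: v; apply: fock_linear_ext => [||M b].
- exact: (linear_comp (hl x) (hc i)).
- exact: (linear_comp (hc i) (hl x)).
rewrite fannE fchargeE (linearZf (hl _)) (linearZf (hc _)) fannE fchargeE !scalerA.
by rewrite mulrC.
Qed.

Lemma fchargeC i j (v : fk) :
  fcharge G i (fcharge G j v) = fcharge G j (fcharge G i v).
Proof.
have hc := fcharge_linear.
move: v; apply: fock_linear_ext => [||M b].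
- exact: (linear_comp (hc j) (hc i)).
- exact: (linear_comp (hc i) (hc j)).
by rewrite !fchargeE !(linearZf (hc _)) !fchargeE !scalerA mulrC.
Qed.

Lemma fmode0 i : fmode G (i, 0%N) = @fcharge F n G i.
Proof. by rewrite fmode.unlock fcharge.unlock fbas.unlock. Qed.

Lemma fmode_linear x : linear (@fmode F n G x).
Proof.
by rewrite fmode.unlock; case: x => i [|k]; exact: linext_linear.
Qed.

Lemma fmodeS i k (v : fk) : fmode G (i, k.+1) v =
  \sum_j (k.+1%:R * hform G (delta_mx 0 i) (delta_mx 0 j)) *: fann (j, k) v.
Proof.
move: v; apply: fock_linear_ext => [||M b]; first exact: fmode_linear.
  by apply: linear_sum_fun => j; apply: linear_scale; exact: fann_linear.
rewrite fmode.unlock /mode /= linextE; apply: eq_bigr => j _.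
by rewrite fannE scalerA fbasE.
Qed.

Lemma fmodeC x y (v : fk) : fmode G x (fmode G y v) = fmode G y (fmode G x v).
Proof.
(* A mode is either a charge operator, diagonal on the basis, or a linear combination of partial
   derivatives; operators of these two kinds all commute. *)
have key z : (exists i, forall w : fk, fmode G z w = fcharge G i w) \/
    (exists (c : 'I_n -> F) k, forall w : fk,
       fmode G z w = \sum_j c j *: fann (j, k) w).
  case: z => i [|k]; first by left; exists i => w; rewrite fmode0.
  right; exists (fun j => k.+1%:R * hform G (delta_mx 0 i) (delta_mx 0 j)), k.
  by move=> w; exact: fmodeS.
have hl := fann_linear; have hc := fcharge_linear.
have aux i (c : 'I_n -> F) k (w : fk) :
    fcharge G i (\sum_j c j *: fann (j, k) w) =
    \sum_j c j *: fann (j, k) (fcharge G i w).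
  rewrite (linear_sumf _ _ _ (hc i)); apply: eq_bigr => j _.
  by rewrite (linearZf (hc i)) fcharge_annC.
case: (key x) => [[i hx]|[c [k hx]]]; case: (key y) => [[j hy]|[d [l hy]]];
  rewrite !hx !hy.
- exact: fchargeC.
- by rewrite aux.
- by rewrite aux.
transitivity (\sum_j \sum_j' (c j * d j') *: fann (j, k) (fann (j', l) v)).
  apply: eq_bigr => j _; rewrite (linear_sumf _ _ _ (hl (j, k))) scaler_sumr.
  by apply: eq_bigr => j' _; rewrite (linearZf (hl (j, k))) scalerA.
rewrite exchange_big; apply: eq_bigr => j' _ /=.
rewrite (linear_sumf _ _ _ (hl (j', l))) scaler_sumr; apply: eq_bigr => j _.
by rewrite (linearZf (hl (j', l))) scalerA (mulrC (d j')) (fannC (j', l)).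
Qed.

Definition modes : comfam fk := @Comfam F fk idx (@fmode F n G) fmode_linear fmodeC.

(** The linear span of the selected basis vectors, defined as the intersection of the subspaces
    containing them, so that span induction is its elimination rule. *)
Definition spanP (B : smonom n -> 'rV[int]_n -> Prop) (w : fk) : Prop :=
  forall Q : fk -> Prop, subspace Q -> (forall M b, B M b -> Q (fbas F M b)) -> Q w.

Lemma spanP_sub B : subspace (spanP B).
Proof.
split=> [Q hQ _|c u v hu hv Q hQ hB]; first exact: hQ.1.
by apply: hQ.2; [apply: hu|apply: hv].
Qed.

Lemma spanP_bas (B : smonom n -> 'rV[int]_n -> Prop) M b : B M b -> spanP B (fbas F M b).
Proof. by move=> h Q _ hB; apply: hB. Qed.

Lemma spanP_map B (P : fk -> Prop) (h : fk -> fk) : linear h -> subspace P ->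
  (forall M b, B M b -> P (h (fbas F M b))) -> forall w, spanP B w -> P (h w).
Proof.
move=> hl hP hB w hw; apply: (hw (fun w => P (h w))) => //.
split=> [|c u v hu hv]; first by rewrite (linear0 hl); exact: hP.1.
by rewrite hl; apply: hP.2.
Qed.

Lemma fock_spanP (P : fk -> Prop) : subspace P -> (forall M b, P (fbas F M b)) ->
  forall w, P w.
Proof.
move=> hP hB w; rewrite (fock_sum w); apply: subspace_sum => // p _.
by apply: (subspaceZ _ hP); exact: hB.
Qed.

Lemma fmode_sub (P : fk -> Prop) M b : subspace P -> P (fbas F M b) ->
  (forall x, (0 < M x)%N -> P (fbas F (divcm M (ucm x)) b)) ->
  forall x, P (fmode G x (fbas F M b)).
Proof.
move=> hP h0 h1 [i [|k]].
  by rewrite fmode0 fchargeE; apply: (subspaceZ _ hP); exact: h0.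
rewrite fmodeS; apply: subspace_sum => // j _; apply: subspaceZ => //.
rewrite fannE; case: (posnP (M (j, k))) => [->|hx]; last first.
  by apply: (subspaceZ _ hP); exact: h1.
by rewrite scale0r; exact: hP.1.
Qed.

(** The divisors of M: finitely many monomials, closed under division by a variable. *)
Lemma divisors_cmonom M : exists s : seq (smonom n), M \in s /\
  forall N x, N \in s -> (0 < N x)%N -> divcm N (ucm x) \in s.
Proof.
move: M; apply: cmonom_ind => [|x M [s [hM hs]]].
  exists [:: onecm _]; split=> [|N x]; first exact: mem_head.
  by rewrite inE => /eqP ->; rewrite onecmE.
exists (s ++ [seq mulcm (ucm x) N | N <- s]); split.
  by rewrite mem_cat map_f ?orbT.
move=> N y; rewrite !mem_cat => /orP[hN hy|/mapP[N' hN' ->] hy].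
  by rewrite hs.
case: (eqVneq x y) => [<-|hxy]; first by rewrite mulcm_div hN'.
apply/orP; right; apply/mapP; exists (divcm N' (ucm y)).
  by apply: hs => //; move: hy; rewrite mulcmE ucmE (negbTE hxy).
by rewrite divcm_mulr //; move: hy; rewrite mulcmE ucmE (negbTE hxy).
Qed.

(** The nonnegative modes act locally finitely: on a basis vector they only rescale it or divide its
    monomial by variables, so finitely many divisors span a stable subspace. *)
Lemma stable_span (v : fk) : exists s : seq (smonom n * 'rV[int]_n),
  let P := spanP (fun M b => (M, b) \in s) in
  [/\ P v, subspace P & forall x w, P w -> P (fmode G x w)].
Proof.
have stab (s : seq (smonom n * 'rV[int]_n)) :
    (forall M b x, (M, b) \in s -> (0 < M x)%N -> (divcm M (ucm x), b) \in s) ->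
    forall x w, spanP (fun M b => (M, b) \in s) w ->
      spanP (fun M b => (M, b) \in s) (fmode G x w).
  move=> hs x; apply: spanP_map; [exact: fmode_linear|exact: spanP_sub|].
  move=> M b hM; apply: fmode_sub; [exact: spanP_sub|exact: spanP_bas|].
  by move=> y hy; apply: spanP_bas; apply: hs.
suff [s [h1 h2]] : exists s : seq (smonom n * 'rV[int]_n),
    spanP (fun M b => (M, b) \in s) v /\
    forall M b x, (M, b) \in s -> (0 < M x)%N -> (divcm M (ucm x), b) \in s.
  by exists s; split=> //; [exact: spanP_sub|exact: stab].
have mono (s t : seq (smonom n * 'rV[int]_n)) (w : fk) : {subset s <= t} ->
    spanP (fun M b => (M, b) \in s) w -> spanP (fun M b => (M, b) \in t) w.
  by move=> hst hw Q hQ hB; apply: hw => // M b /hst; apply: hB.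
move: v; apply: fock_spanP => [|M b].
  split=> [|c u v [s [hu hs]] [t [hv ht]]]; first by exists [::]; split=> // Q [].
  exists (s ++ t); split.
    apply: (spanP_sub _).2; [apply: mono hu|apply: mono hv] => p hp.
      by rewrite mem_cat hp.
    by rewrite mem_cat hp orbT.
  move=> M b x; rewrite !mem_cat => /orP[h|h] hx; first by rewrite (hs _ _ x h hx).
  by rewrite (ht _ _ x h hx) orbT.
have [s [hM hs]] := divisors_cmonom M.
exists [seq (N, b) | N <- s]; split.
  by apply: spanP_bas; apply/mapP; exists M.
move=> N c x /mapP[N' hN' [-> ->]] hx; apply/mapP.
by exists (divcm N' (ucm x)) => //; apply: hs.
Qed.

Lemma spanP_coef (s : seq (smonom n * 'rV[int]_n)) (w : fk) :
  spanP (fun M b => (M, b) \in s) w ->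
  exists c : smonom n * 'rV[int]_n -> F,
    w = \sum_(p <- undup s) c p *: fbas F p.1 p.2.
Proof.
move=> hw; apply: (hw (fun w => exists c : smonom n * 'rV[int]_n -> F,
  w = \sum_(p <- undup s) c p *: fbas F p.1 p.2)); first split.
- by exists (fun=> 0); rewrite big1 // => p _; rewrite scale0r.
- move=> a u v [c ->] [d ->]; exists (fun p => a * c p + d p).
  rewrite scaler_sumr -big_split; apply: eq_bigr => p _ /=.
  by rewrite scalerDl scalerA.
move=> M b hM; exists (fun p => (p == (M, b))%:R).
rewrite (bigD1_seq (M, b)) ?undup_uniq ?mem_undup //= eqxx scale1r.
by rewrite big1 ?addr0 // => p /negbTE ->; rewrite scale0r.
Qed.

(** Filtration by the number of variables of a monomial, irrespective of the weights of the
    b_i(-m-1). The modes b_i(k) with k >= 1 lower it by 1, the charges b_i(0) preserve it. *)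
Definition degfil (d : int) : fk -> Prop := spanP (fun M _ => (mdeg M)%:Z <= d).

Lemma degfil_bas d M b : (mdeg M)%:Z <= d -> degfil d (fbas F M b).
Proof. by move=> h Q _ hB; apply: hB. Qed.

Lemma degfil_sub d : subspace (degfil d).
Proof. exact: spanP_sub. Qed.

Lemma degfilZ d c w : degfil d w -> degfil d (c *: w).
Proof. exact: subspaceZ (degfil_sub d). Qed.

Lemma degfil_sum d (I : Type) (r : seq I) (g : I -> fk) :
  (forall i : I, degfil d (g i)) -> degfil d (\sum_(i <- r) g i).
Proof. by move=> h; apply: (@subspace_sum _ _ (degfil d)); first exact: degfil_sub. Qed.

Lemma degfil_mono d d' w : d <= d' -> degfil d w -> degfil d' w.
Proof.
by move=> hd hw Q hQ hB; apply: hw => // M b hM; apply: hB; apply: le_trans hd.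
Qed.

Lemma degfil_ann d x w : degfil d w -> degfil (d - 1) (fann x w).
Proof.
apply: spanP_map; [exact: fann_linear|exact: spanP_sub|].
move=> M b hM; rewrite fannE; case: (posnP (M x)) => [->|hx].
  by rewrite scale0r; exact: (spanP_sub _).1.
apply: degfilZ.
by apply: degfil_bas; rewrite lerBrDr -PoszD addn1 -(mdeg_divcm hx).
Qed.

Lemma degfil_modeS d i k w : degfil d w -> degfil (d - 1) (fmode G (i, k.+1) w).
Proof.
move=> hw; rewrite fmodeS; apply: degfil_sum => j; apply: degfilZ.
exact: degfil_ann.
Qed.

Lemma degfil_mode d x w : degfil d w -> degfil d (fmode G x w).
Proof.
case: x => i [|k] hw; last by apply: degfil_mono (degfil_modeS i k hw); lia.
rewrite fmode0; move: w hw; apply: spanP_map; first exact: fcharge_linear.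
  exact: spanP_sub.
move=> M b hM; rewrite fchargeE; apply: degfilZ.
exact: degfil_bas.
Qed.

Lemma degfilP : filtration modes degfil.
Proof.
split=> [d|d x w|d d' w|d w hd|w].
- exact: spanP_sub.
- exact: degfil_mode.
- exact: degfil_mono.
- move=> hw; apply: (hw (fun w => w = 0)).
    by split=> // c u v -> ->; rewrite scaler0 addr0.
  by move=> M b hM; exfalso; move: hM; lia.
move: w; apply: fock_spanP => [|M b]; last first.
  by exists (mdeg M)%:Z; apply: degfil_bas.
split=> [|c u v [d hu] [d' hv]]; first by exists 0; exact: (spanP_sub _).1.
exists (Num.max d d'); apply: (spanP_sub _).2.
  by apply: degfil_mono hu; lia.
by apply: degfil_mono hv; lia.
Qed.

Lemma fmode_fin (v : fk) : exists K : nat, forall x, (K <= x.2)%N -> fmode G x v = 0.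
Proof.
move: v; apply: fock_spanP => [|M b].
  split=> [|c u v [K hu] [L hv]].
    by exists 0%N => x _; rewrite (linear0 (fmode_linear x)).
  exists (maxn K L) => x; rewrite geq_max => /andP[h1 h2].
  by rewrite fmode_linear hu // hv // scaler0 addr0.
have [K hK] : exists K : nat, forall j k, (K <= k)%N -> M (j, k) = 0%N.
  move: M; apply: cmonom_ind => [|[j k] M [K hK]].
    by exists 0%N => j k _; rewrite onecmE.
  exists (maxn K k.+1) => j' k'; rewrite geq_max => /andP[h1 h2].
  rewrite mulcmE ucmE hK // addn0 xpair_eqE.
  by rewrite (ltn_eqF h2) andbF.
exists K.+1 => -[i [//|k]] /= hk; rewrite fmodeS big1 // => j _.
by rewrite fannE hK // scale0r scaler0.
Qed.

Lemma fmode_vac x : fmode G x (fe F 0) = 0 :> fk.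
Proof.
case: x => i [|k]; last first.
  by rewrite fmodeS big1 // => j _; rewrite fannE onecmE scale0r scaler0.
rewrite fmode0 fchargeE /hform /hvec.
have -> : map_mx intr (0 : 'rV[int]_n) = 0 :> 'rV[F]_n.
  by apply/matrixP => i' j'; rewrite !mxE.
by rewrite trmx0 mulmx0 mxE scale0r.
Qed.

Lemma iter_sderiv (g : int -> F) (k m : nat) :
  iter k (@sderiv F) g m%:Z = (k`! * 'C(m + k, k))%:R * g (m + k)%N%:Z.
Proof.
elim: k m => [|k IH] m; first by rewrite addn0 bin0 mul1r.
rewrite iterS {1}/sderiv.
have -> : m%:Z + 1 = m.+1%:Z by lia.
rewrite IH mulrA addSnnS; congr (_ * _); rewrite -[m.+1%:~R]/(m.+1%:R) -natrM.
congr _%:R.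
have h := mul_bin_diag (m + k.+1) k.
have h1 : ((m + k.+1 - k) * 'C(m + k.+1, k) = k.+1 * 'C(m + k.+1, k.+1))%N.
  by rewrite mul_bin_left.
rewrite factS mulnCA; rewrite [(k.+1 * _)%N]mulnC -mulnA -h1.
by congr (_ * (_ * _))%N; lia.
Qed.

(** No negative power arises from differentiation: the factor m + 1 vanishes at m = -1. *)
Lemma iter_sderiv_neg (g : int -> F) (k : nat) m :
  (forall m, m <= 0 -> g m = 0) -> m < 0 -> iter k (@sderiv F) g m = 0.
Proof.
move=> hg; elim: k m => [|k IH] m hm; first by apply: hg; lia.
rewrite iterS {1}/sderiv; case: (eqVneq (m + 1) 0) => [->|h].
  by rewrite mul0r.
by rewrite IH ?mulr0 //; lia.
Qed.

Lemma Phi_coef (g : int -> F) (k m : nat) :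
  (-1) ^+ k / k`!%:R * iter k (@sderiv F) g m%:Z =
  (-1) ^+ k * 'C(m + k, k)%:R * g (m + k)%N%:Z.
Proof.
have h := factV_neq0 F k.
by rewrite iter_sderiv natrM !mulrA divfK.
Qed.

Lemma PhiE (g : int -> 'rV[F]_n) v (m K : nat) :
  (forall x, (K <= x.2)%N -> fmode G x v = 0) ->
  Phi G g v m%:Z = \sum_i \sum_(k < K)
    ((-1) ^+ k * 'C(m + k, k)%:R * g (m + k)%N%:Z 0 i) *: fmode G (i, k : nat) v.
Proof.
move=> hK; rewrite /Phi; apply: eq_bigr => i _; rewrite /Phi1.
have E k : mode G (delta_mx 0 i) k%:Z v = fmode G (i, k) v by rewrite fmode.unlock.
rewrite (@fsum_nat _ K) => [|k hk]; last by rewrite E hK ?scaler0.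
by apply: eq_bigr => k _; rewrite E Phi_coef.
Qed.

(** On each vector a coefficient of Phi(g) is a finite linear combination of modes, since high modes
    annihilate the vector. A map commuting with the modes preserves that annihilation, so the same
    bound serves for v and h v. *)
Lemma Phi_good (g : int -> 'rV[F]_n) : op_good modes (fun v m => Phi G g v m%:Z).
Proof.
split=> [m c u v|h hl hc v m|P hP hT v m hv].
- have [K1 h1] := fmode_fin u; have [K2 h2] := fmode_fin v.
  pose K := maxn K1 K2.
  have hu x : (K <= x.2)%N -> fmode G x u = 0.
    by rewrite geq_max => /andP[h _]; apply: h1.
  have hv x : (K <= x.2)%N -> fmode G x v = 0.
    by rewrite geq_max => /andP[_ h]; apply: h2.
  rewrite !(@PhiE g _ m K) //; last first.
    by move=> x hx; rewrite fmode_linear hu // hv // scaler0 addr0.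
  rewrite scaler_sumr -big_split; apply: eq_bigr => i _ /=.
  rewrite scaler_sumr -big_split; apply: eq_bigr => k _ /=.
  by rewrite fmode_linear scalerDr !scalerA [_ * c]mulrC.
- have [K hK] := fmode_fin v.
  have hK' x : (K <= x.2)%N -> fmode G x (h v) = 0.
    by move=> hx; rewrite -[fmode G x (h v)](hc x) /= hK // (linear0 hl).
  rewrite !(@PhiE g _ m K) // (linear_sumf _ _ _ hl); apply: eq_bigr => i _.
  rewrite (linear_sumf _ _ _ hl); apply: eq_bigr => k _.
  by rewrite (linearZf hl) -[fmode G _ (h v)](hc (i, k : nat)).
have [K hK] := fmode_fin v; rewrite (@PhiE g _ m K) //.
apply: subspace_sum => // i _; apply: subspace_sum => // k _.
by apply: subspaceZ => //; exact: (hT (i, k : nat)).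
Qed.

Definition phiop (g : int -> 'rV[F]_n) : opser modes := mkop (Phi_good g).

Lemma phiopE g v (m K : nat) : (forall x, (K <= x.2)%N -> fmode G x v = 0) ->
  phiop g v m = \sum_i \sum_(k < K)
    ((-1) ^+ k * 'C(m + k, k)%:R * g (m + k)%N%:Z 0 i) *: fmode G (i, k : nat) v.
Proof. exact: PhiE. Qed.

Lemma ser_phiop g : (forall m, m <= 0 -> g m = 0) -> ser (phiop g) = Phi G g.
Proof.
move=> hg; apply/funext => v; apply/funext => -[m|m] //.
rewrite /Phi big1 // => i _; rewrite /Phi1 fsbig1 // => k _.
rewrite iter_sderiv_neg ?mulr0 ?scale0r // => m' hm'.
by rewrite hg // mxE.
Qed.

(** The modes with k >= 1 lower the degree by 1. The charge terms preserve it, but come with g(x),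
    which has no constant term and so supplies a power of x. *)
Lemma phiop_fil g : g 0 = 0 -> fil_deg degfil 1 (phiop g).
Proof.
move=> hg d v m hv; have [K hK] := fmode_fin v; rewrite (@phiopE g v m K) //.
apply: degfil_sum => i; apply: degfil_sum => -[[|k] hk] /=; last first.
  apply: degfilZ.
  by apply: degfil_mono (degfil_modeS i k hv); lia.
case: m => [|m].
  by rewrite hg mxE mulr0 scale0r; exact: (spanP_sub _).1.
apply: degfilZ.
by apply: degfil_mono (degfil_mode (i, 0%N) hv); lia.
Qed.

Lemma phiop_vac g m : phiop g (fe F 0) m = 0.
Proof.
by rewrite (@phiopE g _ m 0%N) ?big1 // => [i _|x _]; rewrite ?big_ord0 ?fmode_vac.
Qed.

Lemma phiop_linear c g h :
  phiop (fun m => c *: g m + h m) = c *: phiop g + phiop h.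
Proof.
apply: opP => v m; have [K hK] := fmode_fin v.
rewrite opDE opZE !(phiopE _ _ hK) scaler_sumr -big_split.
apply: eq_bigr => i _ /=; rewrite scaler_sumr -big_split.
apply: eq_bigr => k _ /=; move: (fmode _ _ v) => w.
by rewrite !mxE scalerA -scalerDl; congr (_ *: w); ring.
Qed.

(** All coefficients of A(x)v stay in one finitely spanned stable subspace, so A(x)v is a finite
    combination of fixed vectors with scalar series as coefficients. *)
Lemma op_laurent (A : opser modes) v : tens_laurent (ser A v).
Proof.
have [s [hv hP hs]] := stable_span v.
have hA m : exists c : smonom n * 'rV[int]_n -> F,
    A v m = \sum_(p <- undup s) c p *: fbas F p.1 p.2.
  by apply: spanP_coef; apply: (op_stable (op_valP A) hP hs).
have [c hc] := choice hA.
pose k := size (undup s); pose p0 : smonom n * 'rV[int]_n := (onecm _, 0).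
exists k, (fun i : 'I_k => fbas F (nth p0 (undup s) i).1 (nth p0 (undup s) i).2).
exists (fun (i : 'I_k) m => if m is Posz j then c j (nth p0 (undup s) i) else 0).
split=> [i|[m|m]]; first by exists 0; case.
  by rewrite /ser hc (big_nth p0) big_mkord.
by rewrite big1 // => i _; rewrite scale0r.
Qed.

(** The stable subspaces around u and v are spanned by finitely many basis vectors, so the
    truncation bounds of the finitely many pairs have a minimum. *)
Lemma vop_bounded (Y : fk -> fk -> int -> fk) :
  (forall m, bilin (fun u v => Y u v m)) -> (forall u v, laurent (Y u v)) ->
  forall u v, exists (N : int) (P Q : fk -> Prop),
  [/\ subspace P /\ (forall x w, P w -> P (modes x w)),
      subspace Q /\ (forall x w, Q w -> Q (modes x w)), P u, Q v &
      forall u' v' c, P u' -> Q v' -> c < N -> Y u' v' c = 0].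
Proof.
move=> hb hl u v; have [s [hu hP hPs]] := stable_span u.
have [t [hv hQ hQs]] := stable_span v.
have [N hN] : exists N : int, forall p q c, p \in s -> q \in t -> c < N ->
    Y (fbas F p.1 p.2) (fbas F q.1 q.2) c = 0.
  elim: s {hu hP hPs} => [|p s [N IH]]; first by exists 0.
  have [N' hN'] : exists N' : int, forall q c, q \in t -> c < N' ->
      Y (fbas F p.1 p.2) (fbas F q.1 q.2) c = 0.
    elim: t {hv hQ hQs IH} => [|q t [N' IH]]; first by exists 0.
    have [N2 h2] := hl (fbas F p.1 p.2) (fbas F q.1 q.2).
    exists (Num.min N' N2) => q' c; rewrite inE => /orP[/eqP ->|hq] hc.
      by apply: h2; lia.
    by apply: IH => //; lia.
  exists (Num.min N N') => p' q c; rewrite inE => /orP[/eqP ->|hp] hq hc.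
    by apply: hN' => //; lia.
  by apply: IH => //; lia.
exists N, (spanP (fun M b => (M, b) \in s)), (spanP (fun M b => (M, b) \in t)).
split=> // u' v' c hu' hv' hc.
apply: (hu' (fun u' => Y u' v' c = 0)).
  split=> [|a x y hx hy]; first exact: (linear0 ((hb c).1 v')).
  by rewrite (hb c).1 hx hy scaler0 addr0.
move=> M b hM; apply: (hv' (fun v' => Y (fbas F M b) v' c = 0)).
  split=> [|a x y hx hy]; first exact: (linear0 ((hb c).2 _)).
  by rewrite (hb c).2 hx hy scaler0 addr0.
by move=> M' b' hM'; apply: (hN (M, b) (M', b')).
Qed.

End Modes.

Section ThetaPrimitive.
Variables (F : numFieldType) (V : lmodType F) (T : comfam V).
Variables (Y : V -> V -> int -> V) (hY : forall m, bilin (fun u v => Y u v m)).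
Implicit Types A B : opser T.

Lemma theta_1l B u v a b : theta Y 1 B u v a b = Y u (B v a) b.
Proof.
rewrite /theta (@fsum1 _ _ 0%N) => [|[|k] // _]; last first.
  rewrite big1 ?scaler0 // => i _.
  by rewrite op_derE op1E addnS scaler0 (linear0 ((hY _).1 _)).
rewrite expr0 scale1r subr0 op_der0 big_ord_recl big1 ?addr0 ?subn0 // => i _.
by rewrite op1E /= (linear0 ((hY _).1 _)).
Qed.

Lemma theta_sum_r1 A u v a b k :
  \sum_(i < a.+1) Y (op_der k A u i) (op_val (1 : opser T) v (a - i)%N) b =
  Y (op_der k A u a) v b.
Proof.
rewrite big_ord_recr /= subnn op1E big1 ?add0r // => i _.
by rewrite -(subnSK (ltn_ord i)) op1E (linear0 ((hY _).2 _)).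
Qed.

End ThetaPrimitive.

Section CoproductPhi.
Variables (F : numFieldType) (n : nat) (G : 'M[int]_n).
Local Notation fk := (fock F n).
Variable Y : fk -> fk -> int -> fk.
Hypotheses (hY : forall m, bilin (fun u v => Y u v m))
  (hYl : forall u v, laurent (Y u v)).
Hypothesis hcomm : forall i k u v c,
  fmode G (i, k) (Y u v c) - Y u (fmode G (i, k) v) c =
  \sum_(j < k.+1) 'C(k, j)%:R *: Y (fmode G (i, j : nat) u) v (c - (k - j)%N%:Z).

(** Summing the commutator formula over the modes gives [Phi(g)(x1), Y(u, x2)] = Y(Phi(g)(x1 - x2)u,
    x2): the binomial C(k, j) x2^(k-j) of the formula matches the Taylor expansion in x2. *)
Lemma coprod_phi g :
  coprod Y (phiop G g) [:: (phiop G g, 1); (1, phiop G g)].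
Proof.
move=> u v a b; rewrite big_cons big_seq1 /= theta_1l //.
have [N [P [Q [hP hQ hu hv h]]]] := vop_bounded G hY hYl u v.
have [K1 h1] := fmode_fin G u; have [K2 h2] := fmode_fin G v.
have [K3 h3] := fmode_fin G (Y u v b).
pose K := (absz (b - N)).+1; pose M := (K1 + K2 + K3 + K)%N.
have hM : b - M%:Z < N by rewrite /M /K; lia.
have hMu x : (M <= x.2)%N -> fmode G x u = 0 by move=> hx; apply: h1; lia.
have hMv x : (M <= x.2)%N -> fmode G x v = 0 by move=> hx; apply: h2; lia.
have hMY x : (M <= x.2)%N -> fmode G x (Y u v b) = 0 by move=> hx; apply: h3; lia.
apply/eqP; rewrite -subr_eq; apply/eqP.
rewrite (@thetaE _ _ (modes F G) Y N P Q u v hP hQ hu hv h _ _ _ _ _ hM).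
pose cf k : F := (-1) ^+ k * 'C(a + k, k)%:R.
(* The term of the mode b_i(k), k = q + j, in which b_i(j) acts on u and x2^q is split off. *)
pose S i j q : fk := (cf (q + j)%N * g (a + (q + j))%N%:Z 0 i * 'C(q + j, j)%:R) *:
  Y (fmode G (i, j) u) v (b - q%:Z).
transitivity (\sum_i \sum_(j < M) \sum_(q < M) S i j q).
  rewrite (phiopE _ _ hMY) (phiopE _ _ hMv) (linear_sumf _ _ _ ((hY _).2 _)) -sumrB.
  apply: eq_bigr => i _.
  rewrite sum_tri_square => [|j q hjq]; last first.
    rewrite /S; case: (leqP K1 j) => hj.
      by rewrite h1 // (linear0 ((hY _).1 _)) scaler0.
    have hP' : P (fmode G (i, j) u) by apply: (hP.2 (i, j)).
    by rewrite (h _ _ _ hP' hv) ?scaler0 //; move: hjq; rewrite /M /K; lia.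
  rewrite (linear_sumf _ _ _ ((hY _).2 _)) -sumrB; apply: eq_bigr => k _.
  rewrite (linearZf ((hY _).2 _)) -scalerBr hcomm scaler_sumr.
  apply: eq_bigr => j _; rewrite /S scalerA subnK ?leq_ord //.
transitivity (\sum_(q < M) \sum_i \sum_(j < M) S i j q).
  rewrite [RHS]exchange_big; apply: eq_bigr => i _ /=.
  exact: exchange_big.
apply: eq_bigr => q _; rewrite theta_sum_r1 // op_derE (phiopE _ _ hMu).
rewrite (linearZf ((hY _).1 _)) scalerA (linear_sumf _ _ _ ((hY _).1 _)) scaler_sumr.
apply: eq_bigr => i _; rewrite (linear_sumf _ _ _ ((hY _).1 _)) scaler_sumr.
apply: eq_bigr => j _; rewrite (linearZf ((hY _).1 _)) scalerA /S.
move: (Y _ _ _) => w; congr (_ *: w).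
have /(congr1 (fun k => k%:R : F)) := bin_trinomial a q j.
rewrite /cf addnA !natrM exprD => e.
move: e ((-1) ^+ q : F) ((-1) ^+ j : F) (g _ 0 i) => + x y z.
move: ('C(a + q, q)%:R : F) ('C(a + q + j, j)%:R : F) ('C(q + j, j)%:R : F) => c1 c2 c3.
move: ('C(a + q + j, q + j)%:R : F) => c4 e.
by transitivity (x * y * z * (c4 * c3)); [ring|rewrite -e; ring].
Qed.

End CoproductPhi.

(** * The module structure Y_M^f *)

Section ModuleStructure.
Variables (F : numFieldType) (n : nat) (G : 'M[int]_n).
Local Notation fk := (fock F n).
Local Notation ops := (opser (modes F G)).
Variable f : 'rV[F]_n -> int -> 'rV[F]_n.
Hypotheses (f_linear : forall m, linear (fun a => f a m))
  (f_pos : forall a m, m <= 0 -> f a m = 0).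
Implicit Types (al : 'rV[int]_n).

Definition phih (h : 'rV[F]_n) : ops := phiop G (f h).

Lemma phih_linear : linear phih.
Proof.
move=> c h h'; rewrite /phih -phiop_linear; congr phiop.
by apply/funext => m; apply: f_linear.
Qed.

Lemma phih_fil h : fil_deg (@degfil F n) 1 (phih h).
Proof. by apply: phiop_fil; apply: f_pos. Qed.

(** Differentiation commutes with Phi, so derivatives of Phi(g) are again of this form and
    [coprod_phi] applies to them. Only nonnegative coefficients of g enter [phiop], hence the value
    0 at negative exponents is harmless. *)
Lemma op_der_phiop q g : op_der q (phiop G g : ops) =
  phiop G (fun m => if m is Posz j then 'C(j + q, q)%:R *: g (j + q)%N%:Z else 0).
Proof.
apply: opP => v m; have [K hK] := fmode_fin G v.
rewrite op_derE !(phiopE _ _ hK) scaler_sumr; apply: eq_bigr => i _.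
rewrite scaler_sumr; apply: eq_bigr => k _; move: (fmode _ _ v) => w.
rewrite scalerA mxE; congr (_ *: w).
have /(congr1 (fun k => k%:R : F)) := bin_trinomial m q k.
have -> : (m + k + q = m + q + k)%N by lia.
have /(congr1 (fun k => k%:R : F)) := bin_trinomial m k q.
rewrite [in X in _ -> X](_ : 'C(q + k, k) = 'C(k + q, q)); last first.
  by rewrite -bin_sub ?leq_addl // addnK addnC.
have -> : (m + k + q = m + q + k)%N by lia.
rewrite (addnC k q) !natrM; move: (g _ 0 i) ((-1) ^+ k : F) => x y.
move: ('C(m + k, k)%:R : F) ('C(m + q + k, q)%:R : F) => c1 c2.
move: ('C(m + q + k, q + k)%:R : F) ('C(q + k, q)%:R : F) => c3 c4.
move: ('C(m + q, q)%:R : F) ('C(m + q + k, k)%:R : F) => c5 c6 e1 e2.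
by transitivity (y * x * (c5 * c6)); [ring|rewrite e2 -e1; ring].
Qed.

(* The images of b_i(-m-1), for x = (i, m), and of e^al under Y_M^f. *)
Definition xop (x : 'I_n * nat) : ops :=
  op_der x.2 (op_der 1 (phih (delta_mx 0 x.1))).
Definition eop al : ops := op_exp (phih (hvec F al)).

Lemma eopD (a b : 'rV[int]_n) : eop (a + b) = eop a * eop b.
Proof.
rewrite -(op_expD (degfilP F G)); try exact: phih_fil.
by rewrite /eop -(linearDf phih_linear) /hvec map_mxD.
Qed.

Lemma eop0 : eop 0 = 1.
Proof.
rewrite /eop; have -> : hvec F (0 : 'rV[int]_n) = 0 by apply: map_mx0.
by rewrite (linear0 phih_linear) (op_exp0 (degfilP F G)).
Qed.

Definition ym : fk -> ops := fock_eval (U := ops) *%R xop eop.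

Lemma ym_linear : linear ym.
Proof. exact: fock_eval_linear. Qed.

Lemma ymM u v : ym (fmul u v) = ym u * ym v.
Proof.
apply: fock_evalM; [exact: opmul_bilin|exact: eopD].
Qed.

Lemma ym_e al : ym (fe F al) = eop al.
Proof. exact: (fock_eval_e (U := ops)). Qed.

Lemma ym1 : ym (fe F 0) = 1.
Proof. by rewrite ym_e eop0. Qed.

Lemma ym_x x : ym (fx F x) = xop x.
Proof. by apply: fock_eval_x; exact: eop0. Qed.

Lemma hvec_sum (a : 'rV[int]_n) : hvec F a = \sum_i ((a 0 i)%:~R : F) *: delta_mx 0 i.
Proof. by rewrite {1}(row_sum_delta (hvec F a)); apply: eq_bigr => i _; rewrite mxE. Qed.

(** On e^a this is (exp Phi)' = Phi' exp Phi, where Phi' is the image of a(-1); on the variables it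
    holds by the choice of [xop]. The Leibniz rule on both sides gives the rest. *)
Lemma ym_der u : ym (fder u) = op_der 1 (ym u).
Proof.
have hd := @op_der_linear F fk (modes F G) 1; have hy := ym_linear.
move: u; apply: fock_gen_ind => [c u v hu hv|a|[i m]|u v hu hv].
- by rewrite fder_linear !hy hd hu hv.
- rewrite fder_e ymM ym_e (op_der1_exp (degfilP F G)); last exact: phih_fil.
  rewrite mulrC -/(eop a); congr (_ * _).
  rewrite hvec_sum (linear_sumf _ _ _ phih_linear).
  rewrite (linear_sumf _ _ _ hd) (linear_sumf _ _ _ hy); apply: eq_bigr => i _.
  by rewrite (linearZf hy) ym_x /xop op_der0 (linearZf phih_linear) (linearZf hd).
- rewrite fder_x (linearZf hy) !ym_x /xop [in RHS]op_der_comp /=.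
  by rewrite add1n binSn.
by rewrite fderM (linearDf hy) !ymM hu hv op_der1M.
Qed.

Lemma ym_dpow p u : ym (dpow (@fder F n) p u) = op_der p (ym u).
Proof.
rewrite (dpow_morph _ _ ym_linear ym_der); move: (ym u) => A.
elim: p => [|p IH]; first by rewrite dpow0 op_der0.
have h0 : p.+1%:R != 0 :> F by rewrite pnatr_eq0.
have e : p.+1%:R / (p.+1)`!%:R = (p`!)%:R^-1 :> F.
  by rewrite factS natrM invfM mulVKf.
apply: (scalerI h0); have := op_der_comp 1 p A.
rewrite add1n binSn => <-; rewrite -IH /dpow scalerA e.
exact/esym/(linearZf (@op_der_linear _ _ _ 1)).
Qed.

Definition YM (h : fk) : fk -> int -> fk := ser (ym h).

Lemma YM_module : is_module (BL F n) YM.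
Proof.
split.
- move=> m; split=> [v|u]; last exact: ser_linear.
  exact: (linear_comp ym_linear (ser_linear_op v m)).
- by move=> u w; exists 0 => m; exact: ser_neg.
- by move=> w; rewrite BL_vacE /YM ym1 ser1.
apply: fock_weak_assoc.
- by move=> u m; exact: ser_linear.
- by move=> w m; rewrite /YM (linear0 ym_linear) (linear0 (ser_linear_op w m)).
- by move=> u w m; exact: ser_neg.
- by move=> u v w m; rewrite /YM ser_scomp ymM.
move=> p u w m; rewrite /YM ym_dpow; case: m => [m|m].
  by rewrite /ser op_derE -PoszD ibin_nat.
case: (ltP (Negz m + p%:Z) 0) => h; first by rewrite !ser_neg ?scaler0.
have [q hq] : exists q : nat, Negz m + p%:Z = q%:Z.
  by exists (absz (Negz m + p%:Z)); lia.
rewrite hq ser_neg // ibin_nat bin_small ?scale0r //.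
lia.
Qed.

Lemma YM_e (a : 'rV[int]_n) : YM (fe F a) = sexp (Phi G (f (hvec F a))).
Proof.
rewrite /YM ym_e /eop -(ser_exp (degfilP F G)); last exact: phih_fil.
rewrite ser_phiop //; exact: f_pos.
Qed.

Lemma op_exp_vac (A : ops) v m : (forall m, A v m = 0) -> fil_deg (@degfil F n) 1 A ->
  op_exp A v m = op_val (1 : ops) v m.
Proof.
move=> hA hn; rewrite (op_exp_fun (degfilP F G)) // /exp_fun (@fsum1 _ _ 0%N).
  by rewrite expr0 fact0 invr1 scale1r.
move=> [|k] // _; rewrite exprSr opME big1 ?scaler0 // => j _.
by rewrite hA (linear0 (opval_linear _ _)).
Qed.

(** The nonnegative modes annihilate the vacuum, so exponentials fix it and the images of the
    variables annihilate it, as the counit prescribes. *)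
Lemma ym_vac h m : ym h (fe F 0) m = op_val (fcounit h *: (1 : ops)) (fe F 0) m.
Proof.
have he := @fcounit_linear F n.
move: h m; apply: fock_gen_ind => [c u v hu hv m|a m|x m|u v hu hv m].
- by rewrite ym_linear he opDE opZE hu hv !opZE scalerDl scalerA.
- rewrite ym_e fcounit_e scale1r; apply: op_exp_vac; last exact: phih_fil.
  by move=> j; apply: phiop_vac.
- rewrite ym_x fcounit_x scale0r op0E /xop !op_derE.
  by rewrite [phih _ _ _]phiop_vac !scaler0.
rewrite ymM fcounitM opME.
under eq_bigr => j _ do rewrite hv opZE (linearZf (opval_linear _ _)).
rewrite -scaler_sumr -opME mulr1 hu !opZE scalerA mulrC.
by [].
Qed.

Lemma YM_vac h : YM h (fe F 0) = cst_series (fcounit h *: fe F 0).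
Proof.
apply/funext => -[m|m] //; rewrite /YM /ser ym_vac opZE op1E /cst_series.
by case: m => [|m] //; rewrite scaler0.
Qed.

(** * Action on products Y(u, x)v *)

Section Action.
Variable Y : fk -> fk -> int -> fk.
Hypotheses (hY : forall m, bilin (fun u v => Y u v m))
  (hYl : forall u v, laurent (Y u v)).
Hypothesis hcomm : forall i k u v c,
  fmode G (i, k) (Y u v c) - Y u (fmode G (i, k) v) c =
  \sum_(j < k.+1) 'C(k, j)%:R *: Y (fmode G (i, j : nat) u) v (c - (k - j)%N%:Z).

Let hT := vop_bounded G hY hYl.

Lemma ym_theta_bilin u v a b :
  bilin (fun h1 h2 => theta Y (ym h1) (ym h2) u v a b).
Proof.
exact: (bilin_comp (theta_bilin (T := modes F G) hY hT u v a b) ym_linear ym_linear).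
Qed.

(** The e^a act by exponentials of primitive series, hence are grouplike; the variables act by
    derivatives of such series, again primitive; and the property passes to products. This matches
    the coproduct of B_L. *)
Lemma ym_coprod h u v a b : ym h (Y u v b) a =
  tlift (fun h1 h2 => theta Y (ym h1) (ym h2) u v a b) (fcomul h).
Proof.
move: h u v a b; apply: fock_gen_ind => [c h h' hu hv|e|x|h h' hu hv] u v a b;
  have hB := ym_theta_bilin.
- rewrite ym_linear opDE opZE hu hv.
  by rewrite fcomul_linear (tlift_linear (hB u v a b)).
- rewrite fcomul_e (tliftE _ _ (hB u v a b)) ym_e /=.
  have := coprod_exp (T := modes F G) hY hT (degfilP F G) (phih_fil (hvec F e)) (coprod_phi hY hYl hcomm _).
  by move=> /(_ u v a b); rewrite big_seq1.
- rewrite fcomul_x (linearDf (tlift_linear (hB u v a b))).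
  rewrite !(tliftE _ _ (hB u v a b)) ym_x ym1 /xop /phih !op_der_phiop.
  have := coprod_phi hY hYl hcomm _.
  by move=> /(_ _ u v a b) ->; rewrite big_cons big_seq1.
have hA : coprod Y (ym h) [seq (ym p.1, ym p.2) | p <- repr (fcomul h)].
  by move=> u' v' a' b'; rewrite hu big_map.
have hA' : coprod Y (ym h') [seq (ym p.1, ym p.2) | p <- repr (fcomul h')].
  by move=> u' v' a' b'; rewrite hv big_map.
rewrite ymM (coprodM (T := modes F G) hY hT hA hA') big_allpairs_dep big_map.
have hm := fmul_bilin F n.
rewrite fcomulM (tlift_tmul hm hm _ _ (hB u v a b)) /tlift; apply: eq_bigr => p _.
by rewrite big_map; apply: eq_bigr => q _; rewrite /= !ymM.
Qed.

(** Identifies the expansion of (x1 - x2)^m used in the definition of a module vertex algebra with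
    the Taylor expansion in [theta]: for m = i + k the coefficient C(m, k) is that of the k-th
    divided derivative at x1^i. *)
Lemma theta_int (A B : ops) u v (a b : int) :
  \sum_(mk \in [set: int * nat]) (ibin F mk.1 mk.2 * (-1) ^+ mk.2) *:
     Y (ser A u mk.1) (ser B v (a - mk.1 + mk.2%:Z)) (b - mk.2%:Z) =
  if a is Posz a0 then theta Y A B u v a0 b else 0.
Proof.
have z m (k : nat) (c : int) : (m < 0) || (m < k%:Z) || (a - m + k%:Z < 0) ->
    (ibin F m k * (-1) ^+ k) *: Y (ser A u m) (ser B v (a - m + k%:Z)) c = 0.
  case/orP => [/orP[hm|hm]|hm].
  - by rewrite ser_neg // (linear0 ((hY _).1 _)) scaler0.
  - case: m hm => m hm; last by rewrite ser_neg // (linear0 ((hY _).1 _)) scaler0.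
    by rewrite ibin_nat bin_small ?mul0r ?scale0r.
  by rewrite [ser B v _]ser_neg // (linear0 ((hY _).2 _)) scaler0.
case: a z => a z; last first.
  by rewrite fsbig1 // => -[m k] _ /=; apply: z; lia.
have [N [P [Q [hP hQ hu hv h]]]] := hT u v.
pose K := (absz (b - N)).+1.
have hK : b - K%:Z < N by rewrite /K; lia.
rewrite (@thetaE _ _ (modes F G) Y N P Q u v hP hQ hu hv h _ _ _ _ _ hK).
(* Besides k < K, a nonzero term needs k <= m and m - k <= a, hence the parametrisation m = i + k
   with i <= a. *)
pose s := [seq ((i + k)%N%:Z, k) | k <- iota 0 K, i <- iota 0 a.+1].
have us : uniq s.
  apply: allpairs_uniq; rewrite ?iota_uniq // => -[k i] [k' i'] _ _ /= [] hi hk.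
  by rewrite hk in hi *; congr (_, _); lia.
rewrite (fsum_seq us) => [|[m k] hmk /=].
  have big_iota k (g : nat -> fk) : \sum_(i <- iota 0 k) g i = \sum_(i < k) g i.
    by rewrite -(big_mkord xpredT g) /index_iota subn0.
  rewrite big_allpairs_dep big_iota; apply: eq_bigr => k _.
  rewrite big_iota scaler_sumr; apply: eq_bigr => i _; cbn [fst snd].
  have hi := ltn_ord i.
  have -> : a%:Z - (i + k)%N%:Z + k%:Z = (a - i)%N%:Z by lia.
  rewrite /ser ibin_nat op_derE (linearZf ((hY _).1 _)) scalerA mulrC.
  by [].
case: (ltnP k K) => hk; last first.
  rewrite (h _ _ _ _ _ (_ : b - k%:Z < N)) ?scaler0 //; last by lia.
    case: m {hmk} => m /=; last exact: hP.1.1.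
    by apply: (op_stable (op_valP A)) => //; [exact: hP.1|exact: hP.2].
  case: (a%:Z - m + k%:Z) => j /=; last exact: hQ.1.1.
  by apply: (op_stable (op_valP B)) => //; [exact: hQ.1|exact: hQ.2].
apply: z; apply: contraR hmk; rewrite !negb_or -!leNgt => /andP[/andP[h1 h2] h3].
apply/allpairsP; exists (k, absz (m - k%:Z)); split.
- by rewrite mem_iota.
- by rewrite mem_iota /=; lia.
by congr (_, _) => /=; lia.
Qed.

Lemma YM_vop h u v a b : YM h (Y u v b) a =
  tlift (fun h1 h2 => \sum_(mk \in [set: int * nat])
     (ibin F mk.1 mk.2 * (-1) ^+ mk.2) *:
     Y (YM h1 u mk.1) (YM h2 v (a - mk.1 + mk.2%:Z)) (b - mk.2%:Z))
    (fcomul h).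
Proof.
rewrite /tlift; under eq_bigr => p _ do rewrite /YM theta_int.
case: a => a; last by rewrite big1.
by rewrite /YM /ser ym_coprod.
Qed.

End Action.

End ModuleStructure.

(** * Uniqueness, inverse and compatibility *)

Section BLModules.
Variables (F : numFieldType) (n : nat).
Local Notation fk := (fock F n).

Lemma fmul_e (a b : 'rV[int]_n) : fmul (fe F a) (fe F b) = fe F (a + b).
Proof. by rewrite /fe fmulE mulcm0. Qed.

Lemma fx0 (i : 'I_n) : fx F (i, 0%N) =
  fmul (fder (fe F (delta_mx 0 i))) (fe F (- delta_mx 0 i)).
Proof.
rewrite fder_e -fmulA fmul_e subrr fmulr1 (bigD1 i) //= mxE !eqxx scale1r.
rewrite big1 ?addr0 // => j /negbTE hj.
by rewrite mxE hj andbF scale0r.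
Qed.

(* The vertex algebra B_L is generated by the e^a, since                      *)
(* alpha(-1) = (d e^alpha) e^(-alpha).                                        *)
Lemma BL_module_ext (W : lmodType F) (Y1 Y2 : fk -> W -> int -> W) :
  is_module (BL F n) Y1 -> is_module (BL F n) Y2 ->
  (forall a : 'rV[int]_n, Y1 (fe F a) = Y2 (fe F a)) -> Y1 = Y2.
Proof.
move=> h1 h2 he.
have [b1 l1 v1 a1] := h1; have [b2 l2 v2 a2] := h2.
have neg u v m : m < 0 -> vop (BL F n) u v m = 0 by exact: BL_vopN.
have r1 := regular_module b1 l1 neg a1; have r2 := regular_module b2 l2 neg a2.
have hM u v : Y1 u = Y2 u -> Y1 v = Y2 v -> Y1 (fmul u v) = Y2 (fmul u v).
  move=> hu hv; apply/funext => w; apply/funext => c.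
  (* The coefficient of x0^0 says Y(u, x)Y(v, x) = Y(uv, x). *)
  have [_ /(_ 0%N c)] := r1 u v w; have [_ /(_ 0%N c)] := r2 u v w.
  by rewrite !BL_vop !dpow0 hu hv => <- <-.
have hD u : Y1 u = Y2 u -> Y1 (fder u) = Y2 (fder u).
  move=> hu; apply/funext => w; apply/funext => c.
  (* With the vacuum as second factor, the coefficient of x0^1 expresses Y(du, x) through Y(u,
     x). *)
  have [_ /(_ 1%N c)] := r1 u (vac (BL F n)) w.
  have [_ /(_ 1%N c)] := r2 u (vac (BL F n)) w.
  rewrite v1 v2 hu => e2 e1.
  have := esym e1; rewrite e2 BL_vop BL_vacE fmulr1 /dpow /=.
  by rewrite (_ : 1`! = 1%N) // invr1 scale1r => ->.
apply/funext; apply: fock_gen_ind => [c u v hu hv|a|[i m]|].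
- apply/funext => w; apply/funext => m.
  by rewrite (b1 m).1 (b2 m).1 hu hv.
- exact: he.
- elim: m => [|m IH]; first by rewrite fx0; apply: hM; [apply: hD|]; apply: he.
  have h0 : m.+1%:R != 0 :> F by rewrite pnatr_eq0.
  have -> : fx F (i, m.+1) = (m.+1%:R)^-1 *: fder (fx F (i, m)) :> fk.
    by rewrite fder_x scalerA mulVf // scale1r.
  apply/funext => w; apply/funext => c.
  by rewrite (linearZf ((b1 c).1 w)) (linearZf ((b2 c).1 w)) (hD _ IH).
exact: hM.
Qed.

(** * The convolution inverse *)

Section Convolution.
Variables (G : 'M[int]_n) (f f' : 'rV[F]_n -> int -> 'rV[F]_n).
Hypotheses (f_linear : forall m, linear (fun a => f a m))
  (f_pos : forall a m, m <= 0 -> f a m = 0)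
  (f'_linear : forall m, linear (fun a => f' a m))
  (f'_pos : forall a m, m <= 0 -> f' a m = 0)
  (ff' : forall a m, f' a m = - f a m).
Local Notation ops := (opser (modes F G)).

Lemma phih_opp h : phih G f' h = - phih G f h.
Proof.
apply/eqP; rewrite -subr_eq0 opprK; apply/eqP.
rewrite /phih -[phiop G (f' h)]scale1r -phiop_linear.
apply: opP => v m; have [K hK] := fmode_fin G v.
rewrite (phiopE _ _ hK) op0E big1 // => i _; rewrite big1 // => k _.
by rewrite ff' scale1r addNr mxE mulr0 scale0r.
Qed.

(** Both sides are multiplicative in h, the operator ring being commutative. On e^a the two
    exponentials cancel; on a variable the two primitive terms do. *)
Lemma ym_inverse h :
  tlift (fun h1 h2 => ym G f h1 * ym G f' h2) (fcomul h) = fcounit h *: (1 : ops).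
Proof.
have hB : bilin (fun h1 h2 : fk => ym G f h1 * ym G f' h2).
  exact: (bilin_comp (@opmul_bilin F fk (modes F G)) (ym_linear G f) (ym_linear G f')).
move: h; apply: fock_gen_ind => [c u v hu hv|a|x|u v hu hv].
- by rewrite fcomul_linear (tlift_linear hB) hu hv fcounit_linear scalerDl scalerA.
- rewrite fcomul_e (tliftE _ _ hB) !ym_e fcounit_e scale1r /eop.
  rewrite -(op_expD (degfilP F G)); try exact: phih_fil.
  by rewrite phih_opp subrr (op_exp0 (degfilP F G)).
- rewrite fcomul_x (linearDf (tlift_linear hB)) !(tliftE _ _ hB).
  rewrite !ym1 // !ym_x // mulr1 mul1r fcounit_x scale0r /xop phih_opp.
  by rewrite !(linearNf (@op_der_linear _ _ _ _)) subrr.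
have hm := fmul_bilin F n.
have [b1 b2] := @opmul_bilin F fk (modes F G).
have -> : fcounit (fmul u v) *: (1 : ops) =
    (fcounit u *: (1 : ops) : ops) * (fcounit v *: (1 : ops) : ops).
  by rewrite (linearZf (b1 _)) mul1r scalerA fcounitM.
rewrite -hu -hv fcomulM (tlift_tmul hm hm _ _ hB) /tlift mulr_suml.
apply: eq_bigr => p _; rewrite mulr_sumr; apply: eq_bigr => q _.
rewrite (ymM G f_linear f_pos) (ymM G f'_linear f'_pos); exact: mulrACA.
Qed.

Lemma conv_YM : conv (BL F n) (YM G f) (YM G f') = Yeps (BL F n).
Proof.
apply/funext => h; apply/funext => v; apply/funext => m.
rewrite /conv /Yeps BL_comulE BL_counitE.
transitivity (ser (tlift (fun h1 h2 => ym G f h1 * ym G f' h2) (fcomul h)) v m).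
  rewrite /tlift (linear_sumf _ _ _ (ser_linear_op v m)).
  by apply: eq_bigr => p _; rewrite /YM ser_scomp.
rewrite ym_inverse (linearZf (ser_linear_op v m)) ser1 /cst_series.
by case: ifP => // _; rewrite scaler0.
Qed.

End Convolution.
End BLModules.

(** * Slices of tensors *)

Section TensorCoefficients.
Variables (F : numFieldType) (n : nat) (V : lmodType F).
Local Notation fk := (fock F n).

Lemma mcoeff_linear (q : smonom n * 'rV[int]_n) : linear (fun v : fk => v@_q : F^o).
Proof. by move=> a u v; rewrite mcoeffD mcoeffZ. Qed.

Lemma slice_bilin (phi : fk -> F^o) : linear phi ->
  bilin (fun (w : V) (h : fk) => phi h *: w).
Proof.
move=> hp; split=> [h|w] a x y; last by rewrite hp scalerDl scalerA.
by rewrite scalerDr !scalerA mulrC.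
Qed.

(** Slices by linear functionals separate tensors: finitely many basis vectors occur in the right
    factors, and their coefficient functionals recover the tensor. *)
Lemma tens_slice_ext (s t : tensor V fk) :
  (forall phi : fk -> F^o, linear phi ->
     tlift (fun w h => phi h *: w) s = tlift (fun w h => phi h *: w) t) -> s = t.
Proof.
move=> hst.
have [t1 t2] := tens_bilin V fk.
have [D hD] : exists D : {fset (smonom n * 'rV[int]_n)%type},
    forall p, p \in repr s ++ repr t -> (msupp p.2 `<=` D)%fset.
  elim: (repr s ++ repr t) => [|p r [D IH]]; first by exists fset0.
  exists (msupp p.2 `|` D)%fset => p'; rewrite inE => /orP[/eqP ->|hp].
    exact: fsubsetUl.
  exact: fsubset_trans (IH _ hp) (fsubsetUr _ _).
have E (u : tensor V fk) : {subset repr u <= repr s ++ repr t} ->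
    u = \sum_(q <- D) tens (tlift (fun w h => (h@_q : F^o) *: w) u) (fbas F q.1 q.2).
  move=> hu; rewrite {1}(tens_sum u).
  under [RHS]eq_bigr => q _ do rewrite /tlift (linear_sumf _ _ _ (t1 _)).
  rewrite exchange_big; apply: eq_big_seq => p hp /=.
  under eq_bigr => q _ do rewrite (linearZf (t1 _)) -(linearZf (t2 _)).
  rewrite -(linear_sumf _ _ _ (t2 _)); congr (tens _ _).
  rewrite {1}(fock_sum p.2); apply: big_fset_incl; first exact/hD/hu.
  by move=> q _ hq; rewrite mcoeff_outdom // scale0r.
rewrite (E s) => [|p hp]; last by rewrite mem_cat hp.
rewrite (E t) => [|p hp]; last by rewrite mem_cat hp orbT.
by apply: eq_bigr => q _; rewrite (hst _ (mcoeff_linear q)).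
Qed.

End TensorCoefficients.

(** * The lattice vertex algebra and its coaction *)

Section LatticeVA.
Variables (F : numFieldType) (n : nat) (G : 'M[int]_n)
  (eps : 'rV[int]_n -> 'rV[int]_n -> F) (VL : preva (fock F n)).
Hypothesis hVL : is_lattice_va G eps VL.
Local Notation fk := (fock F n).

Lemma VL_fmode (i : 'I_n) (k : nat) v :
  vop VL (fock_h (delta_mx 0 i) 0) v (-1 - k%:Z) = fmode G (i, k) v.
Proof.
rewrite (lattice_va_h hVL) fmode.unlock.
by have -> : - (-1 - k%:Z) - 1 = k%:Z by lia.
Qed.

Lemma VL_commutator i k u v c :
  fmode G (i, k) (vop VL u v c) - vop VL u (fmode G (i, k) v) c =
  \sum_(j < k.+1) 'C(k, j)%:R *:
     vop VL (fmode G (i, j : nat) u) v (c - (k - j)%N%:Z).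
Proof.
rewrite -!VL_fmode (va_commutator (lattice_va_va hVL)).
by apply: eq_bigr => j _; rewrite VL_fmode.
Qed.

Lemma VL_vac : vac VL = fe F 0.
Proof. by rewrite (lattice_va_vac hVL) fock1_fe. Qed.

Variable rho : fk -> tensor fk fk.
Hypothesis hrho : is_lattice_coaction VL rho.

Let hom := comodule_hom (lattice_coaction_comodule hrho).
Let rho_linear := va_hom_linear hom.
Let VLn : is_nlva VL := (lattice_va_va hVL).1.

(** Needed to evaluate [tlift] on pure tensors. The sum over j is finite since Y(u, x)v is truncated
    below and B_L has no negative powers. *)
Lemma tensor_va_termbilin v k m : bilin (fun u h : fk =>
  \sum_(j \in [set: int]) tens (vop VL u v j) (vop (BL F n) h k (m - j))).
Proof.
have [t1 t2] := tens_bilin fk fk.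
have fs u h : fsupp (fun j => tens (vop VL u v j) (vop (BL F n) h k (m - j))).
  have [N hN] := nlva_laurent VLn u v.
  apply: (@fsupp_int _ N m) => j hj; first by rewrite hN // (linear0 (t1 _)).
  by rewrite BL_vopN ?(linear0 (t2 _)) //; lia.
have fsZ c u h : fsupp (fun j =>
    c *: tens (vop VL u v j) (vop (BL F n) h k (m - j))).
  by apply: (fsupp_map (h := fun _ x => c *: x)) => // j; rewrite scaler0.
have sumZ c u h : c *: (\sum_(j \in [set: int])
     tens (vop VL u v j) (vop (BL F n) h k (m - j))) =
   \sum_(j \in [set: int]) c *: tens (vop VL u v j) (vop (BL F n) h k (m - j)).
  apply: fsum_linear; last exact: fs.
  by move=> x y; rewrite scalerBr.
split=> [h|u] c x y; rewrite sumZ -fsumD //; apply: eq_fsbigr => j _.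
  by rewrite (nlva_bilin VLn j).1 t1.
by rewrite (@BL_bilin F n _).1 t2.
Qed.

(** Since rho(b_i) = b_i (x) 1 + 1 (x) b_i(-1), only the first summand contributes to the mode
    b_i(k), k >= 0: the vertex operators of B_L have no coefficient at x^(-1-k). *)
Lemma rho_fmode i k v :
  rho (fmode G (i, k) v) = tmap (fmode G (i, k)) id (rho v).
Proof.
have [t1 t2] := tens_bilin fk fk.
rewrite -VL_fmode (va_hom_vop hom) (lattice_coaction_h hrho).
set hh := fock_h (delta_mx 0 i) 0; set m := -1 - k%:Z.
pose E v k' u h := \sum_(j \in [set: int])
   tens (vop VL u v j) (vop (BL F n) h k' (m - j)).
have hE v' k' : bilin (E v' k') by exact: tensor_va_termbilin.
pose B (t : tensor fk fk) u h := tlift (fun v k' => E v k' u h) t.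
have hB t : bilin (B t) by apply: bilin_sum => q; apply: hE.
have -> s t : vop (tensor_va VL (BL F n)) s t m = tlift (B t) s by [].
have vB x : vop (BL F n) (fe F 0) x = cst_series x.
  by rewrite -BL_vacE; exact: nlva_vacl (BL_nlva F n) x.
have vV x : vop VL (fe F 0) x = cst_series x.
  by rewrite -VL_vac; exact: nlva_vacl VLn x.
have E1 x y : E x y hh (fe F 0) = tens (fmode G (i, k) x) y.
  transitivity (tens (vop VL hh x m) (vop (BL F n) (fe F 0) y (m - m))).
    apply: fsum1 => j hj; rewrite vB /cst_series ifF ?(linear0 (t2 _)) //.
    by apply/negbTE; rewrite subr_eq0 eq_sym.
  by rewrite vB subrr /cst_series eqxx VL_fmode.
have E2 x y : E x y (fe F 0) hh = 0.
  transitivity (tens (vop VL (fe F 0) x 0) (vop (BL F n) hh y (m - 0))).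
    by apply: fsum1 => j /negbTE hj; rewrite vV /cst_series hj (linear0 (t1 _)).
  by rewrite [vop _ hh _ _]BL_vopN ?(linear0 (t2 _)) // /m; lia.
rewrite fock1_fe (linearDf (tlift_linear (hB _))).
rewrite (tliftE _ _ (hB _)) (tliftE _ _ (hB _)) /B /tlift -big_split.
by apply: eq_bigr => p _; rewrite E1 E2; exact: addr0.
Qed.

(** Composing rho with a functional on the right factor gives an endomorphism of V_L that commutes
    with the modes by [rho_fmode], hence with the coefficients of A, which lie in their bicommutant.
    Slices separate tensors. *)
Lemma rho_op (A : opser (modes F G)) v m :
  rho (A v m) = tmap (fun w => A w m) id (rho v).
Proof.
have hA := opval_linear A m.
apply: tens_slice_ext => phi hp.
have hb := slice_bilin fk hp.
pose h w := tlift (fun w h => phi h *: w) (rho w).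
have hl : linear h by exact: (linear_comp rho_linear (tlift_linear hb)).
have tm (B : fk -> fk) t : linear B ->
    tlift (fun w h => phi h *: w) (tmap B id t) = B (tlift (fun w h => phi h *: w) t).
  move=> hB; move: t; apply: tens_linear_ext.
  - exact: (linear_comp (tmap_linear hB (@linear_id _ _)) (tlift_linear hb)).
  - exact: (linear_comp (tlift_linear hb) hB).
  by move=> x y; rewrite tmapE // !(tliftE _ _ hb) (linearZf hB).
rewrite tm //; apply/esym/(op_bicomm (op_valP A) (h := h) hl).
move=> [i k] w; rewrite /h /= rho_fmode tm //.
exact: fmode_linear.
Qed.

Section Structure.
Variable f : 'rV[F]_n -> int -> 'rV[F]_n.
Hypotheses (f_linear : forall m, linear (fun a => f a m))
  (f_pos : forall a m, m <= 0 -> f a m = 0).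

Lemma YM_module_nlva : is_module_nlva (BL F n) VL (YM G f).
Proof.
split.
- exact: BL_nlvb.
- exact: VLn.
- exact: YM_module.
- by move=> h v; apply: op_laurent.
- by move=> h; rewrite VL_vac BL_counitE YM_vac.
move=> h u v a b; rewrite BL_comulE.
apply: YM_vop => //; first exact: nlva_bilin VLn.
  exact: nlva_laurent VLn.
exact: VL_commutator.
Qed.

Lemma YM_compatible : compatible rho (YM G f).
Proof.
move=> h v m; rewrite /YM; case: m => m; first exact: rho_op.
rewrite /= (linear0 rho_linear) /tmap /tlift big1 // => p _.
exact: (linear0 ((tens_bilin _ _).1 _)).
Qed.

End Structure.
End LatticeVA.

Theorem proposition5p7 (R : realType) (n : nat) (G : 'M[int]_n)
    (eps : 'rV[int]_n -> 'rV[int]_n -> R[i])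
    (VL : preva (fock R[i] n))
    (rho : fock R[i] n -> tensor (fock R[i] n) (fock R[i] n))
    (f : 'rV[R[i]]_n -> int -> 'rV[R[i]]_n) :
  nondeg_even_lattice G ->
  is_lattice_cocycle G eps ->
  is_lattice_va G eps VL ->
  is_lattice_coaction VL rho ->
  (forall m, linear (fun a => f a m)) ->
  (forall a m, m <= 0 -> f a m = 0) ->
  exists YM : fock R[i] n -> fock R[i] n -> int -> fock R[i] n,
    [/\ unique (fun Y => is_module (BL R[i] n) Y /\
                  forall a : 'rV[int]_n,
                    Y (fock_e R[i] a) = sexp (Phi G (f (hvec R[i] a)))) YM,
        is_module_va (BL R[i] n) VL YM,
        compatible rho YM &
        invertible_frakL (BL R[i] n) VL rho YM].
Proof.
move=> _ _ hVL hrho f_linear f_pos.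
pose f' a m := - f a m.
have f'_linear m : linear (fun a => f' a m).
  by move=> c a b; rewrite /f' f_linear opprD scalerN.
have f'_pos a m : m <= 0 -> f' a m = 0 by move=> hm; rewrite /f' f_pos ?oppr0.
have good : frakL (BL R[i] n) VL rho (YM G f).
  by split; [exact: (YM_module_nlva hVL)|exact: (YM_compatible hVL hrho)].
exists (YM G f); split.
- split=> [|Y [hY1 hY2]].
    split; first exact: YM_module.
    by move=> a; rewrite fock_e_fe YM_e.
  apply: BL_module_ext hY1 _; first exact: YM_module.
  by move=> a; rewrite YM_e // -hY2 fock_e_fe.
- by split; [exact: good.1|exact: BL_local|exact: (lattice_va_va hVL).2].
- exact: good.2.
split=> //; exists (YM G f'); split.
- by split; [exact: (YM_module_nlva hVL)|exact: (YM_compatible hVL hrho)].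
- exact: conv_YM.
(* The relation between f and its negative is symmetric, so the same lemma gives the other one-sided
   inverse. *)
by apply: conv_YM => // a m; rewrite /f' opprK.
Qed.
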